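(* Let $n\ge1$, let $[Z_0:\cdots:Z_n]$ be homogeneous coordinates on $\mathbb P^n$, and let $s=Z_0\cdots Z_n$, a holomorphic section of $\mathcal O(n+1)\to\mathbb P^n$, with $\|\cdot\|$ the Fubini–Study metric. Let $\omega$ be the quasi-meromorphic top form on $\mathbb P^n$ given in the coordinates $z_j=Z_j/Z_0$ by $$\omega=\frac{i^n}{2^n}\frac{\mathrm dz_1\wedge\mathrm d\bar z_1\wedge\cdots\wedge\mathrm dz_n\wedge\mathrm d\bar z_n}{|z_1\cdots z_n|^2}.$$ Then $$\mathrm{fp}\int_{\mathbb P^n}\omega=\frac{\pi^n}{n!}\,\frac{\mathrm d^n}{\mathrm d\lambda^n}\bigg(\frac{\lambda^n\,\Gamma(\lambda)^{n+1}}{\Gamma((n+1)\lambda)}\bigg)\bigg|_{\lambda=0},$$ where $\Gamma$ is the Euler gamma function.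
   Context: The Fubini–Study metric on $\mathcal O(n+1)$ satisfies $\|s\|^2=\frac{|Z_0\cdots Z_n|^2}{(|Z_0|^2+\cdots+|Z_n|^2)^{n+1}}$. The integral $\int_{\mathbb P^n}\|s\|^{2\lambda}\omega$ converges and is holomorphic in $\lambda$ for $\mathfrak{Re}\,\lambda\gg0$ and has a meromorphic continuation to $\mathbb C$; the finite part $\mathrm{fp}\int_{\mathbb P^n}\omega$ is by definition the constant term (coefficient of $\lambda^0$) of the Laurent expansion of this continuation at $\lambda=0$. The expression in brackets on the right-hand side is understood as holomorphic at $\lambda=0$ after removing the removable singularity. *)

(* Defs.v *)
From HB Require Import structures.
From mathcomp Require Import all_boot all_order all_algebra.
From mathcomp Require Import generic_quotient.
From mathcomp Require Import all_classical all_reals all_analysis.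
From mathcomp Require Import complex ring.

Set Implicit Arguments.
Unset Strict Implicit.
Unset Printing Implicit Defensive.

Import Order.TTheory GRing.Theory Num.Theory.
Import numFieldNormedType.Exports.

Local Open Scope classical_set_scope.
Local Open Scope ring_scope.

(* Typing the complex numbers as a numFieldType makes the topology and the    *)
(* complex derivative of MathComp-Analysis available on them.                 *)
Definition Cplx (R : realType) : numFieldType := R[i].

(* An alias of (m1 \x m2)%E that carries the sigma_finite_measure structure   *)
(* not inferred for (m1 \x m2)%E itself.                                      *)
Section ProdMeasure.
Context d1 d2 (T1 : measurableType d1) (T2 : measurableType d2) (R : realType).
Variable m1 : {sigma_finite_measure set T1 -> \bar R}.
Variable m2 : {sigma_finite_measure set T2 -> \bar R}.

Definition prod_measure : set (T1 * T2) -> \bar R := (m1 \x m2)%E.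

HB.instance Definition _ := Measure.on prod_measure.

Let prod_measure_sigma_finite : sigma_finite setT prod_measure.
Proof.
have /sigma_finiteP[F [TF ndF Foo]] := sigma_finiteT m1.
have /sigma_finiteP[G [TG ndG Goo]] := sigma_finiteT m2.
exists (fun k => F k `*` G k).
  apply/esym; rewrite -subTset => -[x y] _.
  have : [set: T1] x by [].
  rewrite TF => -[k _ Fk].
  have : [set: T2] y by [].
  rewrite TG => -[l _ Gl].
  exists (maxn k l) => //=; split => /=.
    by move: x Fk; exact/subsetPset/ndF/leq_maxl.
  by move: y Gl; exact/subsetPset/ndG/leq_maxr.
move=> k; have [? ?] := Foo k; have [? ?] := Goo k.
split; first exact: measurableX.
by rewrite /prod_measure product_measure1E// lte_mul_pinfty// ge0_fin_numE.
Qed.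

HB.instance Definition _ := Measure_isSigmaFinite.Build _ _ _ prod_measure
  prod_measure_sigma_finite.

End ProdMeasure.

Section TupleMeasure.
Context d (T : measurableType d) (R : realType).
Variable mu : {sigma_finite_measure set T -> \bar R}.

Definition cons_pair n (p : T * n.-tuple T) : n.+1.-tuple T :=
  [tuple of p.1 :: p.2].

Lemma measurable_cons_pair n : measurable_fun [set: T * n.-tuple T] (@cons_pair n).
Proof. exact: (measurable_cons measurable_fst measurable_snd). Qed.

Section Step.
Variables (n : nat) (m : {sigma_finite_measure set (n.-tuple T) -> \bar R}).

Definition cons_measure : set (n.+1.-tuple T) -> \bar R :=
  pushforward (mu \x m)%E (@cons_pair n).

Let cons_measure0 : cons_measure set0 = 0%E.
Proof. by rewrite /cons_measure /pushforward preimage_set0 measure0. Qed.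

Let cons_measure_ge0 A : (0 <= cons_measure A)%E.
Proof. by rewrite /cons_measure /pushforward measure_ge0. Qed.

Let measurable_pre A : measurable A -> measurable (@cons_pair n @^-1` A).
Proof.
by move=> mA; rewrite -[X in measurable X]setTI; exact: measurable_cons_pair.
Qed.

Let cons_measure_sigma_additive : semi_sigma_additive cons_measure.
Proof.
move=> F mF tF mUF; rewrite /cons_measure /pushforward preimage_bigcup.
apply: measure_semi_sigma_additive.
- by move=> k; exact: measurable_pre.
- apply/trivIsetP => /= i j _ _ ij; rewrite -preimage_setI.
  by move/trivIsetP : tF => /(_ _ _ _ _ ij) ->//; rewrite preimage_set0.
- by rewrite -preimage_bigcup; exact: measurable_pre.
Qed.

HB.instance Definition _ := isMeasure.Build _ _ _ cons_measure
  cons_measure0 cons_measure_ge0 cons_measure_sigma_additive.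

Lemma cons_measure_box (A : set T) (B : set (n.-tuple T)) :
  measurable A -> measurable B ->
  cons_measure [set x | A (thead x) /\ B [tuple of behead x]] = (mu A * m B)%E.
Proof.
move=> mA mB; rewrite /cons_measure /pushforward -product_measure1E//.
congr product_measure1; apply/seteqP; split=> -[a b] /=;
  rewrite /thead !(tnth_nth a)/= => -[Aa].
  by move=> Bb; split=> //; rewrite (_ : b = [tuple of behead (a :: b)])//; apply: val_inj.
by move=> Bb; split=> //; rewrite (_ : [tuple of behead (a :: b)] = b)//; apply: val_inj.
Qed.

Lemma measurable_box (A : set T) (B : set (n.-tuple T)) :
  measurable A -> measurable B ->
  measurable [set x : n.+1.-tuple T | A (thead x) /\ B [tuple of behead x]].
Proof.
move=> mA mB.
rewrite (_ : [set x | _] = (@tnth n.+1 T ^~ ord0) @^-1` A `&`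
  (fun x : n.+1.-tuple T => [tuple of behead x] : n.-tuple T) @^-1` B)//.
apply: measurableI; rewrite -[X in measurable X]setTI.
  exact: measurable_tnth.
exact: measurable_behead.
Qed.

Let cons_measure_sigma_finite : sigma_finite setT cons_measure.
Proof.
have /sigma_finiteP[F [TF ndF Foo]] := sigma_finiteT mu.
have /sigma_finiteP[G [TG ndG Goo]] := sigma_finiteT m.
exists (fun k => [set x | F k (thead x) /\ G k [tuple of behead x]]).
  apply/esym; rewrite -subTset => x _.
  have : [set: T] (thead x) by [].
  rewrite TF => -[k _ Fk].
  have : [set: n.-tuple T] [tuple of behead x] by [].
  rewrite TG => -[l _ Gl].
  exists (maxn k l) => //=; split.
    by move: (thead x) Fk; exact/subsetPset/ndF/leq_maxl.
  by move: [tuple of behead x] Gl; exact/subsetPset/ndG/leq_maxr.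
move=> k; have [? ?] := Foo k; have [? ?] := Goo k.
split; first exact: measurable_box.
by rewrite cons_measure_box// lte_mul_pinfty// ge0_fin_numE.
Qed.

HB.instance Definition _ := Measure_isSigmaFinite.Build _ _ _ cons_measure
  cons_measure_sigma_finite.

End Step.

(* n-fold product measure *)
Fixpoint tuple_measure n : {sigma_finite_measure set (n.-tuple T) -> \bar R} :=
  match n with
  | 0 => \d_([tuple] : 0.-tuple T)
  | k.+1 => cons_measure (tuple_measure k)
  end.

Lemma tuple_measureE n (A : 'I_n -> set T) : (forall i, measurable (A i)) ->
  tuple_measure n [set x | forall i, A i (tnth x i)] = (\prod_(i < n) mu (A i))%E.
Proof.
elim: n A => [|n IH] A mA.
  rewrite big_ord0 /= diracE mem_set//= => i; by case: i.
rewrite big_ord_recl /= -IH// -cons_measure_box//.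
  congr cons_measure; apply/seteqP; split => x /=.
    move=> Ax; split=> [|i]; first exact: Ax.
    by have := Ax (lift ord0 i); rewrite [in X in X -> _](tuple_eta x) tnthS.
  move=> [A0 Ax] i; case: (unliftP ord0 i) => [j|] ->//.
  by rewrite (tuple_eta x) tnthS; exact: Ax.
rewrite (_ : [set x | _] = \bigcap_(i in [set: 'I_n])
   (fun x : n.-tuple T => tnth x i) @^-1` A (lift ord0 i)).
  apply: fin_bigcap_measurable => // i _.
  by rewrite -[X in measurable X]setTI; exact: measurable_tnth.
by apply/seteqP; split => x /= Ax i *; exact: Ax.
Qed.

End TupleMeasure.

Section ComplexAnalysis.
Variable R : realType.
Local Notation C := (Cplx R).

Definition normsq (z : C) : R := complex.Re z ^+ 2 + complex.Im z ^+ 2.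

(* t^z for real t >= 0; it is 0 at t = 0 as soon as Re z <> 0 *)
Definition cpow (t : R) (z : C) : C :=
  (((t `^ complex.Re z)%:C)%C : C) *
  (cos (complex.Im z * ln t) +i* sin (complex.Im z * ln t))%C.

Section Integral.
Context d (T : measurableType d).
Variables (mu : {measure set T -> \bar R}) (D : set T) (f : T -> C).

Definition cintegrable : Prop :=
  mu.-integrable D (fun x => (complex.Re (f x))%:E) /\
  mu.-integrable D (fun x => (complex.Im (f x))%:E).

Definition cintegral : C :=
  ((\int[mu]_(x in D) complex.Re (f x))%R +i*
   (\int[mu]_(x in D) complex.Im (f x))%R)%C.

End Integral.

Definition euler_integral (z : C) : C :=
  cintegral lebesgue_measure `]0, +oo[
    (fun t : R => cpow t (z - 1) * ((expR (- t))%:C)%C).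

(* Euler's integral is extended from Re z > 0 by the functional equation      *)
(* Gamma(z) = Gamma(z + m) / (z (z + 1) ... (z + m - 1)), where m is chosen   *)
(* so that Re z + m > 0. The value at the poles 0, -1, -2, ... is 0.          *)
Definition Gamma (z : C) : C :=
  let m := if 0 < complex.Re z then 0%N
           else (Num.truncn (- complex.Re z)).+1 in
  euler_integral (z + m%:R) / \prod_(k < m) (z + k%:R).

(* f(z) = sum_(k >= - m) a_k (z - w)^k for z <> w near w *)
Definition laurent_expansion (f : C -> C) (w : C) (m : nat) (a : int -> C) :=
  (forall k : int, k < - m%:Z -> a k = 0) /\
  \forall z \near w^',
    series (fun k : nat => a (k%:Z - m%:Z) * (z - w) ^ (k%:Z - m%:Z)) @ \oo
      --> f z.

(* The values of f at a discrete set of points, such as its poles, play no    *)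
(* role here.                                                                 *)
Definition meromorphic (f : C -> C) :=
  forall w, exists m a, laurent_expansion f w m a.

(* F is a meromorphic continuation to the whole plane of a function I that is *)
(* meaningful for Re z large enough                                           *)
Definition meromorphic_continuation (I F : C -> C) :=
  meromorphic F /\ exists c : R, forall z, c < complex.Re z -> F z = I z.

Definition constant_term (f : C -> C) (w a0 : C) :=
  exists m a, laurent_expansion f w m a /\ a 0 = a0.

Definition finite_part (I : C -> C) : C :=
  get [set a0 | exists F, meromorphic_continuation I F /\ constant_term F 0 a0].

(* f with a removable singularity at w removed *)
Definition remove_singularity (f : C -> C) (w : C) : C -> C :=
  fun z => if z == w then lim (f @ w^') else f z.

End ComplexAnalysis.

Section ProjectiveSpace.
Variables (R : realType) (n : nat).
Local Notation C := (Cplx R).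

Definition homog_coords := {Z : 'rV[C]_n.+1 | Z != 0}.

Definition proportional (Y Z : homog_coords) : bool :=
  `[< exists c : C, c != 0 /\ val Y = c *: val Z >].

Lemma proportional_refl : reflexive proportional.
Proof. by move=> Z; apply/asboolP; exists 1; rewrite oner_neq0 scale1r. Qed.

Lemma proportional_sym : symmetric proportional.
Proof.
suff H Y Z : proportional Y Z -> proportional Z Y by move=> Y Z; apply/idP/idP => /H.
move=> /asboolP[c [c0 YZ]]; apply/asboolP; exists c^-1.
by rewrite invr_eq0 c0 YZ scalerA mulVf// scale1r.
Qed.

Lemma proportional_trans : transitive proportional.
Proof.
move=> Z Y W /asboolP[a [a0 YZ]] /asboolP[b [b0 ZW]]; apply/asboolP.
by exists (a * b); rewrite mulf_neq0// YZ ZW scalerA.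
Qed.

Canonical proportional_equiv :=
  EquivRel proportional proportional_refl proportional_sym proportional_trans.

Definition projective_space := {eq_quot proportional}%qT.
Local Notation PP := projective_space.

Definition homogeneous_class (Z : homog_coords) : PP := (\pi_PP Z)%qT.

Lemma chart_neq0 (z : 'rV[C]_n) : (row_mx 1 z : 'rV[C]_n.+1) != 0.
Proof.
apply/eqP => /(congr1 (fun M : 'rV[C]_(1 + n) => M 0 (lshift n 0))).
by rewrite row_mxEl !mxE => /eqP; rewrite oner_eq0.
Qed.

(* (z_1, ..., z_n) |-> [1 : z_1 : ... : z_n], the inverse of z_j = Z_j / Z_0  *)
Definition affine_chart (z : 'rV[C]_n) : PP :=
  homogeneous_class (exist (fun Z => Z != 0) _ (chart_neq0 z)).

(* A section of O(d) is a function sec on C^(n+1) that is homogeneous of      *)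
(* degree d; this is the square of its Fubini-Study norm.                     *)
Definition fs_normsq (d : nat) (sec : 'rV[C]_n.+1 -> C) (p : PP) : R :=
  let Z := val (repr p) in
  normsq (sec Z) / (\sum_(j < n.+1) normsq (Z 0 j)) ^+ d.

Lemma normsqM (y z : C) : normsq (y * z) = normsq y * normsq z.
Proof. by case: y z => [a b] [c e]; rewrite /normsq/=; ring. Qed.

Lemma normsq_gt0 (z : C) : z != 0 -> 0 < normsq z.
Proof.
case: z => [a b]; rewrite /normsq/= eq_complex/= negb_and => /orP[h|h].
  by rewrite ltr_pwDl ?sqr_ge0// exprn_even_gt0.
by rewrite ltr_wpDl ?sqr_ge0// exprn_even_gt0.
Qed.

Lemma fs_normsqE d sec (Z : homog_coords) :
  (forall (c : C) (Y : 'rV[C]_n.+1), sec (c *: Y) = c ^+ d * sec Y) ->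
  fs_normsq d sec (homogeneous_class Z) =
  normsq (sec (val Z)) / (\sum_(j < n.+1) normsq (val Z 0 j)) ^+ d.
Proof.
move=> homS; rewrite /fs_normsq.
have /asboolP[c [c0 ->]] : proportional (repr (homogeneous_class Z)) Z.
  by have /eqmodP := reprK (homogeneous_class Z).
rewrite homS normsqM.
have -> : normsq (c ^+ d) = normsq c ^+ d.
  elim: d {homS} => [|d IH]; first by rewrite /normsq/= !expr0; ring.
  by rewrite !exprS normsqM IH.
under eq_bigr do rewrite mxE normsqM.
rewrite -mulr_sumr exprMn -mulf_div divff ?mul1r//.
by rewrite expf_neq0// gt_eqF// normsq_gt0.
Qed.

Definition coord_section (Z : 'rV[C]_n.+1) : C := \prod_(j < n.+1) Z 0 j.

Lemma coord_section_homog (c : C) (Z : 'rV[C]_n.+1) :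
  coord_section (c *: Z) = c ^+ n.+1 * coord_section Z.
Proof.
rewrite /coord_section; under eq_bigr do rewrite mxE.
by rewrite big_split/= prodr_const card_ord.
Qed.

(* A top form, possibly singular, is given by its coefficient g in the affine *)
(* chart, standing for g dz_1 /\ dzbar_1 /\ ... /\ dz_n /\ dzbar_n. The       *)
(* hyperplane Z_0 = 0, left out by the chart, has measure 0.                  *)
Definition top_form := 'rV[C]_n -> C.

Local Notation R2 := (measurableTypeR R * measurableTypeR R)%type.

Definition point_of_tuple (x : n.-tuple R2) : 'rV[C]_n :=
  \row_(j < n) ((tnth x j).1 +i* (tnth x j).2)%C.

Definition lebesgue_R2 : {sigma_finite_measure set R2 -> \bar R} :=
  prod_measure (@lebesgue_measure R) (@lebesgue_measure R).

Definition lebesgue_Cn : {sigma_finite_measure set (n.-tuple R2) -> \bar R} :=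
  tuple_measure lebesgue_R2 n.

(* phi * g in real coordinates z_j = x_j + i y_j, where                       *)
(* dz_j /\ dzbar_j = - 2 i dx_j /\ dy_j                                       *)
Definition form_density (phi : projective_space -> C) (g : top_form)
    (x : n.-tuple R2) : C :=
  let z := point_of_tuple x in
  (- 2 * (('i)%C : C)) ^+ n * g z * phi (affine_chart z).

Definition integrable_form phi g := cintegrable lebesgue_Cn setT (form_density phi g).

Definition integral_form phi g : C := cintegral lebesgue_Cn setT (form_density phi g).

Definition omega : top_form := fun z =>
  (('i)%C : C) ^+ n / 2 ^+ n / ((normsq (\prod_(j < n) z 0 j))%:C)%C.

(* ||sec||^(2 lambda) as a function on P^n *)
Definition norm_power d sec (lambda : C) (p : projective_space) : C :=
  cpow (fs_normsq d sec p) lambda.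

Definition zeta_integral d sec (g : top_form) (lambda : C) : C :=
  integral_form (norm_power d sec lambda) g.

Definition converges_holomorphically d sec (g : top_form) :=
  exists c : R, forall lambda : C, c < complex.Re lambda ->
    integrable_form (norm_power d sec lambda) g /\
    derivable (zeta_integral d sec g) lambda 1.

(* the finite part of the integral of g over P^n with respect to the section  *)
(* sec of O(d)                                                                *)
Definition fp_integral d sec (g : top_form) : C := finite_part (zeta_integral d sec g).

End ProjectiveSpace.

(* Main.v *)
Require Import Defs.
From HB Require Import structures.
From mathcomp Require Import all_boot all_order all_algebra.
From mathcomp Require Import all_classical all_reals all_analysis.
From mathcomp Require Import measurable_realfun complex ring lra.

(* The integral over C^n is, for Re lambda > 0,                               *)
(*   I(lambda) = pi^n Gamma(lambda)^(n + 1) / Gamma((n + 1) lambda).          *)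
(* For real 0 < lambda < 1 this follows from Tonelli's theorem: write         *)
(*   Gamma(c) (1 + S)^(- c) = int_0^oo v^(c - 1) e^(- v (1 + S)) dv,          *)
(* with c = (n + 1) lambda and S = |z_1|^2 + ... + |z_n|^2, which makes the   *)
(* integrand a product over the coordinates, and reduce each factor to a      *)
(* Gaussian integral over R^2 by expanding |z|^(2 lambda - 2) as a Laplace    *)
(* transform. Both sides being analytic, the identity theorem extends the     *)
(* formula to Re lambda > 0; the same argument gives the functional equation  *)
(* of Gamma. Near 0, Gamma(z) = E(z + 1) / z with E Euler's integral, so      *)
(*   H(z) = (n + 1) E(z + 1)^(n + 1) / E((n + 1) z + 1)                       *)
(* is analytic, the continuation is pi^n z^(- n) H(z), and its constant term  *)
(* is pi^n H^(n)(0) / n!.                                                     *)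
(*   Analyticity is expressed by bounds M (r |z - w|)^N on the N-th Taylor    *)
(* remainder, uniform in N. This class is closed under products and inverses  *)
(* by finite computations, without any summation of series.                   *)

Set Implicit Arguments.
Unset Strict Implicit.
Unset Printing Implicit Defensive.

Import Order.TTheory GRing.Theory Num.Theory.
Import numFieldNormedType.Exports.

Local Open Scope classical_set_scope.
Local Open Scope ring_scope.

(** * Absolute value of complex numbers *)

(** In the affine chart the integrand is [W B^lambda], where [W = 1 / |z_1 ... z_n|^2] and [B =
    ||s||^2 = |z_1 ... z_n|^2 / (1 + S)^(n + 1)] lies in [[0, 1]], so the zeta integral is a Mellin
    transform ([zeta_integral_mellin]). Such a transform is analytic at every [w] whose real
    exponents [Re w - delta] and [Re w + delta] both give integrable functions ([taylor_mellin]);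
    here this means [Re lambda > 0], by the closed form at real exponents in []0, 1[]
    ([integral_zeta_real_fun]).

    That closed form rests on one mechanism: a negative power is a Laplace transform. Expanding
    [(1 + S)^(- c)] decouples the coordinates; each of the [n] planes contributes
    [pi v^(- a) Gamma(a)], and the remaining integral over [v] is one more [Gamma(a)], whence the
    exponent [n + 1]. [half_plane_identity] carries the formula to the half-plane
    ([zeta_integral_euler]).

    The right-hand side continues to the whole plane because Gamma does. At 0 the numerator has a
    pole of order [n + 1] and the denominator one of order 1, so [z^n] removes the singularity of
    the quotient ([taylor_removed]). If [b] are the Taylor coefficients of the resulting [H], the
    continuation is [pi^n z^(- n) H(z)] near 0, its constant term is [pi^n b_n]
    ([constant_term_zeta]), and [b_n = H^(n)(0) / n!] ([taylor_derive1n]). Since [finite_part]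
    chooses some continuation and some Laurent expansion, uniqueness of both is what gives it this
    value ([meromorphic_continuation_unique], [laurent_coef0_unique], [finite_partE]). *)

Section ComplexNorm.
Variable R : realType.
Local Notation C := (Cplx R).
Implicit Types z w : C.

(** The norm of [Cplx R] is itself complex valued; its real part is taken so that estimates live in
    the ordered field [R]. *)
Definition cnorm z : R := complex.Re `|z|.

Lemma cnormE z : `|z| = (((cnorm z)%:C)%C : C).
Proof. by rewrite /cnorm (RRe_real (normr_real z)). Qed.

Lemma cnorm_sqrt z : cnorm z = Num.sqrt (complex.Re z ^+ 2 + complex.Im z ^+ 2).
Proof. by rewrite /cnorm normc_def. Qed.

Lemma cnorm0 : cnorm 0 = 0. Proof. by rewrite /cnorm normr0. Qed.

Lemma cnorm1 : cnorm 1 = 1. Proof. by rewrite /cnorm normr1. Qed.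

Lemma cnorm_ge0 z : 0 <= cnorm z. Proof. by rewrite cnorm_sqrt sqrtr_ge0. Qed.

Lemma cnormM z w : cnorm (z * w) = cnorm z * cnorm w.
Proof. by apply: complexI; rewrite -cnormE normrM rmorphM /= -!cnormE. Qed.

Lemma cnormX z n : cnorm (z ^+ n) = cnorm z ^+ n.
Proof. by elim: n => [|n IH]; rewrite ?expr0 ?cnorm1// !exprS cnormM IH. Qed.

Lemma cnormV z : cnorm z^-1 = (cnorm z)^-1.
Proof. by apply: complexI; rewrite -cnormE normfV fmorphV /= -cnormE. Qed.

Lemma cnormN z : cnorm (- z) = cnorm z.
Proof. by rewrite /cnorm normrN. Qed.

Lemma cnormD z w : cnorm (z + w) <= cnorm z + cnorm w.
Proof. by rewrite -lecR rmorphD/= -!cnormE ler_normD. Qed.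

Lemma cnormB z w : cnorm (z - w) <= cnorm z + cnorm w.
Proof. by rewrite -(cnormN w); exact: cnormD. Qed.

Lemma cdistC z w : cnorm (z - w) = cnorm (w - z).
Proof. by rewrite -cnormN opprB. Qed.

Lemma cnorm_eq0 z : (cnorm z == 0) = (z == 0).
Proof. by rewrite -(inj_eq (@complexI R)) -cnormE normr_eq0. Qed.

Lemma cnorm_gt0 z : (0 < cnorm z) = (z != 0).
Proof. by rewrite lt_def cnorm_ge0 cnorm_eq0 andbT. Qed.

Lemma cnorm_real (x : R) : cnorm (x%:C)%C = `|x|.
Proof. by rewrite cnorm_sqrt/= expr0n addr0 sqrtr_sqr. Qed.

Lemma cnorm_nat n : cnorm n%:R = n%:R.
Proof. by rewrite -(rmorph_nat (real_complex R)) cnorm_real normr_nat. Qed.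

Lemma ler_Re_cnorm z : `|complex.Re z| <= cnorm z.
Proof. by rewrite -lecR -cnormE normc_ge_Re. Qed.

Lemma ler_Im_cnorm z : `|complex.Im z| <= cnorm z.
Proof.
by rewrite cnorm_sqrt -sqrtr_sqr ler_wsqrtr// lerDr sqr_ge0.
Qed.

Lemma cnorm_le_ReIm z : cnorm z <= `|complex.Re z| + `|complex.Im z|.
Proof.
rewrite cnorm_sqrt -(ler_pXn2r (ltn0Sn 1)) ?nnegrE ?sqrtr_ge0 ?addr_ge0//.
rewrite sqr_sqrtr ?addr_ge0 ?sqr_ge0// -(real_normK (num_real (complex.Re z))).
rewrite -(real_normK (num_real (complex.Im z))) sqrrD -addrA lerD2l lerDr.
by rewrite mulrn_wge0// mulr_ge0.
Qed.

Lemma cnorm_sum (I : Type) (r : seq I) (P : pred I) (F : I -> C) :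
  cnorm (\sum_(i <- r | P i) F i) <= \sum_(i <- r | P i) cnorm (F i).
Proof.
elim/big_rec2: _ => [|i y x _ h]; first by rewrite cnorm0.
by rewrite (le_trans (cnormD _ _))// lerD2l.
Qed.

(** Balls of [Cplx R] have a complex radius [e], but [0 < e] forces [e] to be real, so real radii
    suffice. *)
Lemma near_cnormP (w : C) (P : C -> Prop) :
  (\forall z \near w, P z) <->
  exists2 r : R, 0 < r & forall z, cnorm (z - w) < r -> P z.
Proof.
split.
  move=> /nbhs_normP[e /= e0 eP]; exists (complex.Re e).
    by move: e0; rewrite ltcE => /andP[].
  move=> z zr; apply: eP; rewrite /ball_/= distrC cnormE.
  by move: e0; rewrite !ltcE/= => /andP[/eqP <- _]; rewrite eqxx.
move=> [r r0 rP]; apply/nbhs_normP; exists (r%:C)%C; first by rewrite /= ltcR.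
by move=> z /=; rewrite distrC cnormE ltcR; exact: rP.
Qed.

Lemma near_dcnormP (w : C) (P : C -> Prop) :
  (\forall z \near w^', P z) <->
  exists2 r : R, 0 < r & forall z, z != w -> cnorm (z - w) < r -> P z.
Proof.
split.
  by move=> /near_cnormP[r r0 h]; exists r => // z zw zr; exact: h.
by move=> [r r0 h]; apply/near_cnormP; exists r => // z zr zw; exact: h.
Qed.

Lemma cvg_cnormP (T : Type) (F : set_system T) (FF : Filter F) (f : T -> C) l :
  f @ F --> l <-> forall e : R, 0 < e -> \forall x \near F, cnorm (f x - l) < e.
Proof.
split.
  move=> fl e e0; apply: (fl [set y | cnorm (y - l) < e]).
  by apply/near_cnormP; exists e.
move=> h P /near_cnormP[e e0 eP].
by apply: filterS (h e e0) => x; exact: eP.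
Qed.

End ComplexNorm.

(** * Functions with geometric Taylor remainders *)

Section Taylor.
Variable R : realType.
Local Notation C := (Cplx R).
Implicit Types (f g h : C -> C) (w z : C) (a b : nat -> C).

(** The same [M] and [r] serve every order [N] and every point of the disc [r |z - w| <= 1]. The
    case [N = 0] says that [f] is bounded by [M] there. *)
Definition taylor_bound f w a (M r : R) := forall z N, r * cnorm (z - w) <= 1 ->
  cnorm (f z - \sum_(k < N) a k * (z - w) ^+ k) <= M * (r * cnorm (z - w)) ^+ N.

(* At z = w the bound with N = 1 forces f w = a 0. *)
Definition taylor f w a := exists M r, 0 < r /\ taylor_bound f w a M r.

Lemma taylor_bound_ge0 f w a M r : taylor_bound f w a M r -> 0 <= M.
Proof.
move=> /(_ w 0); rewrite subrr cnorm0 mulr0 expr0 mulr1 => h.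
exact: le_trans (cnorm_ge0 _) (h ler01).
Qed.

Lemma taylor_bound_le f w a M r M' r' : 0 < r -> M <= M' -> r <= r' ->
  taylor_bound f w a M r -> taylor_bound f w a M' r'.
Proof.
move=> r0 MM rr h z N zr; have M0 := taylor_bound_ge0 h.
have le : r * cnorm (z - w) <= r' * cnorm (z - w) by rewrite ler_wpM2r ?cnorm_ge0.
apply: le_trans (h z N (le_trans le zr)) _.
have x0 : 0 <= r * cnorm (z - w) by rewrite mulr_ge0 ?cnorm_ge0 ?ltW.
by rewrite ler_pM ?exprn_ge0// lerXn2r ?nnegrE// (le_trans x0).
Qed.

(** Both constants may be increased, so one number can play both roles and can be shared by several
    expansions. *)
Lemma taylor_boundP f w a : taylor f w a -> exists2 r, 0 < r &
  forall r', r <= r' -> taylor_bound f w a r' r'.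
Proof.
move=> [M [r [r0 h]]]; exists (Num.max M r); first by rewrite lt_max r0 orbT.
by move=> r'; rewrite ge_max => /andP[? ?]; exact: taylor_bound_le h.
Qed.

Lemma taylor_at f w a : taylor f w a -> f w = a 0%N.
Proof.
move=> [M [r [r0 /(_ w 1%N)]]]; rewrite subrr cnorm0 mulr0 => /(_ ler01).
rewrite big_ord1 expr0 mulr1 expr1 mulr0 => h.
by apply/eqP; rewrite -subr_eq0 -cnorm_eq0 eq_le h cnorm_ge0.
Qed.

(** At a point with [r |z - w| = 1], the remainders of orders [k] and [k + 1] differ by
    [a k * (z - w) ^+ k], and each is at most [M]. *)
Lemma taylor_bound_coef f w a M r : 0 < r -> taylor_bound f w a M r ->
  forall k, cnorm (a k) <= 2 * M * r ^+ k.
Proof.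
move=> r0 h k; have M0 := taylor_bound_ge0 h.
pose z : C := w + ((r^-1)%:C)%C.
have zw : z - w = ((r^-1)%:C)%C by rewrite /z addrC addKr.
have nz : cnorm (z - w) = r^-1 by rewrite zw cnorm_real gtr0_norm ?invr_gt0.
have rz : r * cnorm (z - w) = 1 by rewrite nz divff ?gt_eqF.
have h1 := h z k; have h2 := h z k.+1; rewrite rz !expr1n !mulr1 in h1 h2.
have : cnorm (a k * (z - w) ^+ k) <= M + M.
  have -> : a k * (z - w) ^+ k =
    (f z - \sum_(i < k) a i * (z - w) ^+ i) -
    (f z - \sum_(i < k.+1) a i * (z - w) ^+ i).
    by rewrite big_ord_recr/=; ring.
  by rewrite (le_trans (cnormB _ _))// lerD ?h1 ?h2.
rewrite cnormM cnormX nz exprVn => hh.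
by rewrite -ler_pdivrMr ?exprn_gt0// mulr_natl mulr2n.
Qed.

Lemma taylor_eq f g w a b : f =1 g -> a =1 b -> taylor f w a -> taylor g w b.
Proof. by move=> /funext <- /funext <-. Qed.

Lemma taylor_near f g w a : (\forall z \near w, f z = g z) ->
  taylor f w a -> taylor g w a.
Proof.
move=> /near_cnormP[e e0 fg] [M [r [r0 h]]].
(* With a rate of at least [2 / e] the bound is claimed only within [e / 2] of [w], where [f] and
   [g] agree. *)
exists M, (Num.max r (2 / e)); split; first by rewrite lt_max r0.
have h' : taylor_bound f w a M (Num.max r (2 / e)).
  by apply: taylor_bound_le h => //; rewrite le_max lexx.
move=> z N zr; rewrite -fg; first exact: h'.
have : 2 / e * cnorm (z - w) <= 1.
  by apply: le_trans zr; rewrite ler_wpM2r ?cnorm_ge0// le_max lexx orbT.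
rewrite mulrAC ler_pdivrMr// mul1r; have := cnorm_ge0 (z - w); lra.
Qed.

Lemma taylor_cst (c : C) w : taylor (fun=> c) w (fun k => if k is 0%N then c else 0).
Proof.
exists (cnorm c), 1; split=> // z [|N] _; first by rewrite big_ord0 subr0 expr0 mulr1.
rewrite big_ord_recl/= expr0 mulr1 big1 ?addr0 ?subrr ?cnorm0; last first.
  by move=> i _; rewrite mul0r.
by rewrite mulr_ge0 ?exprn_ge0 ?mulr_ge0 ?cnorm_ge0.
Qed.

Lemma taylorD f g w a b : taylor f w a -> taylor g w b ->
  taylor (fun z => f z + g z) w (fun k => a k + b k).
Proof.
move=> /taylor_boundP[r r0 fr] /taylor_boundP[s s0 gs].
exists (Num.max r s + Num.max r s), (Num.max r s); split; first by rewrite lt_max r0.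
move=> z N zr; have {fr}h1 := fr (Num.max r s); have {gs}h2 := gs (Num.max r s).
under eq_bigr do rewrite mulrDl.
rewrite big_split/= opprD addrACA mulrDl (le_trans (cnormD _ _))//.
by rewrite lerD ?h1 ?h2// le_max lexx ?orbT.
Qed.

Lemma taylorZ (c : C) f w a : taylor f w a ->
  taylor (fun z => c * f z) w (fun k => c * a k).
Proof.
move=> [M [r [r0 h]]]; exists (cnorm c * M), r; split=> // z N zr.
under eq_bigr do rewrite -mulrA.
rewrite -mulr_sumr -mulrBr cnormM -mulrA ler_wpM2l ?cnorm_ge0//; exact: h.
Qed.

Lemma taylorB f g w a b : taylor f w a -> taylor g w b ->
  taylor (fun z => f z - g z) w (fun k => a k - b k).
Proof.
move=> hf /(taylorZ (-1)) /(taylorD hf).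
by apply: taylor_eq => z; rewrite mulN1r.
Qed.

Lemma taylor_affine f w (c d : C) a : taylor f (c * w + d) a ->
  taylor (fun z => f (c * z + d)) w (fun k => a k * c ^+ k).
Proof.
(* The [+ 1] keeps the rate positive when [c = 0]. *)
move=> [M [r [r0 h]]]; exists M, (r * (cnorm c + 1)).
have M0 := taylor_bound_ge0 h.
split; first by rewrite mulr_gt0// ltr_wpDl ?cnorm_ge0.
move=> z N zr; set x := cnorm (z - w) in zr *; have x0 : 0 <= x by exact: cnorm_ge0.
have e : c * z + d - (c * w + d) = c * (z - w) by ring.
have le : r * (cnorm c * x) <= r * (cnorm c + 1) * x.
  by rewrite mulrA ler_wpM2r// ler_wpM2l ?lerDl// ltW.
have := h (c * z + d) N; rewrite e cnormM => /(_ (le_trans le zr)) h1.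
under eq_bigr do rewrite -mulrA -exprMn.
apply: le_trans h1 _; rewrite ler_wpM2l// lerXn2r// nnegrE ?mulr_ge0 ?cnorm_ge0//.
- exact: ltW.
- exact: ltW.
- by rewrite addr_ge0 ?cnorm_ge0.
Qed.

Lemma taylor_mulX f w a : taylor f w a ->
  taylor (fun z => (z - w) * f z) w (fun k => if k is k'.+1 then a k' else 0).
Proof.
move=> [M [r [r0 h]]]; exists (M / r), r; split=> // z N zr.
have M0 := taylor_bound_ge0 h.
have x0 := cnorm_ge0 (z - w).
case: N => [|N].
  rewrite big_ord0 subr0 expr0 mulr1 cnormM.
  have := h z 0%N zr; rewrite big_ord0 subr0 expr0 mulr1 => h0.
  by rewrite mulrC ler_pM ?cnorm_ge0// -div1r ler_pdivlMr// mulrC.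
rewrite big_ord_recl/= mul0r add0r.
under eq_bigr do rewrite /= exprS mulrCA.
rewrite -mulr_sumr -mulrBr cnormM exprS !mulrA mulfVK ?gt_eqF//.
by rewrite (mulrC M) -mulrA ler_wpM2l//; exact: h.
Qed.

Lemma taylor_mulXn f w a n : taylor f w a ->
  taylor (fun z => (z - w) ^+ n * f z) w (fun k => if (k < n)%N then 0 else a (k - n)%N).
Proof.
move=> hf; elim: n => [|n IH].
  by apply: taylor_eq hf => k; rewrite ?ltn0 ?subn0 ?expr0 ?mul1r.
by apply: taylor_eq (taylor_mulX IH) => [z|[|k]]; rewrite ?exprS ?mulrA.
Qed.

(** Dividing the remainder of order [N + 1] by [z - w] gives the one of order [N] for the quotient.
    At [z = w] the quotient must be given the value [a 1], whose coefficient bound is the source of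
    the constant [2 * M * r]. *)
Lemma taylor_divX f w a : taylor f w a -> a 0%N = 0 ->
  exists2 g, taylor g w (fun k => a k.+1) & forall z, f z = (z - w) * g z.
Proof.
move=> hf a0; have [M [r [r0 h]]] := hf.
have M0 := taylor_bound_ge0 h.
pose g z := if z == w then a 1%N else f z / (z - w).
exists g; last first.
  move=> z; rewrite /g; case: eqVneq => [->|zw].
    by rewrite subrr mul0r (taylor_at hf).
  by rewrite mulrCA divff ?mulr1// subr_eq0.
exists (2 * M * r), r; split=> // z N zr; rewrite /g; case: eqVneq => [->|zw].
  rewrite subrr cnorm0 mulr0; case: N => [|N].
    by rewrite big_ord0 subr0 expr0 mulr1; have := taylor_bound_coef r0 h 1%N.
  rewrite big_ord_recl/= expr0 mulr1 big1; last first.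
    by move=> i _; rewrite /= exprS mul0r mulr0.
  by rewrite addr0 subrr cnorm0 expr0n/= mulr0.
have zw0 : z - w != 0 by rewrite subr_eq0.
rewrite -(ler_pM2l (_ : 0 < cnorm (z - w))) ?cnorm_gt0// -cnormM mulrBr.
rewrite mulrCA divff// mulr1 mulr_sumr.
have := h z N.+1 zr; rewrite big_ord_recl a0 mul0r add0r.
under eq_bigr do rewrite /= exprS mulrCA.
move=> h1; apply: le_trans h1 _.
rewrite exprS (_ : cnorm _ * _ = 2 * (M * (r * cnorm (z - w) * (r * cnorm (z - w)) ^+ N))); last by ring.
have r0' := ltW r0.
by rewrite ler_peMl ?ler1n// !mulr_ge0 ?exprn_ge0 ?mulr_ge0 ?cnorm_ge0.
Qed.

Lemma taylor_divXn f w a n : taylor f w a -> (forall k, (k < n)%N -> a k = 0) ->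
  exists2 g, taylor g w (fun k => a (k + n)%N) & forall z, f z = (z - w) ^+ n * g z.
Proof.
move=> hf; elim: n => [|n IH] an.
  by exists f => [|z]; [apply: taylor_eq hf => // k; rewrite addn0|rewrite expr0 mul1r].
have [k kn|g hg fg] := IH; first by apply: an; exact: ltnW.
have [|h hh gh] := taylor_divX hg; first by rewrite add0n an.
exists h; first by apply: taylor_eq hh => // k; rewrite addSnnS.
by move=> z; rewrite fg gh exprSr mulrA.
Qed.

(** The bound with [N = 1] at points tending to [w] forces [a 0 = 0]; division by [z - w] shifts the
    coefficients and keeps the function zero, so induction applies. *)
Lemma taylor_near0 f w a : taylor f w a -> (\forall z \near w^', f z = 0) ->
  forall k, a k = 0.
Proof.
have base f' a' : taylor f' w a' -> (\forall z \near w^', f' z = 0) -> a' 0%N = 0.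
  move=> /taylor_boundP[r r0 /(_ r (lexx _)) h] /near_dcnormP[e e0 fe].
  apply/eqP; rewrite -cnorm_eq0 eq_le cnorm_ge0 andbT; apply/ler_addgt0Pr => d d0.
  rewrite add0r.
  pose t := Num.min (e / 2) (Num.min (d / r / r) (1 / r)).
  have t0 : 0 < t by rewrite !lt_min !divr_gt0.
  have zw : w + ((t%:C)%C : C) - w = (t%:C)%C by rewrite addrC addKr.
  have := h (w + (t%:C)%C) 1%N; rewrite zw cnorm_real gtr0_norm// big_ord1 expr0 mulr1.
  have -> : f' (w + (t%:C)%C) = 0.
    apply: fe; first by rewrite -subr_eq0 zw -cnorm_eq0 cnorm_real normr_eq0 gt_eqF.
    rewrite zw cnorm_real gtr0_norm// /t gt_min; apply/orP; left.
    by rewrite ltr_pdivrMr// ltr_pMr// ltr1n.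
  rewrite sub0r cnormN.
  have td : t <= d / r / r by rewrite /t ge_min; apply/orP; right; rewrite ge_min lexx.
  have t1 : t <= 1 / r by rewrite /t !ge_min lexx !orbT.
  move: t1 td; rewrite !ler_pdivlMr// expr1 => t1 td /(_ _)/le_trans; apply; lra.
move=> hf f0 k; elim: k f a hf f0 => [|k IH] f a hf f0; first exact: base hf f0.
have [g hg fg] := taylor_divX hf (base _ _ hf f0).
apply: (IH g (fun k => a k.+1)) => //.
move: f0 => /near_dcnormP[e e0 fe]; apply/near_dcnormP; exists e => // z zw ze.
have := fe _ zw ze; rewrite fg => /eqP; rewrite mulf_eq0 subr_eq0 (negbTE zw) /=.
by move/eqP.
Qed.

Lemma taylor_unique f g w a b : (\forall z \near w^', f z = g z) ->
  taylor f w a -> taylor g w b -> a =1 b.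
Proof.
move=> fg hf hg k; apply/eqP; rewrite -subr_eq0; apply/eqP.
apply: (taylor_near0 (taylorB hf hg)).
by apply: filterS fg => z ->; rewrite subrr.
Qed.

(** Uniformity in [N] is essential: [|f z| <= M x ^ N] for all [N] with a fixed [x < 1/2] leaves
    only [f z = 0], whereas a flat function could satisfy bounds whose constants grow with [N]. *)
Lemma taylor0 f w a : taylor f w a -> (forall k, a k = 0) ->
  \forall z \near w, f z = 0.
Proof.
move=> [M [r [r0 h]]] a0; apply/near_cnormP; exists ((2 * r)^-1).
  by rewrite invr_gt0 mulr_gt0.
move=> z zr; have M0 := taylor_bound_ge0 h; set x := r * cnorm (z - w).
have x2 : x < 2^-1.
  by rewrite /x mulrC -ltr_pdivlMr// -invfM.
have x0 : 0 <= x by rewrite mulr_ge0 ?cnorm_ge0 ?ltW.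
have hN N : cnorm (f z) <= M * x ^+ N.
  have := h z N; rewrite -/x big1 ?subr0; last by move=> i _; rewrite a0 mul0r.
  by apply; lra.
have cv : (fun N => M * x ^+ N) @ \oo --> (0 : R).
  rewrite -(mulr0 M); apply: cvgMr; apply: cvg_expr; rewrite ger0_norm//; lra.
have : cnorm (f z) <= 0.
  rewrite -(cvg_lim (@Rhausdorff R) cv); apply: limr_ge; first by apply/cvg_ex; exists 0.
  by near=> N; exact: hN.
by rewrite le_eqVlt ltNge cnorm_ge0 orbF cnorm_eq0 => /eqP.
Unshelve. all: by end_near. Qed.

Lemma taylor_neq0 f w a : taylor f w a -> a 0%N != 0 -> \forall z \near w, f z != 0.
Proof.
move=> /taylor_boundP[r r0 /(_ r (lexx _)) h] a0; apply/near_cnormP.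
have A0 : 0 < cnorm (a 0%N) by rewrite cnorm_gt0.
exists (Num.min (1 / r) (cnorm (a 0%N) / r / r)); first by rewrite lt_min !divr_gt0.
move=> z; rewrite lt_min => /andP[z1 z2]; apply/eqP => fz.
have := h z 1%N; rewrite fz big_ord1 expr0 mulr1 sub0r cnormN expr1.
move: z1 z2; rewrite !ltr_pdivlMr// => z1 z2.
move=> hz; have /hz : r * cnorm (z - w) <= 1 by lra.
lra.
Qed.

Lemma taylor_order f w a : taylor f w a ->
  (forall k, a k = 0) \/ exists n, exists2 g, taylor g w (fun k => a (k + n)%N) &
    a n != 0 /\ forall z, f z = (z - w) ^+ n * g z.
Proof.
move=> hf; have [ex|nex] := pselect (exists n, a n != 0); last first.
  by left=> k; apply/eqP; apply/negPn/negP => ak; apply: nex; exists k.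
right; case: (ex_minnP ex) => n an nmin; exists n.
have [|g hg fg] := @taylor_divXn f w a n hf; last by exists g.
by move=> k kn; apply/eqP; apply/negPn/negP => /nmin; rewrite leqNgt kn.
Qed.

(** Both sides sum [a j * b k * x ^ (j + k)] over the triangle [j + k < N]. *)
Lemma cauchy_product_sum a b (x : C) N :
  \sum_(k < N) (\sum_(j < k.+1) a j * b (k - j)%N) * x ^+ k =
  \sum_(j < N) a j * x ^+ j * \sum_(k < N - j) b k * x ^+ k.
Proof.
elim: N => [|N IH]; first by rewrite !big_ord0.
rewrite big_ord_recr/= IH [RHS]big_ord_recr/= subSnn big_ord1 expr0 mulr1.
rewrite big_ord_recr/= subnn mulrDl [_ * _ * b 0%N]mulrAC addrA; congr (_ + _).
rewrite mulr_suml -big_split/=; apply: eq_bigr => j _.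
rewrite subSn; last by rewrite ltnW.
rewrite big_ord_recr/= mulrDr; congr (_ + _).
have -> : x ^+ N = x ^+ j * x ^+ (N - j) by rewrite -exprD subnKC// ltnW.
by ring.
Qed.

Lemma natr_le_expn2 n : (n%:R : R) <= 2 ^+ n.
Proof. by rewrite -natrX ler_nat ltnW// ltn_expl. Qed.

(** The remainder of the product is the remainder of [f] times [g], plus the terms [a j * x ^ j]
    times the remainder of order [N - j] of [g]. Each has size [u ^ N] up to a constant; their
    number is absorbed by doubling the rate, through [1 + 2 N <= 3 * 2 ^ N]. *)
Lemma taylorM f g w a b : taylor f w a -> taylor g w b ->
  taylor (fun z => f z * g z) w (fun k => \sum_(j < k.+1) a j * b (k - j)%N).
Proof.
move=> /taylor_boundP[r r0 fr] /taylor_boundP[s s0 gs].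
set t := Num.max r s; have t0 : 0 < t by rewrite lt_max r0.
have {fr}h1 : taylor_bound f w a t t by apply: fr; rewrite le_max lexx.
have {gs}h2 : taylor_bound g w b t t by apply: gs; rewrite le_max lexx orbT.
exists (3 * t * t), (2 * t); split=> [|z N]; first by rewrite mulr_gt0.
rewrite -(mulrA 2 t); set u := t * cnorm (z - w) => u1.
have u0 : 0 <= u by rewrite mulr_ge0 ?cnorm_ge0 ?ltW.
have {}u1 : u <= 1 by lra.
set x := z - w; rewrite cauchy_product_sum.
have -> : f z * g z - \sum_(j < N) a j * x ^+ j * \sum_(k < N - j) b k * x ^+ k =
  (f z - \sum_(j < N) a j * x ^+ j) * g z +
  \sum_(j < N) a j * x ^+ j * (g z - \sum_(k < N - j) b k * x ^+ k).
  under [X in _ = _ + X]eq_bigr do rewrite mulrBr.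
  by rewrite big_split/= sumrN -mulr_suml; ring.
have gt : cnorm (g z) <= t.
  by have := h2 z 0%N u1; rewrite big_ord0 subr0 expr0 mulr1.
have b1 : cnorm ((f z - \sum_(j < N) a j * x ^+ j) * g z) <= t * u ^+ N * t.
  by rewrite cnormM ler_pM ?cnorm_ge0//; exact: h1.
have b2 : cnorm (\sum_(j < N) a j * x ^+ j * (g z - \sum_(k < N - j) b k * x ^+ k))
    <= \sum_(j < N) 2 * t * t * u ^+ N.
  rewrite (le_trans (cnorm_sum _ _ _))//; apply: ler_sum => j _.
  rewrite !cnormM cnormX.
  apply: (@le_trans _ _ (2 * t * t ^+ j * cnorm x ^+ j * (t * u ^+ (N - j)))).
    rewrite ler_pM ?mulr_ge0 ?cnorm_ge0 ?exprn_ge0 ?cnorm_ge0//; last exact: h2.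
    by rewrite ler_wpM2r ?exprn_ge0 ?cnorm_ge0// (taylor_bound_coef t0 h1).
  rewrite -[in leRHS](subnKC (ltnW (ltn_ord j))) exprD.
  by rewrite [X in _ <= _ * (X * _)]exprMn le_eqVlt; apply/orP; left; apply/eqP; ring.
apply: le_trans (cnormD _ _) _; apply: le_trans (lerD b1 b2) _.
rewrite (exprMn _ 2 u).
have := natr_le_expn2 N; have : 1 <= 2 ^+ N :> R by rewrite exprn_ege1// ler1n.
move=> p1 p2; rewrite (_ : _ + _ = t * t * u ^+ N * (1 + 2 * N%:R)); last first.
  by rewrite sumr_const card_ord -(mulr_natr (_ * _) N); ring.
rewrite (_ : 3 * t * t * _ = t * t * u ^+ N * (3 * 2 ^+ N)); last by ring.
have t0' := ltW t0.
apply: ler_wpM2l; first by rewrite !mulr_ge0 ?exprn_ge0.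
lra.
Qed.

Lemma taylorX f w a n : taylor f w a -> exists2 b, taylor (fun z => f z ^+ n) w b &
  b 0%N = a 0%N ^+ n.
Proof.
move=> hf; elim: n => [|n [b hb b0]].
  by exists (fun k => if k is 0%N then 1 else 0) => //; exact: taylor_cst.
exists (fun k => \sum_(j < k.+1) a j * b (k - j)%N); last first.
  by rewrite big_ord1 subn0 b0 exprS.
by apply: taylor_eq (taylorM hf hb) => // z; rewrite exprS.
Qed.

End Taylor.

(** * Inverses of Taylor expansions *)

Section Inverse.
Variable R : realType.
Local Notation C := (Cplx R).
Implicit Types (f g h : C -> C) (w z : C) (a b : nat -> C).

(** Each coefficient of [1 / f] is solved from all earlier ones in the convolution identity
    [inv_coefP]; the recursion therefore carries the list of the first [n]. *)
Fixpoint inv_coef_seq a n : seq C :=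
  if n is n'.+1 then
    let s := inv_coef_seq a n' in
    rcons s ((\sum_(j < n') s`_j * a (n' - j)%N - (n' == 0%N)%:R) / - a 0%N)
  else [::].

Definition inv_coef a n := (inv_coef_seq a n.+1)`_n.

Lemma size_inv_coef_seq a n : size (inv_coef_seq a n) = n.
Proof. by elim: n => //= n IH; rewrite size_rcons IH. Qed.

Lemma inv_coef_seqE a n k : (k < n)%N -> (inv_coef_seq a n)`_k = inv_coef a k.
Proof.
elim: n => // n IH; rewrite ltnS leq_eqVlt => /orP[/eqP -> //|kn].
by rewrite /= nth_rcons size_inv_coef_seq kn IH.
Qed.

Lemma inv_coefE a n :
  inv_coef a n = (\sum_(j < n) inv_coef a j * a (n - j)%N - (n == 0%N)%:R) / - a 0%N.
Proof.
rewrite {1}/inv_coef /= nth_rcons size_inv_coef_seq ltnn eqxx.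
by congr ((_ - _) / _); apply: eq_bigr => j _; rewrite inv_coef_seqE.
Qed.

Lemma inv_coefP a n : a 0%N != 0 ->
  \sum_(j < n.+1) inv_coef a j * a (n - j)%N = (n == 0%N)%:R.
Proof.
move=> a0; rewrite big_ord_recr/= subnn inv_coefE.
by rewrite invrN mulrN mulNr divfK// opprB addrC subrK.
Qed.

(** With [K = c * A], the recursion turns the bounds at smaller indices into [K] times the geometric
    sum of the [(1 + K) ^ j], which is [(1 + K) ^ (k + 1) - 1]. *)
Lemma inv_coef_bound a (A r : R) : a 0%N != 0 -> 0 <= A -> 0 < r ->
  (forall k, cnorm (a k) <= A * r ^+ k) ->
  let c := (cnorm (a 0%N))^-1 in
  forall k, cnorm (inv_coef a k) <= c * (r * (1 + c * A)) ^+ k.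
Proof.
move=> a0 A0 r0 ha c k; have c0 : 0 < c by rewrite invr_gt0 cnorm_gt0.
elim/ltn_ind: k => -[|k] IH.
  by rewrite inv_coefE big_ord0 sub0r/= cnormM cnormV !cnormN cnorm1 expr0 mul1r mulr1.
rewrite inv_coefE subr0 cnormM cnormV cnormN -/c mulrC ler_pM2l//.
set K := c * A; have K0 : 0 <= K by rewrite mulr_ge0// ltW.
apply: (@le_trans _ _ (\sum_(j < k.+1) K * (r ^+ k.+1 * (1 + K) ^+ j))).
  rewrite (le_trans (cnorm_sum _ _ _))//; apply: ler_sum => j _.
  rewrite cnormM; apply: (@le_trans _ _ (c * (r * (1 + K)) ^+ j * (A * r ^+ (k.+1 - j)))).
    by rewrite ler_pM ?cnorm_ge0// IH.
  have -> : r ^+ k.+1 = r ^+ j * r ^+ (k.+1 - j) by rewrite -exprD subnKC// ltnW.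
  by rewrite exprMn le_eqVlt; apply/orP; left; apply/eqP; rewrite /K; ring.
rewrite -mulr_sumr -mulr_sumr mulrCA exprMn ler_wpM2l ?exprn_ge0 ?ltW//.
have := subrX1 (1 + K) k.+1; rewrite addrAC subrr add0r => <-.
by rewrite ltrBlDr ltrDl.
Qed.

(** By [inv_coefP] the remainder of [1 / f] is minus the sum of [inv_coef a j * x ^ j] times the
    remainder of order [N - j] of [f], divided by [f z]. This needs [N > 0]; the case [N = 0] is
    just boundedness of [1 / f]. *)
Lemma taylorV f w a : taylor f w a -> a 0%N != 0 ->
  taylor (fun z => (f z)^-1) w (inv_coef a).
Proof.
move=> /taylor_boundP[r r0 /(_ r (lexx _)) h] a0.
have hc := taylor_bound_coef r0 h.
have A0 : 0 <= 2 * r by rewrite mulr_ge0 ?ltW.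
have := inv_coef_bound a0 A0 r0 hc; set c := (cnorm (a 0%N))^-1 => /= hb.
have c0 : 0 < c by rewrite invr_gt0 cnorm_gt0.
set s := r * (1 + c * (2 * r)) in hb.
have K0 : 0 <= c * (2 * r) by rewrite mulr_ge0// ltW.
have rs : r <= s by rewrite /s mulrDr mulr1 lerDl mulr_ge0 ?(ltW r0).
have s0 : 0 < s by exact: lt_le_trans rs.
(* The summand [2 * s] absorbs the number of terms; the other one makes the disc so small that
   [|f z| >= |a 0| / 2] on it. *)
pose t := 2 * s + 2 * r * r * c.
have t0 : 0 < t by rewrite addr_gt0//; [rewrite mulr_gt0|rewrite !mulr_gt0].
exists (2 * c * (1 + c * r)), t; split=> // z N; set x := z - w => xt.
have x0 := cnorm_ge0 x.
have st : 2 * s * cnorm x <= t * cnorm x.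
  by rewrite ler_wpM2r// lerDl !mulr_ge0// ltW.
have rst : r * cnorm x <= s * cnorm x by rewrite ler_wpM2r.
have sx0 : 0 <= s * cnorm x by rewrite mulr_ge0// ltW.
have rx : r * cnorm x <= 1 by lra.
have crx : 2 * r * r * c * cnorm x <= 1.
  by apply: le_trans xt; rewrite ler_wpM2r// lerDr mulr_ge0 ?ltW.
have cV : c^-1 = cnorm (a 0%N) by rewrite /c invrK.
have cf : c^-1 <= 2 * cnorm (f z).
  have := h z 1%N rx; rewrite big_ord1 expr0 mulr1 expr1 => h1.
  have : r * (r * cnorm x) <= c^-1 / 2.
    by rewrite -div1r -mulrA -invfM ler_pdivlMr ?mulr_gt0//; lra.
  have : cnorm (a 0%N) <= cnorm (f z) + cnorm (f z - a 0%N).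
    by rewrite -[a 0%N in leLHS](subKr (f z)) (le_trans (cnormB _ _)).
  by rewrite -cV -/x in h1 *; lra.
have f0 : f z != 0.
  by rewrite -cnorm_gt0 -(pmulr_rgt0 _ (ltr0Sn R 1)) (lt_le_trans _ cf)// invr_gt0.
have fV : (cnorm (f z))^-1 <= 2 * c.
  rewrite -div1r ler_pdivrMr ?cnorm_gt0//.
  by have := ler_wpM2l (ltW c0) cf; rewrite divff ?gt_eqF//; lra.
have cr0 : 0 <= c * r by rewrite mulr_ge0 ?ltW.
have u0 : 0 <= t * cnorm x by rewrite mulr_ge0 ?(ltW t0).
case: N => [|N].
  rewrite big_ord0 subr0 cnormV expr0 mulr1 (le_trans fV)// mulrDr mulr1 lerDl.
  by rewrite !mulr_ge0// ltW.
have -> : (f z)^-1 - \sum_(k < N.+1) inv_coef a k * x ^+ k =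
  - (\sum_(j < N.+1) inv_coef a j * x ^+ j * (f z - \sum_(k < N.+1 - j) a k * x ^+ k)) / f z.
  under [in RHS]eq_bigr do rewrite mulrBr.
  rewrite sumrB -cauchy_product_sum -mulr_suml.
  under [X in _ = - (_ - X) / _]eq_bigr do rewrite inv_coefP//.
  have -> : \sum_(k < N.+1) (k == 0%N :> nat)%:R * x ^+ k = 1.
    by rewrite big_ord_recl/= expr0 mulr1 big1 ?addr0// => i _; rewrite mul0r.
  by rewrite opprB mulrBl mul1r mulfK.
rewrite cnormM cnormN cnormV [X in X <= _]mulrC.
have b2 : cnorm (\sum_(j < N.+1) inv_coef a j * x ^+ j * (f z - \sum_(k < N.+1 - j) a k * x ^+ k))
    <= \sum_(j < N.+1) c * r * (s * cnorm x) ^+ N.+1.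
  rewrite (le_trans (cnorm_sum _ _ _))//; apply: ler_sum => j _.
  rewrite !cnormM cnormX.
  apply: (@le_trans _ _ (c * s ^+ j * cnorm x ^+ j * (r * (s * cnorm x) ^+ (N.+1 - j)))).
    rewrite ler_pM ?mulr_ge0 ?cnorm_ge0 ?exprn_ge0//.
      by rewrite ler_wpM2r ?exprn_ge0.
    apply: le_trans (h z (N.+1 - j)%N rx) _; rewrite ler_wpM2l ?(ltW r0)//.
    by rewrite lerXn2r ?nnegrE// mulr_ge0// ltW.
  have -> : (s * cnorm x) ^+ N.+1 = (s * cnorm x) ^+ j * (s * cnorm x) ^+ (N.+1 - j).
    by rewrite -exprD subnKC// ltnW.
  by rewrite [X in _ <= _ * (X * _)]exprMn le_eqVlt; apply/orP; left; apply/eqP; ring.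
rewrite -[X in _ <= X]mulrA ler_pM ?cnorm_ge0 ?invr_ge0 ?cnorm_ge0//.
apply: le_trans b2 _; rewrite sumr_const card_ord -(mulr_natr (_ * _)).
apply: (@le_trans _ _ (c * r * (2 * s * cnorm x) ^+ N.+1)).
  rewrite -(mulrA 2) (exprMn _ 2) -(mulrA (c * r)) ler_wpM2l//.
  by rewrite mulrC ler_wpM2r ?exprn_ge0// natr_le_expn2.
have sx2 : 0 <= 2 * s * cnorm x by rewrite -mulrA mulr_ge0.
apply: ler_pM => //; first exact: exprn_ge0.
  by rewrite lerDr.
by rewrite lerXn2r// nnegrE.
Qed.

End Inverse.

(** * Complex derivatives of Taylor expansions *)

Section Meromorphic.
Variable R : realType.
Local Notation C := (Cplx R).
Implicit Types (f g h : C -> C) (w z : C) (a b : nat -> C).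

Lemma geometric_lt (B q e : R) : 0 <= q < 1 -> 0 < e ->
  exists N, forall n, (N <= n)%N -> B * q ^+ n < e.
Proof.
move=> /andP[q0 q1] e0.
have cv : (fun n => B * q ^+ n) @ \oo --> (0 : R).
  by rewrite -(mulr0 B); apply: cvgMr; apply: cvg_expr; rewrite ger0_norm.
have /cvgrPdist_lt/(_ e e0)[N _ hN] := cv.
exists N => n Nn; have := hN n Nn; rewrite /= sub0r normrN.
by apply: le_lt_trans; exact: ler_norm.
Qed.

Lemma ler_geometric_eps (X Y M q : R) : 0 <= q < 1 ->
  (forall N, X <= Y + M * q ^+ N) -> X <= Y.
Proof.
move=> q01 h; apply/ler_addgt0Pr => e e0.
have [N hN] := geometric_lt M q01 e0.
by rewrite (le_trans (h N))// lerD2l ltW// hN.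
Qed.

Lemma geometric_sum_tail (c : nat -> C) (A q : R) : 0 <= q <= 2^-1 ->
  (forall k, cnorm (c k) <= A * q ^+ k) ->
  forall N j, cnorm (\sum_(k < N + j) c k - \sum_(k < N) c k) <= 2 * A * q ^+ N.
Proof.
move=> /andP[q0 q2] hc N j.
have A0 : 0 <= A by have := hc 0%N; rewrite expr0 mulr1; apply: le_trans; exact: cnorm_ge0.
(* The subtracted term makes the bound telescope, as [q <= 1/2]; the induction on [j] would not
   close without it. *)
suff : cnorm (\sum_(k < N + j) c k - \sum_(k < N) c k) <=
    2 * A * q ^+ N - 2 * A * q ^+ (N + j).
  by move/le_trans; apply; rewrite gerBl mulr_ge0 ?exprn_ge0// mulr_ge0.
elim: j => [|j IH]; first by rewrite addn0 !subrr cnorm0.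
rewrite addnS big_ord_recr/= addrAC (le_trans (cnormD _ _))//.
apply: le_trans (lerD IH (hc _)) _; rewrite exprS.
set Q := A * q ^+ (N + j); have Q0 : 0 <= Q by rewrite mulr_ge0 ?exprn_ge0.
have : q * Q <= 2^-1 * Q by rewrite ler_wpM2r.
rewrite (_ : 2 * A * (q * q ^+ (N + j)) = 2 * (q * Q)); last by rewrite /Q; ring.
rewrite (_ : 2 * A * q ^+ (N + j) = 2 * Q); last by rewrite /Q; ring.
lra.
Qed.

Lemma geometric_cvg (s : nat -> R) (B q : R) : 0 <= q < 1 ->
  (forall N j, `|s (N + j)%N - s N| <= B * q ^+ N) ->
  exists l, forall N, `|l - s N| <= B * q ^+ N.
Proof.
move=> q01 hs.
have cs : cvgn s.
  apply/cauchy_cvgP; apply: cauchy_exP => e e0.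
  have [N hN] := geometric_lt B q01 e0.
  exists (s N); exists N => // n /= Nn.
  rewrite /ball/= distrC; apply: le_lt_trans (hN N (leqnn _)).
  by rewrite -(subnKC Nn).
exists (limn s) => N; apply/ler_addgt0Pr => e e0.
have /cvgrPdist_lt/(_ e e0)[n _ hn] := cs.
have := hn (N + n)%N (leq_addl _ _) => /= h1; have h2 := hs N n.
rewrite -(subrK (s (N + n)%N) (limn s)) -addrA (le_trans (ler_normD _ _))//.
by rewrite [leRHS]addrC lerD// ltW.
Qed.

Lemma cReB (x y : C) : complex.Re (x - y) = complex.Re x - complex.Re y.
Proof. by case: x y => [? ?] [? ?]. Qed.

Lemma cImB (x y : C) : complex.Im (x - y) = complex.Im x - complex.Im y.
Proof. by case: x y => [? ?] [? ?]. Qed.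

(** The power series converges where the ratio is at most [1/2], hence the rate [2 * r]. Real and
    imaginary parts converge separately, each with error [2 * A * q ^ N], hence the constant
    [4 * A]. *)
Lemma taylor_exists w a (A r : R) : 0 < r -> (forall k, cnorm (a k) <= A * r ^+ k) ->
  exists f, taylor f w a.
Proof.
move=> r0 ha.
have A0 : 0 <= A by have := ha 0%N; rewrite expr0 mulr1; apply: le_trans; exact: cnorm_ge0.
have /choice[f hf] : forall z, exists l, 2 * r * cnorm (z - w) <= 1 ->
    forall N, cnorm (l - \sum_(k < N) a k * (z - w) ^+ k) <= 4 * A * (r * cnorm (z - w)) ^+ N.
  move=> z; have [zr|zr] := pselect (2 * r * cnorm (z - w) <= 1); last by exists 0 => /zr.
  have x0 : 0 <= r * cnorm (z - w) by rewrite mulr_ge0 ?cnorm_ge0// ltW.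
  have x2 : 0 <= r * cnorm (z - w) <= 2^-1 by apply/andP; split=> //; lra.
  have q01 : 0 <= r * cnorm (z - w) < 1 by apply/andP; split=> //; lra.
  have hc k : cnorm (a k * (z - w) ^+ k) <= A * (r * cnorm (z - w)) ^+ k.
    by rewrite cnormM cnormX exprMn mulrA ler_wpM2r ?exprn_ge0 ?cnorm_ge0.
  pose S N := \sum_(k < N) a k * (z - w) ^+ k.
  have hS := geometric_sum_tail x2 hc.
  have [|l1 h1] := @geometric_cvg (fun N => complex.Re (S N)) (2 * A) _ q01.
    by move=> N j; rewrite -cReB (le_trans (ler_Re_cnorm _))// hS.
  have [|l2 h2] := @geometric_cvg (fun N => complex.Im (S N)) (2 * A) _ q01.
    by move=> N j; rewrite -cImB (le_trans (ler_Im_cnorm _))// hS.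
  exists (l1 +i* l2)%C => _ N; rewrite (le_trans (cnorm_le_ReIm _))//.
  have -> : 4 * A * (r * cnorm (z - w)) ^+ N =
    2 * A * (r * cnorm (z - w)) ^+ N + 2 * A * (r * cnorm (z - w)) ^+ N by ring.
  by apply: lerD; [rewrite cReB; exact: h1|rewrite cImB; exact: h2].
exists f, (4 * A), (2 * r); split; first by rewrite mulr_gt0.
move=> z N zr; apply: le_trans (hf z zr N) _; rewrite ler_wpM2l ?mulr_ge0//.
have x0 : 0 <= r * cnorm (z - w) by rewrite mulr_ge0 ?cnorm_ge0// ltW.
have x2 : r * cnorm (z - w) <= 2 * r * cnorm (z - w) by rewrite -mulrA ler_peMl// ler1n.
by rewrite lerXn2r ?nnegrE// (le_trans x0).
Qed.

(** The expected bound is [k ^ 2 * s ^ (k - 2) * |h| ^ 2]; multiplying by [s ^ 2] avoids both the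
    truncated exponent [k - 2] and a division by a possibly zero [s]. *)
Lemma exprD_taylor1_bound (x h : C) (s : R) k : cnorm x <= s -> cnorm (x + h) <= s ->
  cnorm ((x + h) ^+ k - x ^+ k - k%:R * h * x ^+ k.-1) * s ^+ 2 <=
  k%:R ^+ 2 * s ^+ k * cnorm h ^+ 2.
Proof.
move=> xs xhs; have s0 : 0 <= s by apply: le_trans xs; exact: cnorm_ge0.
elim: k => [|k IH]; first by rewrite !expr0 subrr !mul0r subrr cnorm0 expr0n/= !mul0r.
set D := _ - _ - _ in IH.
have -> : (x + h) ^+ k.+1 - x ^+ k.+1 - k.+1%:R * h * x ^+ k.+1.-1 =
    (x + h) * D + k%:R * h ^+ 2 * x ^+ k.-1.
  rewrite /D; case: k {IH D} => [|k] /=; first by rewrite !expr0 !expr1; ring.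
  by rewrite !exprS -!natr1; ring.
have b1 : cnorm ((x + h) * D) * s ^+ 2 <= s * (k%:R ^+ 2 * s ^+ k * cnorm h ^+ 2).
  by rewrite cnormM -mulrA ler_pM ?mulr_ge0 ?exprn_ge0 ?cnorm_ge0.
have b2 : cnorm (k%:R * h ^+ 2 * x ^+ k.-1) * s ^+ 2 <= k%:R * (s ^+ k.+1 * cnorm h ^+ 2).
  rewrite !cnormM !cnormX cnorm_nat; case: k {IH D b1} => [|k]; first by rewrite !mul0r.
  have X : cnorm x ^+ k * s ^+ 2 <= s ^+ k.+2.
    rewrite -[k.+2]addn2 exprD ler_wpM2r ?exprn_ge0//.
    by rewrite lerXn2r ?nnegrE ?cnorm_ge0.
  rewrite (_ : _ * s ^+ 2 = k.+1%:R * (cnorm h ^+ 2 * (cnorm x ^+ k * s ^+ 2))); last by ring.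
  by rewrite ler_wpM2l// [leRHS]mulrC ler_wpM2l ?exprn_ge0 ?cnorm_ge0.
rewrite (le_trans (ler_wpM2r (exprn_ge0 _ s0) (cnormD _ _)))// mulrDl.
apply: le_trans (lerD b1 b2) _; rewrite -natr1 !(exprS s).
have E0 : 0 <= s * s ^+ k * cnorm h ^+ 2 by rewrite !mulr_ge0 ?exprn_ge0 ?cnorm_ge0.
have K0 : 0 <= k%:R :> R by exact: ler0n.
rewrite (_ : _ + _ = (k%:R ^+ 2 + k%:R) * (s * s ^+ k * cnorm h ^+ 2)); last by ring.
by rewrite -[leRHS]mulrA ler_wpM2r//; lra.
Qed.

Lemma taylor_derive f w a : taylor f w a -> derivable f w 1 /\ derive1 f w = a 1%N.
Proof.
move=> /taylor_boundP[r r0 /(_ r (lexx _)) h].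
have cv : (fun x => x^-1 *: (f (x + w) - f w)) @ 0^' --> (a 1%N : C).
  apply/cvg_cnormP => e e0; apply/near_dcnormP.
  (* The remainder of order 2, with [M = r], divided by [x] is at most [r ^ 3 * |x|]. *)
  exists (Num.min (1 / r) (e / r ^+ 3)); first by rewrite lt_min !divr_gt0// exprn_gt0.
  move=> x x0; rewrite subr0 lt_min => /andP[x1 xe].
  have xw : x + w - w = x by rewrite addrK.
  have xr : r * cnorm x <= 1 by move: x1; rewrite ltr_pdivlMr// mulrC => /ltW.
  have -> : f w = a 0%N by apply: taylor_at; exists r, r.
  have -> : x^-1 *: (f (x + w) - a 0%N) - a 1%N =
      (f (x + w) - \sum_(k < 2) a k * (x + w - w) ^+ k) / x.
    rewrite xw !big_ord_recl big_ord0 expr0 mulr1 expr1 addr0 /GRing.scale/=.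
    by field.
  have := h (x + w) 2; rewrite xw => /(_ xr) hx.
  have nx : 0 < cnorm x by rewrite cnorm_gt0.
  rewrite cnormM cnormV ltr_pdivrMr//; apply: le_lt_trans hx _.
  move: xe; rewrite ltr_pdivlMr ?exprn_gt0// => xe.
  have := ltr_pM2r nx (cnorm x * r ^+ 3) e; rewrite xe => hx.
  by rewrite (_ : r * _ = cnorm x * r ^+ 3 * cnorm x)//; ring.
split; last by rewrite /derive1; apply/cvg_lim => //; exact: norm_hausdorff.
rewrite /derivable (_ : (fun h : C => h^-1 *: (f (h *: (1 : C) + w) - f w)) =
  fun x => x^-1 *: (f (x + w) - f w)); first by apply/cvg_ex; exists (a 1%N).
by apply/funext => x; rewrite /GRing.scale/= mulr1.
Qed.

(** The differentiated series has a sum [f1], since [k + 1 <= 2 ^ (k + 1)] only doubles the rate.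
    The point is that [f1] is the derivative on a whole disc, not only at [w]: there
    [f (z + x) - f z - x * f1 z] is [O(|x| ^ 2)]. *)
Lemma taylor_derive1 f w a : taylor f w a ->
  taylor (derive1 f) w (fun k => k.+1%:R * a k.+1) /\ \forall z \near w, derivable f z 1.
Proof.
move=> hf; have /taylor_boundP[r r0 hr] := hf.
have hc := taylor_bound_coef r0 (hr r (lexx _)).
have hc1 k : cnorm (k.+1%:R * a k.+1) <= 4 * r ^+ 2 * (2 * r) ^+ k.
  rewrite cnormM cnorm_nat; apply: (@le_trans _ _ (2 ^+ k.+1 * (2 * r * r ^+ k.+1))).
    by rewrite ler_pM ?cnorm_ge0// natr_le_expn2.
  by rewrite (exprMn _ 2 r) !exprS le_eqVlt; apply/orP; left; apply/eqP; ring.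
have [|f1 hf1] := @taylor_exists w (fun k => k.+1%:R * a k.+1) _ (2 * r) _ hc1.
  by rewrite mulr_gt0.
have /taylor_boundP[r1 r10 hr1] := hf1.
set t := Num.max r r1; have t0 : 0 < t by rewrite lt_max r0.
have {hr}h := hr t (ltac:(by rewrite le_max lexx)).
have {hr1}h1 := hr1 t (ltac:(by rewrite le_max lexx orbT)).
have {}hc := taylor_bound_coef t0 h.
(* With [t * s = 1/8], the factor [k ^ 2 * 8 ^ (- k)] equals [(k * 2 ^ (- k)) ^ 2 * 2 ^ (- k)], at
   most [2 ^ (- k)], so the sum over [k] is below 2. *)
pose s := (8 * t)^-1; have s0 : 0 < s by rewrite invr_gt0 mulr_gt0.
have st : t * s = 8^-1 by rewrite /s invfM mulrCA divff ?mulr1// gt_eqF.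
have main z x : cnorm (z - w) < s -> cnorm (z + x - w) < s ->
    cnorm (f (z + x) - f z - x * f1 z) <= 4 * t * cnorm x ^+ 2 / s ^+ 2.
  move=> zs zxs; set y := z - w in zs *.
  have yx : z + x - w = y + x by rewrite /y addrAC.
  rewrite yx in zxs.
  pose F N (u : C) := \sum_(k < N) a k * u ^+ k.
  pose G N := \sum_(k < N) k.+1%:R * a k.+1 * y ^+ k.
  have ty : t * cnorm y <= 8^-1 by rewrite -st ler_pM2l// ltW.
  have tyx : t * cnorm (y + x) <= 8^-1 by rewrite -st ler_pM2l// ltW.
  have poly N : cnorm (F N.+1 (y + x) - F N.+1 y - x * G N) <= 4 * t * cnorm x ^+ 2 / s ^+ 2.
    have -> : F N.+1 (y + x) - F N.+1 y - x * G N =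
        \sum_(k < N.+1) a k * ((y + x) ^+ k - y ^+ k - k%:R * x * y ^+ k.-1).
      under eq_bigr do rewrite !mulrBr.
      rewrite !sumrB; congr (_ - _); rewrite big_ord_recl !mul0r mulr0 add0r.
      by rewrite /G mulr_sumr; apply: eq_bigr => k _; rewrite lift0 /=; ring.
    rewrite (le_trans (cnorm_sum _ _ _))// ler_pdivlMr ?exprn_gt0// mulr_suml.
    apply: (@le_trans _ _ (\sum_(k < N.+1) 2 * t * cnorm x ^+ 2 * 2^-1 ^+ k)).
      apply: ler_sum => k _; rewrite cnormM -[leLHS]mulrA.
      apply: (@le_trans _ _ (2 * t * t ^+ k * (k%:R ^+ 2 * s ^+ k * cnorm x ^+ 2))).
        rewrite ler_pM ?mulr_ge0 ?exprn_ge0 ?cnorm_ge0 ?(ltW s0)//.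
        by apply: exprD_taylor1_bound; exact: ltW.
      have -> : 2 * t * t ^+ k * (k%:R ^+ 2 * s ^+ k * cnorm x ^+ 2) =
        2 * t * cnorm x ^+ 2 * (k%:R ^+ 2 * (t * s) ^+ k) by rewrite exprMn; ring.
      rewrite ler_wpM2l ?mulr_ge0 ?exprn_ge0 ?cnorm_ge0 ?(ltW t0)// st.
      have kk : k%:R * 2^-1 ^+ k <= 1 :> R.
        by rewrite exprVn ler_pdivrMr ?exprn_gt0// mul1r natr_le_expn2.
      have -> : 8^-1 = 2^-1 * 2^-1 * 2^-1 :> R by field.
      rewrite !exprMn (_ : _ * _ = (k%:R * 2^-1 ^+ k) ^+ 2 * 2^-1 ^+ k); last by ring.
      by rewrite ler_piMl ?exprn_ge0 ?invr_ge0// exprn_ile1// mulr_ge0 ?exprn_ge0 ?invr_ge0.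
    have half n : \sum_(k < n) 2^-1 ^+ k = 2 - 2 * 2^-1 ^+ n :> R.
      elim: n => [|n IHn]; first by rewrite big_ord0 expr0; ring.
      by rewrite big_ord_recr/= IHn exprS; field.
    rewrite -mulr_sumr half.
    rewrite (_ : 4 * t * _ = 2 * t * cnorm x ^+ 2 * 2); last by ring.
    rewrite ler_wpM2l ?mulr_ge0 ?exprn_ge0 ?cnorm_ge0 ?(ltW t0)//.
    by rewrite gerBl mulr_ge0 ?exprn_ge0 ?invr_ge0.
  (* The estimate [poly] for partial sums does not depend on [N]; the three truncation errors decay
     like [8 ^ (- N)], so it passes to the limit. *)
  have := @ler_geometric_eps (cnorm (f (z + x) - f z - x * f1 z)) (4 * t * cnorm x ^+ 2 / s ^+ 2)
     (2 * t + cnorm x * t) 8^-1.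
  apply; first by apply/andP; split; lra.
  move=> N.
  have y1 : t * cnorm y <= 1 by lra.
  have yx1 : t * cnorm (z + x - w) <= 1 by rewrite yx; lra.
  have a1 := h (z + x) N.+1 yx1; have a2 := h z N.+1 y1; have a3 := h1 z N y1.
  rewrite yx in a1.
  have q8 (u : C) n : (N <= n)%N -> t * cnorm u <= 8^-1 -> t * (t * cnorm u) ^+ n <= t * 8^-1 ^+ N.
    move=> Nn un; rewrite ler_wpM2l ?(ltW t0)//.
    have u0 : 0 <= t * cnorm u by rewrite mulr_ge0 ?cnorm_ge0 ?(ltW t0).
    apply: (@le_trans _ _ (8^-1 ^+ n)); first by rewrite lerXn2r ?nnegrE// (le_trans u0).
    by rewrite ler_wiXn2l// ?invr_ge0// invf_le1 ?ler1n.
  have {}a1 := le_trans a1 (q8 _ _ (leqnSn N) tyx).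
  have {}a2 := le_trans a2 (q8 _ _ (leqnSn N) ty).
  have {}a3 := le_trans a3 (q8 _ _ (leqnn N) ty).
  have -> : f (z + x) - f z - x * f1 z = (F N.+1 (y + x) - F N.+1 y - x * G N) +
     (((f (z + x) - F N.+1 (y + x)) - (f z - F N.+1 y)) - x * (f1 z - G N)) by ring.
  rewrite (le_trans (cnormD _ _))// lerD ?poly//.
  rewrite (le_trans (cnormB _ _))// [leRHS]mulrDl lerD//.
    rewrite (le_trans (cnormB _ _))//.
    have -> : 2 * t * 8^-1 ^+ N = t * 8^-1 ^+ N + t * 8^-1 ^+ N by ring.
    exact: lerD.
  by rewrite cnormM -mulrA ler_wpM2l ?cnorm_ge0.
have der z : cnorm (z - w) < s -> derivable f z 1 /\ derive1 f z = f1 z.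
  move=> zs.
  have cv : (fun x => x^-1 *: (f (x + z) - f z)) @ 0^' --> (f1 z : C).
    apply/cvg_cnormP => e e0; apply/near_dcnormP.
    pose K := 4 * t / s ^+ 2; have K0 : 0 < K by rewrite divr_gt0 ?mulr_gt0 ?exprn_gt0.
    exists (Num.min (s - cnorm (z - w)) (e / K)).
      by rewrite lt_min subr_gt0 zs divr_gt0.
    move=> x x0; rewrite subr0 lt_min => /andP[x1 xe].
    have -> : x^-1 *: (f (x + z) - f z) - f1 z = (f (z + x) - f z - x * f1 z) / x.
      by rewrite /GRing.scale/= (addrC x z); field.
    have nx : 0 < cnorm x by rewrite cnorm_gt0.
    rewrite cnormM cnormV ltr_pdivrMr//.
    apply: le_lt_trans (main z x zs _) _.
      by rewrite addrAC (le_lt_trans (cnormD _ _))//; lra.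
    move: xe; rewrite ltr_pdivlMr// => xe.
    have := ltr_pM2r nx (cnorm x * K) e; rewrite xe => hx.
    by rewrite (_ : _ / _ = cnorm x * K * cnorm x)// /K; ring.
  split; last by rewrite /derive1; apply/cvg_lim => //; exact: norm_hausdorff.
  rewrite /derivable (_ : (fun h : C => h^-1 *: (f (h *: (1 : C) + z) - f z)) =
    fun x => x^-1 *: (f (x + z) - f z)); first by apply/cvg_ex; exists (f1 z).
  by apply/funext => x; rewrite /GRing.scale/= mulr1.
split; last by apply/near_cnormP; exists s => // z /der[].
apply: taylor_near hf1; apply/near_cnormP; exists s => // z /der[_ ->//].
Qed.

Lemma taylor_derive1n f w a n : taylor f w a -> derive1n n f w = n`!%:R * a n.
Proof.
elim: n f a => [|n IH] f a hf; first by rewrite derive1n0 fact0 mul1r (taylor_at hf).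
have [hf1 _] := taylor_derive1 hf.
by rewrite derive1Sn (IH _ _ hf1) factS natrM; ring.
Qed.

End Meromorphic.

(** * Meromorphic functions and the identity theorem *)

Section Mero.
Variable R : realType.
Local Notation C := (Cplx R).
Implicit Types (f g h : C -> C) (w z : C) (a b : nat -> C).

(** A local form of [meromorphic] (see [meromorphicP]) that mentions no series, so that closure
    under field operations reduces to that of [taylor]. *)
Definition meromorphic_at f w := exists m g a, taylor g w a /\
  \forall z \near w^', f z * (z - w) ^+ m = g z.

Lemma meromorphic_at_near f g w : (\forall z \near w^', f z = g z) ->
  meromorphic_at f w -> meromorphic_at g w.
Proof.
move=> fg [m [h [a [ha hf]]]]; exists m, h, a; split=> //.
by near=> z; rewrite -(near hf z)//; congr (_ * _); apply/esym; near: z.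
Unshelve. all: by end_near. Qed.

Lemma taylor_meromorphic f w a : taylor f w a -> meromorphic_at f w.
Proof.
move=> hf; exists 0%N, f, a; split=> //.
by apply: nearW => z; rewrite expr0 mulr1.
Qed.

Lemma meromorphic_atD f g w : meromorphic_at f w -> meromorphic_at g w ->
  meromorphic_at (fun z => f z + g z) w.
Proof.
move=> [m [f' [a [ha hf]]]] [n [g' [b [hb hg]]]].
exists (m + n)%N, (fun z => (z - w) ^+ n * f' z + (z - w) ^+ m * g' z).
eexists; split; first exact: taylorD (taylor_mulXn _ ha) (taylor_mulXn _ hb).
by near=> z; rewrite exprD -(near hf z)// -(near hg z)//; ring.
Unshelve. all: by end_near. Qed.

Lemma meromorphic_atM f g w : meromorphic_at f w -> meromorphic_at g w ->
  meromorphic_at (fun z => f z * g z) w.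
Proof.
move=> [m [f' [a [ha hf]]]] [n [g' [b [hb hg]]]].
exists (m + n)%N, (fun z => f' z * g' z).
eexists; split; first exact: taylorM ha hb.
by near=> z; rewrite exprD -(near hf z)// -(near hg z)//; ring.
Unshelve. all: by end_near. Qed.

Lemma meromorphic_at_cst (c : C) w : meromorphic_at (fun=> c) w.
Proof. exact: taylor_meromorphic (taylor_cst c w). Qed.

Lemma meromorphic_atB f g w : meromorphic_at f w -> meromorphic_at g w ->
  meromorphic_at (fun z => f z - g z) w.
Proof.
move=> hf hg; have := meromorphic_atD hf (meromorphic_atM (meromorphic_at_cst (-1) w) hg).
by apply: meromorphic_at_near; apply: nearW => z; rewrite mulN1r.
Qed.

Lemma meromorphic_atX f w n : meromorphic_at f w -> meromorphic_at (fun z => f z ^+ n) w.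
Proof.
move=> hf; elim: n => [|n IH]; first exact: meromorphic_at_cst.
apply: meromorphic_at_near (meromorphic_atM hf IH).
by apply: nearW => z; rewrite exprS.
Qed.

Lemma meromorphic_at_prod (f_ : nat -> C -> C) w n : (forall k : nat, meromorphic_at (f_ k) w) ->
  meromorphic_at (fun z => \prod_(k < n) f_ k z) w.
Proof.
move=> hf; elim: n => [|n IH].
  apply: meromorphic_at_near (meromorphic_at_cst 1 w).
  by apply: nearW => z; rewrite big_ord0.
apply: meromorphic_at_near (meromorphic_atM IH (hf n)).
by apply: nearW => z; rewrite big_ord_recr.
Qed.

Lemma near_neq w : \forall z \near w^', z != w.
Proof. by apply/near_dcnormP; exists 1. Qed.

(** Zeros are isolated unless all coefficients vanish: otherwise the first nonzero coefficient is
    factored out by [taylor_order], and the cofactor does not vanish near [w]. *)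
Lemma meromorphic_at_dichotomy f w : meromorphic_at f w ->
  (\forall z \near w^', f z = 0) \/ (\forall z \near w^', f z != 0).
Proof.
move=> [m [g [a [ga fg]]]].
have [a0|[n [h hh [an gh]]]] := taylor_order ga.
  left; have /nbhs_dnbhs g0 := taylor0 ga a0; have nw := near_neq w.
  near=> z; have : f z * (z - w) ^+ m = 0 by rewrite (near fg z)// (near g0 z).
  move/eqP; rewrite mulf_eq0 expf_eq0 subr_eq0 => /orP[/eqP//|/andP[_]].
  by have -> : z == w = false by apply/negbTE; near: z.
right; have /nbhs_dnbhs h0 := taylor_neq0 hh an; have nw := near_neq w.
near=> z; apply/eqP => fz; have : g z = 0 by rewrite -(near fg z)// fz mul0r.
rewrite gh => /eqP; rewrite mulf_eq0 expf_eq0 subr_eq0.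
have -> : z == w = false by apply/negbTE; near: z.
by rewrite andbF/= (negbTE (near h0 z _)).
Unshelve. all: by end_near. Qed.

(* If f vanishes near w, so does its inverse, as 0^-1 = 0. *)
Lemma meromorphic_atV f w : meromorphic_at f w -> meromorphic_at (fun z => (f z)^-1) w.
Proof.
move=> [m [g [a [ga fg]]]].
have nw := near_neq w.
have [a0|[n [h hh [an gh]]]] := taylor_order ga.
  apply: meromorphic_at_near (meromorphic_at_cst 0 w).
  have /nbhs_dnbhs g0 := taylor0 ga a0.
  near=> z; have : f z * (z - w) ^+ m = 0 by rewrite (near fg z)// (near g0 z).
  move/eqP; rewrite mulf_eq0 expf_eq0 subr_eq0.
  have -> : z == w = false by apply/negbTE; near: z.
  by rewrite andbF orbF => /eqP ->; rewrite invr0.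
exists n, (fun z => (z - w) ^+ m * (h z)^-1).
eexists; split; first exact: taylor_mulXn (taylorV hh an).
near=> z.
have zw : z - w != 0 by rewrite subr_eq0; near: z.
have e : f z = (z - w) ^+ n * h z / (z - w) ^+ m.
  by rewrite -gh -(near fg z)// mulfK// expf_neq0.
by rewrite e invf_div -mulrA invfM [_^-1 * (h z)^-1]mulrC divfK// expf_neq0.
Unshelve. all: by end_near. Qed.

Lemma meromorphic_at_affine f w (c d : C) : c != 0 -> meromorphic_at f (c * w + d) ->
  meromorphic_at (fun z => f (c * z + d)) w.
Proof.
move=> c0 [m [g [a [ga fg]]]].
exists m, (fun z => c ^- m * g (c * z + d)); eexists; split.
  exact: taylorZ (taylor_affine ga).
move: fg => /near_dcnormP[e e0 fg]; apply/near_dcnormP.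
exists (e / cnorm c) => [|z zw ze]; first by rewrite divr_gt0// cnorm_gt0.
have E : c * z + d - (c * w + d) = c * (z - w) by ring.
rewrite -fg.
- by rewrite E exprMn mulrCA (mulrA (c ^- m)) mulVf ?mul1r// expf_neq0.
- by rewrite -subr_eq0 E mulf_neq0// subr_eq0.
- by rewrite E cnormM mulrC -ltr_pdivlMr// cnorm_gt0.
Qed.

Lemma exprz_subn (x : C) (k m : nat) : x != 0 ->
  (x ^ (k%:Z - m%:Z) = x ^+ k / x ^+ m)%R.
Proof. by move=> x0; rewrite expfzDr// -exprnN. Qed.

Lemma taylor_laurent f g w m a : taylor g w a ->
  (\forall z \near w^', f z * (z - w) ^+ m = g z) ->
  laurent_expansion f w m (fun k => if (k + m%:Z)%R is Posz j then a j else 0).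
Proof.
move=> [M [r [r0 h]]] fg; split.
  by move=> k; rewrite -subr_lt0 opprK; case: (k + m%:Z).
have M0 := taylor_bound_ge0 h.
move: fg => /near_dcnormP[e e0 fg]; apply/near_dcnormP.
exists (Num.min e (2^-1 / r)) => [|z zw]; first by rewrite lt_min e0 divr_gt0.
rewrite lt_min => /andP[ze]; rewrite ltr_pdivlMr// mulrC => zr.
have zw0 : z - w != 0 by rewrite subr_eq0.
pose q := r * cnorm (z - w).
have q0 : 0 <= q by rewrite mulr_ge0 ?cnorm_ge0// ltW.
have q01 : 0 <= q < 1 by rewrite q0/= /q; lra.
have nX : 0 < cnorm (z - w) ^+ m by rewrite exprn_gt0// cnorm_gt0.
have -> : f z = g z / (z - w) ^+ m by rewrite -fg// mulfK// expf_neq0.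
apply/cvg_cnormP => d d0.
have [N hN] := geometric_lt M q01 (mulr_gt0 d0 nX).
exists N => // n /= Nn; rewrite /series/=.
have -> : \sum_(0 <= k < n) (if (k%:Z - m%:Z + m%:Z)%R is Posz j then a j else 0) *
    (z - w) ^ (k%:Z - m%:Z) = (\sum_(k < n) a k * (z - w) ^+ k) / (z - w) ^+ m.
  rewrite big_mkord mulr_suml; apply: eq_bigr => k _.
  by rewrite subrK exprz_subn// mulrA.
rewrite -mulrBl cnormM cnormV cnormX ltr_pdivrMr// (cdistC _ (g z)).
by apply: le_lt_trans (hN n Nn); apply: h; lra.
Qed.

(** Abel's argument: at distance [e / 2] the terms of the series tend to 0, hence are bounded by
    some [A], so [|c k| <= A * (2 / e) ^ k]. The rate [4 / e] then keeps the ratio below [1/2]. *)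
Lemma laurent_taylor f w m (a : int -> C) : laurent_expansion f w m a ->
  exists2 g, taylor g w (fun k => a (k%:Z - m%:Z)%R) &
    \forall z \near w^', f z * (z - w) ^+ m = g z.
Proof.
move=> [_ /near_dcnormP[e e0 he]].
pose c k := a (k%:Z - m%:Z)%R.
have hc z : z != w -> cnorm (z - w) < e ->
    (fun n => \sum_(k < n) c k * (z - w) ^+ k) @ \oo --> f z * (z - w) ^+ m.
  move=> zw ze; have zw0 : z - w != 0 by rewrite subr_eq0.
  have -> : (fun n => \sum_(k < n) c k * (z - w) ^+ k) =
      (fun n => series (fun k : nat => a (k%:Z - m%:Z)%R * (z - w) ^ (k%:Z - m%:Z)) n
        * (z - w) ^+ m).
    apply/funext => n; rewrite /series/= big_mkord mulr_suml.
    by apply: eq_bigr => k _; rewrite exprz_subn// -mulrA divfK// expf_neq0.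
  by apply: cvgMl; exact: he.
pose z0 : C := w + (((e / 2)%:C)%C : C).
have z0w : z0 - w = (((e / 2)%:C)%C : C) by rewrite /z0 addrC addKr.
have nz0 : cnorm (z0 - w) = e / 2 by rewrite z0w cnorm_real gtr0_norm ?divr_gt0.
have [A A0 hA] : exists2 A, 0 <= A & forall k, cnorm (c k) * (e / 2) ^+ k <= A.
  have z0n : z0 != w by rewrite -subr_eq0 -cnorm_eq0 nz0 gt_eqF ?divr_gt0.
  have ze : cnorm (z0 - w) < e by rewrite nz0; lra.
  have := hc z0 z0n ze.
  rewrite (_ : (fun n => _) = series (fun k => c k * (z0 - w) ^+ k)); last first.
    by apply/funext => n; rewrite /series/= big_mkord.
  move=> cv; have /cvg_series_cvg_0 : cvgn (series (fun k => c k * (z0 - w) ^+ k)).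
    by apply/cvg_ex; eexists; exact: cv.
  move=> /cvg_cnormP/(_ 1 ltr01)[N _ hN].
  exists (1 + \sum_(k < N) cnorm (c k) * (e / 2) ^+ k).
    by rewrite addr_ge0// sumr_ge0// => k _; rewrite mulr_ge0 ?cnorm_ge0 ?exprn_ge0// divr_ge0 ?ltW.
  have s0 : 0 <= \sum_(k < N) cnorm (c k) * (e / 2) ^+ k.
    by rewrite sumr_ge0// => k _; rewrite mulr_ge0 ?cnorm_ge0 ?exprn_ge0// divr_ge0 ?ltW.
  move=> k; have [Nk|kN] := leqP N k.
    have := hN k Nk; rewrite /= subr0 cnormM cnormX nz0 => /ltW/le_trans; apply.
    by rewrite lerDl.
  rewrite (bigD1 (Ordinal kN))//= addrCA lerDl addr_ge0// sumr_ge0// => j _.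
  by rewrite mulr_ge0 ?cnorm_ge0 ?exprn_ge0// divr_ge0 ?ltW.
pose r := 4 / e; have r0 : 0 < r by rewrite divr_gt0.
(* The expansion says nothing about [f w], so the value at the centre is set to the constant
   coefficient. *)
exists (fun z => if z == w then c 0%N else f z * (z - w) ^+ m); last first.
  by have := near_neq w; apply: filterS => z /negbTE ->.
exists (2 * A), r; split=> // z N zr; case: eqVneq => [->|zw].
  rewrite subrr cnorm0 mulr0; case: N => [|N]; last first.
    rewrite big_ord_recl/= expr0 mulr1 big1; last first.
      by move=> i _; rewrite /= exprS mul0r mulr0.
    by rewrite addr0 subrr cnorm0 expr0n/= mulr0.
  rewrite big_ord0 subr0 expr0 mulr1; have := hA 0%N; rewrite expr0 mulr1; lra.
pose q := cnorm (z - w) * (e / 2)^-1.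
have q0 : 0 <= q by rewrite mulr_ge0 ?cnorm_ge0// invr_ge0 divr_ge0 ?ltW.
have qr : r * cnorm (z - w) = 2 * q by rewrite /r /q; field; rewrite gt_eqF.
rewrite qr in zr *.
have q2 : 0 <= q <= 2^-1 by rewrite q0/=; lra.
have ck k : cnorm (c k * (z - w) ^+ k) <= A * q ^+ k.
  rewrite cnormM cnormX /q exprMn (mulrC (cnorm _ ^+ k)) mulrA ler_wpM2r ?exprn_ge0 ?cnorm_ge0//.
  by rewrite exprVn ler_pdivlMr ?exprn_gt0 ?divr_gt0.
have tail := geometric_sum_tail q2 ck N.
have ze : cnorm (z - w) < e.
  have q1 : q < 1 by lra.
  by move: q1; rewrite /q ltr_pdivrMr ?divr_gt0//; lra.
have fin : cnorm (f z * (z - w) ^+ m - \sum_(k < N) c k * (z - w) ^+ k) <= 2 * A * q ^+ N.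
  apply/ler_addgt0Pr => d d0.
  have /cvg_cnormP/(_ d d0)[n _ hn] := hc z zw ze.
  have := hn (N + n)%N (leq_addl _ _) => /= h1.
  rewrite -(subrK (\sum_(k < N + n) c k * (z - w) ^+ k) (f z * _)) -addrA.
  by rewrite (le_trans (cnormD _ _))// [leRHS]addrC lerD// cdistC ltW.
apply: le_trans fin _; rewrite ler_wpM2l ?mulr_ge0//.
have q2q : q <= 2 * q by lra.
by rewrite lerXn2r ?nnegrE// (le_trans q0).
Qed.

Lemma meromorphicP f : meromorphic f <-> forall w, meromorphic_at f w.
Proof.
split=> [mf w|mf w].
  have [m [a fma]] := mf w; have [g ga fg] := laurent_taylor fma.
  by exists m, g; eexists; split; first exact: ga.
have [m [g [a [ga fg]]]] := mf w; exists m; eexists; exact: taylor_laurent ga fg.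
Qed.

Lemma laurent_coef0_unique f1 f2 w m1 m2 (a1 a2 : int -> C) :
  laurent_expansion f1 w m1 a1 -> laurent_expansion f2 w m2 a2 ->
  (\forall z \near w^', f1 z = f2 z) -> a1 0 = a2 0.
Proof.
move=> /laurent_taylor[g1 h1 e1] /laurent_taylor[g2 h2 e2] f12.
have := taylor_unique _ (taylor_mulXn m2 h1) (taylor_mulXn m1 h2).
move=> /(_ _ (m1 + m2)%N); rewrite !ltnNge leq_addl leq_addr /=.
rewrite addnK addKn !subrr; apply.
by near=> z; rewrite -(near e1 z)// -(near e2 z)// (near f12 z)//; ring.
Unshelve. all: by end_near. Qed.

(** A nearby parameter [s] other than [t] gives a centre inside the old punctured ball; the radius
    [|t - s| * |v|] keeps the new ball away from the old centre, where [P] may fail. *)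
Lemma open_punctured (P : C -> Prop) (w v : C) :
  open [set t : R | \forall z \near (w + (t%:C)%C * v)^', P z].
Proof.
rewrite openE => t /= /near_dcnormP[e e0 he].
have [v0|v0] := eqVneq v 0.
  apply/nbhs_ballP; exists 1 => //= s _; apply/near_dcnormP; exists e => // z.
  by rewrite v0 mulr0 in he; rewrite v0 mulr0; exact: he.
have nv : 0 < cnorm v by rewrite cnorm_gt0.
apply/nbhs_ballP; exists (e / 2 / cnorm v) => /=; first by rewrite !divr_gt0.
move=> s; rewrite /ball/= => st.
have E : w + (s%:C)%C * v - (w + (t%:C)%C * v) = ((s - t)%:C)%C * v.
  by rewrite rmorphB/=; ring.
have [->|sneqt] := eqVneq s t; first by apply/near_dcnormP; exists e.
have nE : cnorm (((s - t)%:C)%C * v) = `|t - s| * cnorm v.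
  by rewrite cnormM cnorm_real distrC.
have n0 : 0 < `|t - s| * cnorm v by rewrite mulr_gt0// normr_gt0 subr_eq0 eq_sym.
have n2 : `|t - s| * cnorm v < e / 2 by rewrite -ltr_pdivlMr.
apply/near_dcnormP; exists (`|t - s| * cnorm v) => // z zs zst.
apply: he.
  by apply/eqP => zt; move: zst; rewrite zt cdistC E nE ltxx.
rewrite -(subrK (w + (s%:C)%C * v) z) -addrA E (le_lt_trans (cnormD _ _))// nE.
lra.
Qed.

Lemma near_dcnormF w (P : Prop) : (\forall z \near w^', P) -> P.
Proof.
move=> /near_dcnormP[e e0 h]; apply: (h (w + ((e / 2)%:C)%C)).
  by rewrite -subr_eq0 addrC addKr -cnorm_eq0 cnorm_real normr_eq0 gt_eqF ?divr_gt0.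
by rewrite addrC addKr cnorm_real gtr0_norm ?divr_gt0//; lra.
Qed.

(** Connectedness of [[0, 1]]: the parameters at which [f] is locally zero form a nonempty set [Z]
    that is open and closed. *)
Lemma meromorphic_identity f w v :
  (forall t : R, 0 <= t <= 1 -> meromorphic_at f (w + (t%:C)%C * v)) ->
  (\forall z \near w^', f z = 0) -> \forall z \near (w + v)^', f z = 0.
Proof.
move=> mf f0.
pose Z := [set t : R | \forall z \near (w + (t%:C)%C * v)^', f z = 0].
pose N := [set t : R | \forall z \near (w + (t%:C)%C * v)^', f z != 0].
have ZN t : Z t -> ~ N t.
  move=> Zt Nt; apply: (@near_dcnormF (w + (t%:C)%C * v)).
  by near=> z; have : f z != 0 by [near: z]; rewrite (near Zt z)// eqxx.
suff B : `[0, 1]%classic `&` Z = `[0, 1]%classic.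
  have : (`[0, 1]%classic `&` Z) 1 by rewrite B /= in_itv/= ler01 lexx.
  by case=> _; rewrite /Z/= mul1r.
apply: (@segment_connected R 0 1).
- exists 0; split; first by rewrite /= in_itv/= lexx ler01.
  by rewrite /Z /= mul0r addr0.
- by exists Z => //; exact: open_punctured.
(* By the dichotomy, [Z] is on [[0, 1]] the complement of [N], which is open too. *)
- exists (~` N); first by apply: open_closedC; exact: open_punctured.
  apply/seteqP; split=> t [t01 ht]; (split; first exact: t01); first exact: ZN ht.
  have mt : meromorphic_at f (w + (t%:C)%C * v).
    by apply: mf; move: t01; rewrite /= in_itv.
  by have [|Nt] := meromorphic_at_dichotomy mt; last by case: ht.
Unshelve. all: by end_near. Qed.

End Mero.

(** * Complex powers and parameter integrals *)

Section ExpRemainder.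
Variable R : realType.
Local Notation C := (Cplx R).

Definition cexp (z : C) : C :=
  (((expR (complex.Re z))%:C)%C : C) * (cos (complex.Im z) +i* sin (complex.Im z))%C.

Lemma cReM (x y : C) :
  complex.Re (x * y) = complex.Re x * complex.Re y - complex.Im x * complex.Im y.
Proof. by case: x y => [? ?] [? ?]. Qed.

Lemma cImM (x y : C) :
  complex.Im (x * y) = complex.Re x * complex.Im y + complex.Im x * complex.Re y.
Proof. by case: x y => [? ?] [? ?]. Qed.

Lemma cReD (x y : C) : complex.Re (x + y) = complex.Re x + complex.Re y.
Proof. by case: x y => [? ?] [? ?]. Qed.

Lemma cImD (x y : C) : complex.Im (x + y) = complex.Im x + complex.Im y.
Proof. by case: x y => [? ?] [? ?]. Qed.

Lemma complex_eq (x y : C) : complex.Re x = complex.Re y -> complex.Im x = complex.Im y -> x = y.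
Proof. by case: x y => [? ?] [? ?] /= -> ->. Qed.

Lemma cexpD (x y : C) : cexp (x + y) = cexp x * cexp y.
Proof.
by apply: complex_eq; rewrite /cexp !(cReM, cImM, cReD, cImD)/= expRD (cosD, sinD); ring.
Qed.

Lemma cpow_cexp (t : R) (z : C) : 0 < t -> cpow t z = cexp (z * (((ln t)%:C)%C : C)).
Proof.
move=> t0; rewrite /cpow /cexp cReM cImM/= !mulr0 subr0 add0r.
by rewrite /powR gt_eqF.
Qed.

Lemma cnorm_cpow (t : R) (z : C) : 0 <= t -> cnorm (cpow t z) = t `^ complex.Re z.
Proof.
move=> t0; rewrite /cpow cnormM cnorm_real cnorm_sqrt/= cos2Dsin2 sqrtr1 mulr1.
by rewrite ger0_norm ?powR_ge0.
Qed.

Lemma ge0_is_derive_le (F f : R -> R) (b : R) : 0 <= b ->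
  (forall t : R, is_derive t 1 F (f t)) -> (forall t, 0 <= t -> 0 <= f t) -> F 0 <= F b.
Proof.
move=> b0 dF f0.
have dFE t : derive1 F t = f t by rewrite derive1E; apply: derive_val.
apply: (@ger0_derive1_le_cc _ F 0 b) => //; rewrite ?in_itv/= ?lexx ?b0//.
- by move=> t; rewrite in_itv/= => /andP[/ltW t0 _]; rewrite dFE f0.
- apply: continuous_subspaceT => t; apply/differentiable_continuous.
  by apply/derivable1_diffP; apply: ex_derive.
Qed.

Lemma is_derive_sumX (c : nat -> R) N (t : R) :
  is_derive t 1 (fun s : R => \sum_(k < N.+1) c k * s ^+ k)
    (\sum_(k < N) k.+1%:R * c k.+1 * t ^+ k).
Proof.
elim: N => [|N IH].
  rewrite big_ord0; rewrite (_ : (fun s => _) = cst (c 0%N)); first exact: is_derive_cst.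
  by apply/funext => s; rewrite big_ord1 expr0 mulr1.
rewrite (_ : (fun s => _) = (fun s : R => \sum_(k < N.+1) c k * s ^+ k) +
   (fun s => c N.+1 * s ^+ N.+1)); last by apply/funext => s; rewrite big_ord_recr.
rewrite big_ord_recr/=; apply: is_deriveD.
have dX : is_derive t (1 : R) (@GRing.exp R ^~ N.+1) (N.+1%:R *: t ^+ N *: 1).
  by apply: DeriveDef; [exact: exprn_derivable|exact: exp_derive].
rewrite (_ : N.+1%:R * _ * _ = c N.+1 *: (N.+1%:R *: t ^+ N *: 1)); first exact: is_deriveZ.
by rewrite /GRing.scale/=; ring.
Qed.

Section Remainder.
Variables x y : R.
(** [A N t] and [B N t] below are the real and imaginary parts of the order [N] remainder of the
    exponential series at [t * zeta]. Differentiating in [t] lowers [N] by one and multiplies by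
    [zeta]; this gives the coupled equations [dA] and [dB]. *)
Let zeta : C := (x +i* y)%C.
Let cf (k : nat) : C := zeta ^+ k / k`!%:R.
Let al k := complex.Re (cf k).
Let be k := complex.Im (cf k).
Let A0 (t : R) := expR (x * t) * cos (y * t).
Let B0 (t : R) := expR (x * t) * sin (y * t).
Let A N t := A0 t - \sum_(k < N) al k * t ^+ k.
Let B N t := B0 t - \sum_(k < N) be k * t ^+ k.

Let cfS k : k.+1%:R * cf k.+1 = zeta * cf k.
Proof.
rewrite /cf exprS factS natrM; field.
by rewrite (addrC 1) natr1 !pnatr_eq0 -lt0n fact_gt0.
Qed.

Let natRe k (z : C) : complex.Re (k%:R * z) = k%:R * complex.Re z.
Proof. by rewrite -(rmorph_nat (real_complex R)) cReM/= mul0r subr0. Qed.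

Let natIm k (z : C) : complex.Im (k%:R * z) = k%:R * complex.Im z.
Proof. by rewrite -(rmorph_nat (real_complex R)) cImM/= mul0r addr0. Qed.

Let alS k : k.+1%:R * al k.+1 = x * al k - y * be k.
Proof. by rewrite /al -natRe cfS cReM. Qed.

Let beS k : k.+1%:R * be k.+1 = x * be k + y * al k.
Proof. by rewrite /be -natIm cfS cImM. Qed.

Let dA0 (t : R) : is_derive t 1 A0 (x * A0 t - y * B0 t).
Proof.
rewrite /A0 /B0; apply: is_derive_eq.
by rewrite /GRing.scale/= !mulr1; ring.
Qed.

Let dB0 (t : R) : is_derive t 1 B0 (x * B0 t + y * A0 t).
Proof.
rewrite /A0 /B0; apply: is_derive_eq.
by rewrite /GRing.scale/= !mulr1; ring.
Qed.

Let dA N (t : R) : is_derive t 1 (A N.+1) (x * A N t - y * B N t).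
Proof.
have := is_deriveB (dA0 t) (is_derive_sumX al N t).
rewrite (_ : _ - \sum_(k < N) _ = x * A N t - y * B N t)//.
under eq_bigr do rewrite alS mulrBl -!mulrA.
by rewrite sumrB -!mulr_sumr /A /B; ring.
Qed.

Let dB N (t : R) : is_derive t 1 (B N.+1) (x * B N t + y * A N t).
Proof.
have := is_deriveB (dB0 t) (is_derive_sumX be N t).
rewrite (_ : _ - \sum_(k < N) _ = x * B N t + y * A N t)//.
under eq_bigr do rewrite beS mulrDl -!mulrA.
by rewrite big_split/= -!mulr_sumr /A /B; ring.
Qed.

Let A_at0 N : A N.+1 0 = 0.
Proof.
rewrite /A /A0 !mulr0 expR0 cos0 big_ord_recl/= expr0 !mulr1 big1; last first.
  by move=> i _; rewrite exprS mul0r mulr0.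
by rewrite /al /cf expr0 fact0 mul1r invr1 addr0 subrr.
Qed.

Let B_at0 N : B N.+1 0 = 0.
Proof.
rewrite /B /B0 !mulr0 expR0 sin0 big_ord_recl/= expr0 !mulr1 big1; last first.
  by move=> i _; rewrite exprS mul0r mulr0.
by rewrite /be /cf expr0 fact0 !mul1r invr1 /= !(mulr0, addr0, subr0).
Qed.

Let rho := `|x| + `|y|.

(* The majorant [q ^ N * exp (rho t / q)] solves the comparison equation      *)
(* [psi_(N + 1)' = rho * psi_N] exactly.                                      *)
Let AB_bound (q : R) : 0 < q -> q <= 1 -> forall N t, 0 <= t ->
  `|A N t| <= q ^+ N * expR (rho / q * t) /\ `|B N t| <= q ^+ N * expR (rho / q * t).
Proof.
move=> q0 q1; elim=> [|N IH] t t0.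
  rewrite /A /B !big_ord0 !subr0 expr0 mul1r.
  have le : expR (x * t) <= expR (rho / q * t).
    rewrite ler_expR ler_wpM2r// ler_pdivlMr// (le_trans (_ : _ <= `|x| * q)) //.
      by rewrite ler_wpM2r ?(ltW q0)// ler_norm.
    by apply: (@le_trans _ _ `|x|); [rewrite ler_piMr|rewrite lerDl].
  split; rewrite normrM ger0_norm ?expR_ge0// (le_trans _ le)// ler_piMr ?expR_ge0//.
    by rewrite ler_norml cos_geN1 cos_le1.
  by rewrite ler_norml sin_geN1 sin_le1.
pose psi (M : nat) (s : R) := q ^+ M * expR (rho / q * s).
have dpsi (s : R) : is_derive s 1 (psi N.+1) (rho * psi N s).
  rewrite /psi; apply: is_derive_eq; rewrite /GRing.scale/= !mulr1 exprS.
  by field; rewrite gt_eqF.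
have psi0 : 0 <= psi N.+1 0 by rewrite mulr_ge0 ?expR_ge0 ?exprn_ge0// ltW.
have key (F f : R -> R) : F 0 = 0 -> (forall s : R, is_derive s 1 F (f s)) ->
   (forall s, 0 <= s -> `|f s| <= rho * psi N s) -> `|F t| <= psi N.+1 t.
  move=> F0 dF hf; rewrite ler_norml; apply/andP; split.
    have d (s : R) : is_derive s 1 (psi N.+1 + F) (rho * psi N s + f s) by exact: is_deriveD.
    have := ge0_is_derive_le t0 d; rewrite /= !fctE F0 addr0 => h.
    rewrite -subr_ge0 opprK addrC (le_trans psi0)// h// => s s0.
    by have := hf s s0; rewrite ler_norml => /andP[+ _]; rewrite -subr_ge0 opprK addrC.
  have d (s : R) : is_derive s 1 (psi N.+1 - F) (rho * psi N s - f s) by exact: is_deriveB.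
  have := ge0_is_derive_le t0 d; rewrite /= !fctE F0 subr0 => h.
  rewrite -subr_ge0 (le_trans psi0)// h// => s s0.
  by have := hf s s0; rewrite ler_norml => /andP[_]; rewrite -subr_ge0.
split; [apply: key (A_at0 N) (dA N) _|apply: key (B_at0 N) (dB N) _] => s s0;
  have [hA hB] := IH s s0.
  rewrite (le_trans (ler_normB _ _))// !normrM mulrDl.
  by rewrite lerD// ler_wpM2l.
rewrite (le_trans (ler_normD _ _))// !normrM mulrDl.
by rewrite lerD// ler_wpM2l.
Qed.

Lemma cexp_remainder_aux (q : R) N : 0 < q -> q <= 1 ->
  cnorm (cexp zeta - \sum_(k < N) zeta ^+ k / k`!%:R) <= 2 * (q ^+ N * expR (rho / q)).
Proof.
move=> q0 q1; have [hA hB] := AB_bound q0 q1 N ler01.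
have ReS : complex.Re (\sum_(k < N) cf k) = \sum_(k < N) al k.
  by rewrite (big_morph _ cReD (erefl _)).
have ImS : complex.Im (\sum_(k < N) cf k) = \sum_(k < N) be k.
  by rewrite (big_morph _ cImD (erefl _)).
rewrite (le_trans (cnorm_le_ReIm _))// cReB cImB ReS ImS mulr_natl mulr2n.
rewrite mulr1 in hA hB; apply: lerD.
  move: hA; rewrite /A /A0 !mulr1 /cexp cReM/= mul0r subr0.
  by under eq_bigr do rewrite expr1n mulr1.
move: hB; rewrite /B /B0 !mulr1 /cexp cImM/= mul0r addr0.
by under eq_bigr do rewrite expr1n mulr1.
Qed.

End Remainder.

(** The parameter [q] trades geometric decay in [N] against growth in [z]. With [z = h * ln f] and
    [q] proportional to [|h|], the exponential factor depends on neither [h] nor [N], so a single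
    integrable majorant serves all remainders. *)
Lemma cexp_remainder (z : C) (q : R) N : 0 < q -> q <= 1 ->
  cnorm (cexp z - \sum_(k < N) z ^+ k / k`!%:R) <=
  2 * (q ^+ N * expR (2 * cnorm z / q)).
Proof.
move=> q0 q1; case: z => x y; apply: le_trans (cexp_remainder_aux x y N q0 q1) _.
rewrite ler_wpM2l// ler_wpM2l ?exprn_ge0 ?(ltW q0)// ler_expR ler_wpM2r ?invr_ge0 ?(ltW q0)//.
rewrite mulr_natl mulr2n lerD//; first exact: (ler_Re_cnorm (x +i* y)%C).
exact: (ler_Im_cnorm (x +i* y)%C).
Qed.

End ExpRemainder.

Lemma exprn_fact_le_expR (R : realType) (x : R) k : 0 <= x -> x ^+ k / k`!%:R <= expR x.
Proof.
move=> x0; case: k => [|k].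
  by rewrite expr0 fact0 divr1 (le_trans _ (expR_ge1Dx x))// lerDl.
by rewrite (le_trans _ (expR_ge1Dxn k x0))// lerDr.
Qed.

(** * Complex-valued integrals *)

Section ComplexIntegral.
Context d (T : measurableType d) (R : realType).
Variables (mu : {measure set T -> \bar R}) (D : set T).
Hypothesis mD : measurable D.
Local Notation C := (Cplx R).
Implicit Types F G : T -> C.

Definition cmeasurable F :=
  measurable_fun D (fun x => complex.Re (F x)) /\
  measurable_fun D (fun x => complex.Im (F x)).

Lemma cmeasurableM F G : cmeasurable F -> cmeasurable G ->
  cmeasurable (fun x => F x * G x).
Proof.
move=> [rF iF] [rG iG]; split.
  under eq_fun do rewrite cReM.
  by apply: measurable_funB; apply: measurable_funM.
under eq_fun do rewrite cImM.
by apply: measurable_funD; apply: measurable_funM.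
Qed.

Lemma cmeasurable_real (f : T -> R) : measurable_fun D f ->
  cmeasurable (fun x => ((f x)%:C)%C).
Proof. by move=> mf; split=> //; exact: measurable_cst. Qed.

Lemma cmeasurable_cpow (f : T -> R) (z : C) : measurable_fun D f ->
  cmeasurable (fun x => cpow (f x) z).
Proof.
move=> mf; apply: cmeasurableM.
  by apply: cmeasurable_real; apply: (measurableT_comp (measurable_powR _)).
have mln : measurable_fun D (fun x => complex.Im z * ln (f x)).
  apply: measurable_funM; first exact: measurable_cst.
  exact: (measurableT_comp (@measurable_ln R)).
split.
  exact: (measurableT_comp (continuous_measurable_fun (@continuous_cos R))).
exact: (measurableT_comp (continuous_measurable_fun (@continuous_sin R))).
Qed.

Lemma cintegrable_dominated F (K : T -> R) : cmeasurable F ->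
  mu.-integrable D (EFin \o K) -> (forall x, D x -> cnorm (F x) <= K x) ->
  cintegrable mu D F.
Proof.
move=> [rF iF] iK FK; split.
  apply: (le_integrable mD _ _ iK); first exact/measurable_EFinP.
  move=> x Dx /=; rewrite lee_fin (le_trans (ler_Re_cnorm _))//.
  by rewrite (le_trans (FK _ Dx))// ler_norm.
apply: (le_integrable mD _ _ iK); first exact/measurable_EFinP.
move=> x Dx /=; rewrite lee_fin (le_trans (ler_Im_cnorm _))//.
by rewrite (le_trans (FK _ Dx))// ler_norm.
Qed.

Lemma cintegrableB F G : cintegrable mu D F -> cintegrable mu D G ->
  cintegrable mu D (fun x => F x - G x).
Proof.
move=> [rF iF] [rG iG]; split.
  by under eq_fun do rewrite cReB EFinB; exact: integrableB.
by under eq_fun do rewrite cImB EFinB; exact: integrableB.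
Qed.

Lemma cintegrableD F G : cintegrable mu D F -> cintegrable mu D G ->
  cintegrable mu D (fun x => F x + G x).
Proof.
move=> [rF iF] [rG iG]; split.
  by under eq_fun do rewrite cReD EFinD; exact: integrableD.
by under eq_fun do rewrite cImD EFinD; exact: integrableD.
Qed.

Lemma cintegrableZ (c : C) F : cintegrable mu D F ->
  cintegrable mu D (fun x => c * F x).
Proof.
move=> [rF iF]; split.
  under eq_fun do rewrite cReM EFinB !EFinM.
  by apply: integrableB => //; exact: integrableZl.
under eq_fun do rewrite cImM EFinD !EFinM.
by apply: integrableD => //; exact: integrableZl.
Qed.

Lemma cintegrable_sum N (F : nat -> T -> C) : (forall k, cintegrable mu D (F k)) ->
  cintegrable mu D (fun x => \sum_(k < N) F k x).
Proof.
move=> iF; elim: N => [|N IH].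
  by under eq_fun do rewrite big_ord0; split; exact: integrable0.
by under eq_fun do rewrite big_ord_recr; exact: cintegrableD.
Qed.

Lemma cintegralB F G : cintegrable mu D F -> cintegrable mu D G ->
  cintegral mu D (fun x => F x - G x) = cintegral mu D F - cintegral mu D G.
Proof.
move=> [rF iF] [rG iG]; apply: complex_eq; rewrite ?cReB ?cImB /cintegral/=.
  by under eq_Rintegral do rewrite cReB; rewrite RintegralB.
by under eq_Rintegral do rewrite cImB; rewrite RintegralB.
Qed.

Lemma cintegralD F G : cintegrable mu D F -> cintegrable mu D G ->
  cintegral mu D (fun x => F x + G x) = cintegral mu D F + cintegral mu D G.
Proof.
move=> [rF iF] [rG iG]; apply: complex_eq; rewrite ?cReD ?cImD /cintegral/=.
  by under eq_Rintegral do rewrite cReD; rewrite RintegralD.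
by under eq_Rintegral do rewrite cImD; rewrite RintegralD.
Qed.

Lemma cintegralZ (c : C) F : cintegrable mu D F ->
  cintegral mu D (fun x => c * F x) = c * cintegral mu D F.
Proof.
have iZ (r : R) (f : T -> R) : mu.-integrable D (EFin \o f) ->
    mu.-integrable D (EFin \o (fun x => r * f x)).
  by move=> h; apply: eq_integrable (integrableZl mD r h).
move=> [rF iF]; apply: complex_eq; rewrite ?cReM ?cImM /cintegral/=.
  under eq_Rintegral do rewrite cReM.
  by rewrite RintegralB ?RintegralZl//; exact: iZ.
under eq_Rintegral do rewrite cImM.
by rewrite RintegralD ?RintegralZl//; exact: iZ.
Qed.

Lemma cintegral_sum N (F : nat -> T -> C) : (forall k, cintegrable mu D (F k)) ->
  cintegral mu D (fun x => \sum_(k < N) F k x) = \sum_(k < N) cintegral mu D (F k).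
Proof.
move=> iF; elim: N => [|N IH].
  rewrite big_ord0 /cintegral; under eq_Rintegral do rewrite big_ord0.
  rewrite [X in (_ +i* X)%C](_ : _ = 0); last first.
    by under eq_Rintegral do rewrite big_ord0; rewrite Rintegral_cst// mul0r.
  by rewrite Rintegral_cst// mul0r.
rewrite big_ord_recr /= -IH -cintegralD//; last exact: cintegrable_sum.
by congr cintegral; apply/funext => x; rewrite big_ord_recr.
Qed.

Lemma eq_cintegral F G : (forall x, D x -> F x = G x) ->
  cintegral mu D F = cintegral mu D G.
Proof.
move=> FG; rewrite /cintegral; congr (_ +i* _)%C; apply: eq_Rintegral => x;
  by rewrite inE => Dx; rewrite FG.
Qed.

Lemma eq_cintegrable F G : (forall x, D x -> F x = G x) ->
  cintegrable mu D F -> cintegrable mu D G.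
Proof.
move=> FG [rF iF]; split; [move: rF|move: iF]; apply: eq_integrable => // x;
  by rewrite inE => Dx; rewrite FG.
Qed.

(** The factor 2 comes from bounding real and imaginary parts separately; it is harmless for Taylor
    bounds. *)
Lemma ler_cnorm_cintegral F (K : T -> R) : cintegrable mu D F ->
  mu.-integrable D (EFin \o K) -> (forall x, D x -> cnorm (F x) <= K x) ->
  cnorm (cintegral mu D F) <= 2 * \int[mu]_(x in D) K x.
Proof.
move=> [rF iF] iK FK; rewrite (le_trans (cnorm_le_ReIm _))// mulr_natl mulr2n.
rewrite lerD//.
  rewrite (le_trans (le_normr_Rintegral mD rF))//; apply: le_Rintegral => //.
    exact: (integrable_norm rF).
  by move=> x Dx; rewrite (le_trans (ler_Re_cnorm _))// FK.
rewrite (le_trans (le_normr_Rintegral mD iF))//; apply: le_Rintegral => //.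
  exact: (integrable_norm iF).
by move=> x Dx; rewrite (le_trans (ler_Im_cnorm _))// FK.
Qed.

(** * Analyticity of Mellin transforms *)

Section Mellin.
Variables f g : T -> R.
Hypothesis mf : measurable_fun D f.
Hypothesis mg : measurable_fun D g.
Hypothesis g0 : forall x, D x -> 0 <= g x.
Hypothesis f0 : forall x, D x -> 0 < f x \/ g x = 0.

Definition mellin_fun (z : C) x : C := (((g x)%:C)%C : C) * cpow (f x) z.

Definition mellin (z : C) : C := cintegral mu D (mellin_fun z).

Let mellin_funM z : cmeasurable (mellin_fun z).
Proof.
by apply: cmeasurableM; [exact: cmeasurable_real|exact: cmeasurable_cpow].
Qed.

Section Expand.
Variables (w : C) (delta : R).
Hypothesis delta0 : 0 < delta.
Hypothesis int_lo : mu.-integrable D (fun x => (g x * f x `^ (complex.Re w - delta))%:E).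
Hypothesis int_hi : mu.-integrable D (fun x => (g x * f x `^ (complex.Re w + delta))%:E).

(** According to the sign of [ln f], one of the two powers equals
    [f ^ (Re w) * exp (delta * |ln f|)]; their sum dominates it in both cases. *)
Let K x := g x * (f x `^ (complex.Re w - delta) + f x `^ (complex.Re w + delta)).

Let iK : mu.-integrable D (EFin \o K).
Proof.
apply: eq_integrable (integrableD mD int_lo int_hi) => // x _ /=.
by rewrite -EFinD -mulrDr.
Qed.

Let K_bound x (a : R) : D x -> a <= delta ->
  g x * (f x `^ complex.Re w * expR (a * `|ln (f x)|)) <= K x.
Proof.
move=> Dx ad; rewrite /K; have [fx|->] := f0 Dx; last by rewrite !mul0r.
rewrite ler_wpM2l ?g0// /powR gt_eqF// -expRD.
have [L0|L0] := leP 0 (ln (f x)).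
  rewrite ger0_norm// -mulrDl (le_trans _ (_ : expR ((complex.Re w + delta) * ln (f x)) <= _))//.
    by rewrite ler_expR ler_wpM2r// lerD2l.
  by rewrite lerDr expR_ge0.
rewrite ltr0_norm// mulrN -mulNr -mulrDl.
rewrite (le_trans _ (_ : expR ((complex.Re w - delta) * ln (f x)) <= _))//.
  by rewrite ler_expR ler_wnM2r ?(ltW L0)// lerD2l lerN2.
by rewrite lerDl expR_ge0.
Qed.

Let coef_fun k x : C :=
  mellin_fun w x * ((((ln (f x)) ^+ k / k`!%:R)%:C)%C : C).

Let mcoef k : cmeasurable (coef_fun k).
Proof.
apply: cmeasurableM => //; apply: cmeasurable_real; apply: measurable_funM.
  by apply: measurable_funX; exact: (measurableT_comp (@measurable_ln R)).
exact: measurable_cst.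
Qed.

(** This is [(delta * |ln f|) ^ k / k! <= exp (delta * |ln f|)], followed by [K_bound]. *)
Let coef_bound k x : D x -> cnorm (coef_fun k x) <= delta ^- k * K x.
Proof.
move=> Dx; rewrite /coef_fun /mellin_fun cnormM cnorm_real cnormM cnorm_real.
rewrite (ger0_norm (g0 Dx)); have [fx|gx] := f0 Dx; last first.
  by rewrite gx !mul0r mulr_ge0 ?invr_ge0 ?exprn_ge0 ?(ltW delta0)// /K gx mul0r.
rewrite cnorm_cpow ?(ltW fx)// normrM normrX (ger0_norm (_ : 0 <= k`!%:R^-1)) ?invr_ge0//.
have dk : 0 < delta ^+ k by rewrite exprn_gt0.
have := K_bound Dx (lexx delta).
rewrite -(@ler_pM2l _ (delta ^- k)) ?invr_gt0//; apply: le_trans.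
have -> : delta ^- k * (g x * (f x `^ complex.Re w * expR (delta * `|ln (f x)|))) =
  g x * f x `^ complex.Re w * (delta ^- k * expR (delta * `|ln (f x)|)) by ring.
rewrite ler_wpM2l ?mulr_ge0 ?g0 ?powR_ge0//.
rewrite [leRHS]mulrC ler_pdivlMr// mulrAC (mulrC _ (delta ^+ k)) -exprMn.
by apply: exprn_fact_le_expR; rewrite mulr_ge0 ?(ltW delta0).
Qed.

Let icoef k : cintegrable mu D (coef_fun k).
Proof.
apply: (@cintegrable_dominated _ (fun x => delta ^- k * K x)); first exact: mcoef.
  by apply: eq_integrable (integrableZl mD (delta ^- k) iK).
exact: coef_bound.
Qed.

Let mellin_fun_bound (h : C) x : D x -> cnorm h <= delta ->
  cnorm (mellin_fun (w + h) x) <= K x.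
Proof.
move=> Dx hd; rewrite /mellin_fun cnormM cnorm_real (ger0_norm (g0 Dx)).
have [fx|gx] := f0 Dx; last by rewrite gx mul0r /K gx mul0r.
apply: le_trans (K_bound Dx hd); rewrite ler_wpM2l ?g0// cnorm_cpow ?(ltW fx)// cReD.
rewrite /powR gt_eqF//. rewrite mulrDl expRD ler_pM2l ?expR_gt0// ler_expR.
rewrite (le_trans (ler_norm _))// normrM ler_wpM2r//; exact: ler_Re_cnorm.
Qed.

Let imellin (h : C) : cnorm h <= delta -> cintegrable mu D (mellin_fun (w + h)).
Proof.
by move=> hd; apply: (@cintegrable_dominated _ K) => // x Dx; exact: mellin_fun_bound.
Qed.

Let remainder_bound (h : C) N x : D x -> h != 0 -> 2 * cnorm h <= delta ->
  cnorm (mellin_fun (w + h) x - \sum_(k < N) h ^+ k * coef_fun k x) <=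
  2 * (2 / delta * cnorm h) ^+ N * K x.
Proof.
move=> Dx h0 hd; have [fx|gx] := f0 Dx; last first.
  rewrite /K gx mul0r mulr0 /coef_fun /mellin_fun gx mul0r big1 ?subr0 ?cnorm0//.
  by move=> k _; rewrite !mul0r mulr0.
(* This choice turns the factor of [cexp_remainder] into [exp (delta * |L|)], which [K]
   dominates. *)
pose L := ln (f x); set q := 2 / delta * cnorm h.
have q0 : 0 < q by rewrite !mulr_gt0 ?invr_gt0 ?cnorm_gt0.
have q1 : q <= 1 by rewrite /q mulrAC ler_pdivrMr// mul1r.
have -> : mellin_fun (w + h) x - \sum_(k < N) h ^+ k * coef_fun k x =
  (((g x)%:C)%C : C) * cpow (f x) w *
   (cexp (h * ((L%:C)%C : C)) - \sum_(k < N) (h * ((L%:C)%C : C)) ^+ k / k`!%:R).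
  rewrite mulrBr; congr (_ - _).
    by rewrite /mellin_fun !cpow_cexp// mulrDl cexpD mulrA.
  rewrite mulr_sumr; apply: eq_bigr => k _; rewrite /coef_fun /mellin_fun -/L.
  rewrite exprMn rmorphM rmorphXn fmorphV rmorph_nat /=; ring.
rewrite cnormM [cnorm (_ * cpow _ _)]cnormM cnorm_real (ger0_norm (g0 Dx)) cnorm_cpow ?(ltW fx)//.
have rem := cexp_remainder (h * ((L%:C)%C : C)) N q0 q1.
have E : 2 * cnorm (h * ((L%:C)%C : C)) / q = delta * `|L|.
  rewrite cnormM cnorm_real /q; field.
  by rewrite cnorm_eq0 h0 gt_eqF.
rewrite E in rem.
apply: (@le_trans _ _ (g x * f x `^ complex.Re w * (2 * (q ^+ N * expR (delta * `|L|))))).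
  by rewrite ler_wpM2l// mulr_ge0 ?g0 ?powR_ge0.
have -> : g x * f x `^ complex.Re w * (2 * (q ^+ N * expR (delta * `|L|))) =
  2 * q ^+ N * (g x * (f x `^ complex.Re w * expR (delta * `|L|))) by ring.
by rewrite ler_wpM2l ?mulr_ge0 ?exprn_ge0 ?(ltW q0)// K_bound.
Qed.

(** Integrate the pointwise expansion of [f ^ h = exp (h * ln f)]: [remainder_bound] is uniform in
    [N] and integrable through [K]. The constant 4 is the 2 of the remainder times the 2 of
    [ler_cnorm_cintegral]. *)
Lemma taylor_mellin : taylor mellin w (fun k => cintegral mu D (coef_fun k)).
Proof.
have IK0 : 0 <= \int[mu]_(x in D) K x.
  by apply: Rintegral_ge0 => x Dx; rewrite mulr_ge0 ?g0// addr_ge0 ?powR_ge0.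
exists (4 * \int[mu]_(x in D) K x), (2 / delta); split; first by rewrite divr_gt0.
move=> z N zr; set h := z - w in zr *.
have -> : z = w + h by rewrite /h addrC subrK.
have hd : 2 * cnorm h <= delta by move: zr; rewrite mulrAC ler_pdivrMr// mul1r.
have hd1 : cnorm h <= delta by have := cnorm_ge0 h; lra.
(* The centre is separate because [cexp_remainder] requires [q > 0]. *)
have [h0|h0] := eqVneq h 0.
  rewrite h0 addr0 cnorm0 mulr0; case: N {zr} => [|N].
    rewrite big_ord0 subr0 expr0 mulr1.
    apply: (@le_trans _ _ (2 * \int[mu]_(x in D) K x)); last by lra.
    rewrite -[w in leLHS]addr0; apply: ler_cnorm_cintegral iK _.
      by apply: imellin; rewrite cnorm0 ltW.
    by move=> x Dx; apply: mellin_fun_bound => //; rewrite cnorm0 ltW.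
  rewrite big_ord_recl expr0 mulr1 big1 ?addr0; last first.
    by move=> i _; rewrite /= exprS mul0r mulr0.
  rewrite [X in _ - X](_ : _ = mellin w) ?subrr ?cnorm0 ?expr0n/= ?mulr0//.
  apply: eq_cintegral => x _; rewrite /coef_fun expr0 fact0 divr1.
  by rewrite rmorph1 mulr1.
under eq_bigr do rewrite mulrC -cintegralZ//.
rewrite -(@cintegral_sum _ (fun k x => h ^+ k * coef_fun k x)); last by move=> k; exact: cintegrableZ.
rewrite -cintegralB; [|exact: imellin|]; last first.
  by apply: (@cintegrable_sum _ (fun k x => h ^+ k * coef_fun k x)) => k; exact: cintegrableZ.
have iK' : mu.-integrable D (EFin \o (fun x => 2 * (2 / delta * cnorm h) ^+ N * K x)).
  by apply: eq_integrable (integrableZl mD (2 * (2 / delta * cnorm h) ^+ N) iK).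
apply: le_trans (ler_cnorm_cintegral _ iK' _) _.
- apply: cintegrableB; first exact: imellin.
  by apply: (@cintegrable_sum _ (fun k x => h ^+ k * coef_fun k x)) => k; exact: cintegrableZ.
- by move=> x Dx; exact: remainder_bound.
- rewrite RintegralZl// le_eqVlt; apply/orP; left; apply/eqP; ring.
Qed.

Lemma cintegrable_mellin : cintegrable mu D (mellin_fun w).
Proof. by rewrite -[w]addr0; apply: imellin; rewrite cnorm0 ltW. Qed.

End Expand.

End Mellin.

End ComplexIntegral.

(** * The Gamma function on the positive reals *)

Section Scaling.
Context {R : realType}.
Local Open Scope ereal_scope.
Local Notation mu := (@lebesgue_measure R).

Local Notation Rpos := (`]0%R, +oo[%classic : set R).

Definition scale_fun (c : R) : R -> measurableTypeR R := fun x => (c * x)%R.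

Lemma measurable_scale_fun (c : R) : measurable_fun [set: R] (scale_fun c).
Proof. by apply: measurable_funM => //; exact: measurable_cst. Qed.

Definition scaled_lebesgue (c : {nonneg R}) :
  {measure set (measurableTypeR R) -> \bar R}.
Proof.
refine (mscale c (pushforward mu (scale_fun c%:num))).
exact: measurable_scale_fun.
Defined.

(** Both measures give []a, b]] its length, which characterises Lebesgue measure. *)
Lemma scaled_lebesgueE (c : {nonneg R}) (A : set R) : (0 < c%:num)%R -> measurable A ->
  scaled_lebesgue c A = mu A.
Proof.
move=> c0 mA; apply/esym/lebesgue_measure_unique => //= _ [[a b]] _ <-.
rewrite /scaled_lebesgue/= /mscale /pushforward.
have E : scale_fun c%:num @^-1` `]a, b] = `](a / c%:num)%R, (b / c%:num)%R]%classic :> set R.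
  apply/seteqP; split=> x /=; rewrite !in_itv/= /scale_fun;
    by rewrite ltr_pdivrMr// ler_pdivlMr// (mulrC x).
rewrite [X in _ = _ * X](_ : _ = mu `](a / c%:num)%R, (b / c%:num)%R]%classic); last by congr mu.
rewrite /= !lebesgue_measure_itv/= !lte_fin ltr_pM2r ?invr_gt0//.
case: ifPn => _; last by rewrite mule0.
by rewrite -!EFinB -EFinM -mulrBl mulrC divfK// gt_eqF.
Qed.

Lemma ge0_integral_scale (c : R) (D : set R) (f : R -> \bar R) : (0 < c)%R ->
  measurable D -> measurable_fun D f -> (forall x, D x -> 0 <= f x) ->
  \int[mu]_(x in D) f x = c%:E * \int[mu]_(x in scale_fun c @^-1` D) f (c * x)%R.
Proof.
move=> c0 mD mf f0.
pose k : {nonneg R} := NngNum (ltW c0).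
rewrite (@eq_measure_integral _ (measurableTypeR R) _ D (scaled_lebesgue k)); last first.
  by move=> A mA _; apply/esym; exact: (@scaled_lebesgueE k).
rewrite ge0_integral_mscale//; congr (_ * _).
rewrite ge0_integral_pushforward//; first exact: measurable_scale_fun.
by move=> y; rewrite inE; exact: f0.
Qed.

Lemma ge0_integral_scale_gt0 (c : R) (f : R -> \bar R) : (0 < c)%R ->
  measurable_fun Rpos f -> (forall x, (0 < x)%R -> 0 <= f x) ->
  \int[mu]_(x in Rpos) f x = c%:E * \int[mu]_(x in Rpos) f (c * x)%R.
Proof.
move=> c0 mf f0; rewrite (ge0_integral_scale c0)//; last first.
  by move=> x /=; rewrite in_itv/= andbT; exact: f0.
congr (_ * _); congr (integral _ _ _); apply/seteqP; split=> x /=;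
  by rewrite !in_itv/= !andbT /scale_fun pmulr_rgt0.
Qed.

Lemma ge0_integral_scaleT (c : R) (f : R -> \bar R) : (0 < c)%R ->
  measurable_fun setT f -> (forall x, 0 <= f x) ->
  \int[mu]_x f x = c%:E * \int[mu]_x f (c * x)%R.
Proof. by move=> c0 mf f0; rewrite (ge0_integral_scale c0). Qed.

End Scaling.

Lemma ge0_tonelli_set d1 d2 (T1 : measurableType d1) (T2 : measurableType d2) (R : realType)
  (m1 : {sigma_finite_measure set T1 -> \bar R})
  (m2 : {sigma_finite_measure set T2 -> \bar R}) (D1 : set T1) (D2 : set T2)
  (f : T1 * T2 -> R) : measurable D1 -> measurable D2 -> measurable_fun setT f ->
  (forall p, 0 <= f p) ->
  (\int[m1]_(x in D1) \int[m2]_(y in D2) (f (x, y))%:E =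
   \int[m2]_(y in D2) \int[m1]_(x in D1) (f (x, y))%:E)%E.
Proof.
move=> mD1 mD2 mf f0.
pose g : T1 * T2 -> \bar R := ((EFin \o f) \_ (D1 `*` D2))%E.
have mg : measurable_fun setT g.
  by apply/(measurable_restrictT _ (measurableX mD1 mD2))/measurable_EFinP/measurable_funTS.
have g0 p : (0 <= g p)%E by rewrite /g patchE; case: ifP => // _; rewrite lee_fin.
transitivity (\int[m1]_x \int[m2]_y g (x, y))%E.
  rewrite integral_mkcond; apply: eq_integral => x _; rewrite patchE.
  case: ifPn => [xD|xD].
    rewrite integral_mkcond; apply: eq_integral => y _.
    by rewrite /g !patchE in_setX xD.
  by rewrite integral0_eq// => y _; rewrite /g patchE in_setX (negbTE xD).
rewrite fubini_tonelli//.
rewrite [RHS]integral_mkcond; apply: eq_integral => y _; rewrite patchE.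
case: ifPn => [yD|yD].
  rewrite [RHS]integral_mkcond; apply: eq_integral => x _.
  by rewrite /g !patchE in_setX yD andbT.
by rewrite integral0_eq// => x _; rewrite /g patchE in_setX (negbTE yD) andbF.
Qed.

Lemma ge0_integral_EFinZl d (T : measurableType d) (R : realType)
    (mu : {measure set T -> \bar R}) (D : set T) (f : T -> R) (k : R) :
  measurable D -> measurable_fun D f -> (forall x, D x -> 0 <= f x) -> 0 <= k ->
  (\int[mu]_(x in D) (k * f x)%:E = k%:E * \int[mu]_(x in D) (f x)%:E)%E.
Proof.
move=> mD mf f0 k0; under eq_integral do rewrite EFinM.
by rewrite ge0_integralZl//; exact/measurable_EFinP.
Qed.

Section RealGamma.
Context {R : realType}.
Local Open Scope ereal_scope.
Local Notation mu := (@lebesgue_measure R).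
Local Notation Rpos := (`]0%R, +oo[%classic : set R).

(** Extended values let Tonelli's theorem be applied before convergence is known; [gammaE_rec] is
    proved this way and then used for finiteness. *)
Definition gammaE (a : R) : \bar R := \int[mu]_(t in Rpos) (t `^ (a - 1) * expR (- t))%:E.

Lemma measurable_powR_expR (a s : R) (D : set R) :
  measurable_fun D (fun t : R => t `^ a * expR (- (s * t)))%R.
Proof.
apply: measurable_funTS; apply: measurable_funM; first exact: measurable_powR.
apply: (measurableT_comp (@measurable_expR R)).
by apply: measurableT_comp => //; apply: measurable_funM => //; exact: measurable_cst.
Qed.

Lemma measurable_expRN (s : R) (D : set R) : measurable_fun D (fun t : R => expR (- (s * t)))%R.
Proof.
apply: measurable_funTS; apply: (measurableT_comp (@measurable_expR R)).
by apply: measurableT_comp => //; apply: measurable_funM => //; exact: measurable_cst.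
Qed.

Lemma measurable_gamma_fun (a : R) (D : set R) :
  measurable_fun D (fun t : R => t `^ (a - 1) * expR (- t))%R.
Proof.
rewrite (_ : (fun t : R => _) = (fun t : R => t `^ (a - 1) * expR (- (1 * t)))%R).
  exact: measurable_powR_expR.
by apply/funext => t; rewrite mul1r.
Qed.

Lemma gammaE_ge0 a : 0 <= gammaE a.
Proof. by apply: integral_ge0 => t _; rewrite lee_fin mulr_ge0 ?powR_ge0 ?expR_ge0. Qed.

(** Substitution [t -> s * t] in [gammaE a]. *)
Lemma laplace_powR (a s : R) : (0 < s)%R ->
  \int[mu]_(t in Rpos) (t `^ (a - 1) * expR (- (s * t)))%:E = (s `^ (- a))%:E * gammaE a.
Proof.
move=> s0; rewrite /gammaE [in RHS](ge0_integral_scale_gt0 s0); first last.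
- by move=> x _; rewrite lee_fin mulr_ge0 ?powR_ge0 ?expR_ge0.
- apply/measurable_EFinP.
apply: measurable_gamma_fun.
rewrite [X in _ = _ * (_ * X)](_ : _ =
    \int[mu]_(t in Rpos) (s `^ (a - 1) * (t `^ (a - 1) * expR (- (s * t))))%:E); last first.
  apply: eq_integral => t; rewrite inE/= in_itv/= andbT => t0.
  by rewrite powRM ?(ltW s0) ?(ltW t0)// mulrA.
rewrite ge0_integral_EFinZl ?powR_ge0//; first last.
- by move=> x _; rewrite mulr_ge0 ?powR_ge0 ?expR_ge0.
- exact: measurable_powR_expR.
rewrite !muleA -!EFinM -[X in (_ * X * _)%R](powRr1 (ltW s0)) -mulrA -powRD; last first.
  by apply/implyP => _; rewrite gt_eqF.
by rewrite addrCA subrr addr0 -powRD ?addNr ?powRr0 ?mul1e//; apply/implyP => _; rewrite gt_eqF.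
Qed.

Lemma cvgry_expRN (s : R) : (0 < s)%R -> expR (- (s * x)) @[x --> +oo%R] --> (0 : R)%R.
Proof.
move=> s0; apply: (@cvg_comp _ _ _ (fun x => s * x)%R (fun z => expR (- z))%R _ (pinfty_nbhs R)).
  exact: gt0_cvgMry.
exact: cvgr_expR.
Qed.

Lemma integral_expRN (s a : R) : (0 < s)%R ->
  \int[mu]_(t in `[a, +oo[) (expR (- (s * t)))%:E = (expR (- (s * a)) / s)%:E.
Proof.
move=> s0.
have d (x : R) : is_derive x 1%R (fun t : R => - (expR (- (s * t)) / s))%R (expR (- (s * x))).
  apply: is_derive_eq; rewrite /GRing.scale/= !mulr1; field; rewrite gt_eqF//.
have c : continuous (fun t : R => expR (- (s * t)))%R.
  move=> x; apply: continuous_comp; last exact: continuous_expR.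
  by apply: continuousN; apply: continuousM => //; exact: cst_continuous.
rewrite (@ge0_continuous_FTC2y _ _ (fun t => - (expR (- (s * t)) / s))%R a 0%R).
- by rewrite sub0e EFinN oppeK.
- by move=> x _; exact: expR_ge0.
- exact: continuous_subspaceT.
- rewrite -oppr0 -[in X in _ --> X](mul0r s^-1%R); apply: cvgN; apply: cvgMl.
  exact: cvgry_expRN.
- by move=> x _; exact: ex_derive.
- apply: cvg_at_right_filter; apply: cvgN; apply: cvgMl; exact: c.
- by move=> x _; rewrite derive1E; exact: derive_val.
Qed.

Lemma integral_expRN0 (s : R) : (0 < s)%R ->
  \int[mu]_(t in Rpos) (expR (- (s * t)))%:E = (s^-1)%:E.
Proof.
move=> s0; rewrite integral_itv_obnd_cbnd.
  by rewrite integral_expRN// mulr0 oppr0 expR0 mul1r.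
apply/measurable_EFinP; exact: measurable_expRN.
Qed.

Lemma integral_powRN (a : R) : (0 < a)%R ->
  \int[mu]_(t in `[1%R, +oo[) (t `^ (- a - 1))%:E = (a^-1)%:E.
Proof.
move=> a0.
have d (x : R) : (0 < x)%R ->
    is_derive x 1%R (fun t : R => - (t `^ (- a) / a))%R (x `^ (- a - 1))%R.
  move=> x0; have := is_derive1_powR (- a) x0 => h.
  apply: is_derive_eq; rewrite /GRing.scale/= !mulr0 add0r.
  by field; rewrite gt_eqF.
have dc (p x : R) : (0 < x)%R -> {for x, continuous (fun t : R => t `^ p)}%R.
  move=> x0; apply: differentiable_continuous; apply/derivable1_diffP.
  have := is_derive1_powR p x0 => h; exact: ex_derive.
rewrite (@ge0_continuous_FTC2y _ _ (fun t => - (t `^ (- a) / a))%R 1%R 0%R).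
- by rewrite sub0e EFinN oppeK powR1 div1r.
- by move=> x _; exact: powR_ge0.
- apply: continuous_in_subspaceT => x; rewrite inE/= in_itv/= andbT => x1.
  by apply: dc; exact: lt_le_trans x1.
- rewrite -oppr0 -[in X in _ --> X](mul0r a^-1%R); apply: cvgN; apply: cvgMl.
  apply/cvgrPdist_lt => e e0; near=> x.
  have x0 : (0 < x)%R by near: x; exact: nbhs_pinfty_gt.
  rewrite sub0r normrN ger0_norm ?powR_ge0// powRN -[e]invrK ltf_pV2 ?posrE ?powR_gt0 ?invr_gt0//.
  have -> : (e^-1 = (e^-1 `^ a^-1) `^ a)%R.
    by rewrite -powRrM mulVf ?gt_eqF// powRr1// invr_ge0 ltW.
  apply: gt0_ltr_powR; rewrite ?nnegrE ?powR_ge0 ?(ltW x0)//.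
- move=> x x1; have h := d x (lt_trans ltr01 x1); exact: ex_derive.
- apply: cvg_at_right_filter; apply: cvgN; apply: cvgMl; exact: dc.
- move=> x; rewrite in_itv/= andbT => x1; rewrite derive1E.
  by have h := d x (lt_trans ltr01 x1); exact: derive_val.
Unshelve. all: by end_near. Qed.

(* Integrate [t ^ a e ^ (- s t)] over [t > 0] and [s > 1] in both orders.     *)
Lemma gammaE_rec (a : R) : (0 < a)%R -> gammaE a = (a^-1)%:E * gammaE (a + 1).
Proof.
move=> a0.
pose f (p : R * R) : R := (p.1 `^ a * expR (- (p.2 * p.1)))%R.
have mf : measurable_fun setT f.
  apply: measurable_funM.
    exact: (measurableT_comp (@measurable_powR R a) measurable_fst).
  apply: (measurableT_comp (@measurable_expR R)); apply: measurableT_comp => //.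
  by apply: measurable_funM; [exact: measurable_snd|exact: measurable_fst].
have f0 p : (0 <= f p)%R by rewrite mulr_ge0 ?powR_ge0 ?expR_ge0.
have := @ge0_tonelli_set _ _ _ _ _ mu mu Rpos `[1%R, +oo[%classic f
  (measurable_itv _) (measurable_itv _) mf f0.
rewrite [X in X = _ -> _](_ : _ = gammaE a); last first.
  apply: eq_integral => t; rewrite inE/= in_itv/= andbT => t0; rewrite /f/=.
  under eq_integral do rewrite (mulrC _ t).
  rewrite ge0_integral_EFinZl ?powR_ge0//; last exact: measurable_expRN.
  rewrite integral_expRN// mulr1 -EFinM mulrCA mulrC; congr (_ * _)%:E.
  by rewrite powRB ?powRr1 ?(ltW t0)//; apply/implyP => _; rewrite gt_eqF.
move=> ->.
rewrite [LHS](_ : _ = \int[mu]_(s in `[1%R, +oo[) ((s `^ (- a - 1))%:E * gammaE (a + 1))); last first.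
  apply: eq_integral => s; rewrite inE/= in_itv/= andbT => s1; rewrite /f/=.
  have := @laplace_powR (a + 1) s (lt_le_trans ltr01 s1).
  by rewrite addrK opprD => <-.
rewrite ge0_integralZr ?integral_powRN ?gammaE_ge0//; last first.
  by move=> x _; rewrite lee_fin powR_ge0.
apply/measurable_EFinP; apply: measurable_funTS; exact: measurable_powR.
Qed.

(** For [b >= 1] the integrand is at most a constant times [exp (- t / 2)]; the recursion
    [gammaE_rec] then covers exponents below 1, where it is singular at 0. *)
Lemma gammaE_lty (a : R) : (0 < a)%R -> gammaE a < +oo.
Proof.
have big (b : R) : (1 <= b)%R -> gammaE b < +oo.
  move=> b1; pose N := `|Num.ceil (b - 1)|%N.
  have bN : (b - 1 <= N%:R)%R.
    rewrite (le_trans (Num.Theory.ceil_ge _))// /N natr_absz ler_int.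
    exact: ler_norm.
  (* The 1 handles [t <= 1]; the rest comes from [(t / 2) ^ N / N! <= exp (t / 2)]. *)
  pose c := (1 + 2 ^+ N * N`!%:R)%R : R.
  have c0 : (0 <= c)%R by rewrite addr_ge0// mulr_ge0 ?exprn_ge0.
  apply: (@le_lt_trans _ _ (c%:E * \int[mu]_(t in Rpos) (expR (- (2^-1 * t)))%:E)); last first.
    by rewrite integral_expRN0 ?invr_gt0// -EFinM ltry.
  have me : measurable_fun Rpos (fun t : R => (expR (- (2^-1 * t)))%:E).
    apply/measurable_EFinP; exact: measurable_expRN.
  rewrite -ge0_integralZl//.
  apply: ge0_le_integral => //.
  - by move=> t _; rewrite lee_fin mulr_ge0 ?powR_ge0 ?expR_ge0.
  - apply/measurable_EFinP; exact: measurable_gamma_fun.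
  - exact: measurable_funeM.
  move=> t; rewrite /= in_itv/= andbT => t0; rewrite -EFinM lee_fin.
  have -> : (- t = 2^-1 * t + - (2^-1 * t) - t)%R by ring.
  have e2 : (expR (- t) = expR (- (2^-1 * t)) * expR (- (2^-1 * t)))%R.
    by rewrite -expRD; congr expR; field.
  have tb : (t `^ (b - 1) <= c * expR (2^-1 * t))%R.
    have E1 : (1 <= expR (2^-1 * t))%R by rewrite -expR0 ler_expR mulr_ge0 ?invr_ge0 ?(ltW t0).
    apply: (@le_trans _ _ (1 + t ^+ N)%R).
      have [t1|t1] := leP t 1%R.
        rewrite (@le_trans _ _ 1%R)// ?lerDl ?exprn_ge0 ?(ltW t0)//.
        rewrite -[leRHS](powRr0 t); apply: ger_powR; rewrite ?t0//.
        by rewrite subr_ge0.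
      rewrite (@le_trans _ _ (t ^+ N)%R)// ?lerDr//.
      by rewrite -powR_mulrn ?(ltW t0)//; apply: ler_powR => //; exact: ltW.
    rewrite /c mulrDl mul1r lerD//.
    have := @exprn_fact_le_expR R (2^-1 * t) N; rewrite mulr_ge0 ?invr_ge0 ?(ltW t0)//.
    move=> /(_ isT); rewrite exprMn exprVn ler_pdivrMr ?ltr0n ?fact_gt0//.
    rewrite mulrC ler_pdivrMr ?exprn_gt0// => h; apply: le_trans h _.
    by rewrite le_eqVlt; apply/orP; left; apply/eqP; ring.
  rewrite (_ : (2^-1 * t + - (2^-1 * t) - t = - t)%R); last by ring.
  rewrite e2 mulrA; rewrite ler_wpM2r ?expR_ge0//.
  rewrite (le_trans (ler_wpM2r (expR_ge0 _) tb))// -mulrA -expRD subrr expR0 mulr1//.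
move=> a0; rewrite gammaE_rec// lte_mul_pinfty ?lee_fin ?invr_ge0 ?(ltW a0)//.
by rewrite big// lerDr ltW.
Qed.

Lemma gammaE_gt0 (a : R) : (0 < a)%R -> 0 < gammaE a.
Proof.
have big (b : R) : (1 <= b)%R -> 0 < gammaE b.
  move=> b1; apply: (@lt_le_trans _ _ (\int[mu]_(t in `[1%R, +oo[) (expR (- (1 * t)))%:E)).
    by rewrite integral_expRN// lte_fin divr_gt0// expR_gt0.
  have mb D : measurable D -> measurable_fun D (fun t : R => (t `^ (b - 1) * expR (- t))%:E).
    by move=> mD; apply/measurable_EFinP; exact: measurable_gamma_fun.
  apply: (@le_trans _ _ (\int[mu]_(t in `[1%R, +oo[) (t `^ (b - 1) * expR (- t))%:E)).
    apply: ge0_le_integral => //.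
    - apply/measurable_EFinP; exact: measurable_expRN.
    - exact: mb.
    - move=> t; rewrite /= in_itv/= andbT => t1.
      rewrite lee_fin mul1r ler_peMl ?expR_ge0// -[X in (X <= _)%R](powRr0 t); apply: ler_powR => //.
      by rewrite subr_ge0.
  apply: ge0_subset_integral => //; first exact: mb.
  - by move=> t _; rewrite lee_fin mulr_ge0 ?powR_ge0 ?expR_ge0.
  - by move=> t /=; rewrite !in_itv/= !andbT; exact: lt_le_trans.
move=> a0; rewrite gammaE_rec// mule_gt0 ?lte_fin ?invr_gt0//.
by rewrite big// lerDr ltW.
Qed.

Definition rgamma (a : R) : R := fine (gammaE a).

Lemma rgammaE a : (0 < a)%R -> gammaE a = (rgamma a)%:E.
Proof. by move=> a0; rewrite /rgamma fineK// ge0_fin_numE ?gammaE_ge0// gammaE_lty. Qed.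

Lemma rgamma_gt0 a : (0 < a)%R -> (0 < rgamma a)%R.
Proof. by move=> a0; rewrite -lte_fin -rgammaE// gammaE_gt0. Qed.

Lemma rgammaS a : (0 < a)%R -> (rgamma (a + 1) = a * rgamma a)%R.
Proof.
move=> a0; have := gammaE_rec a0; rewrite !rgammaE ?addr_gt0// -EFinM => -[->].
by rewrite mulrA divff ?mul1r// gt_eqF.
Qed.

End RealGamma.

(** * The zeta integral at real arguments *)

Section Radial.
Context {R : realType}.
Local Open Scope ereal_scope.
Local Notation mu := (@lebesgue_measure R).
Local Notation Rpos := (`]0%R, +oo[%classic : set R).
Local Notation R2 := (measurableTypeR R * measurableTypeR R)%type.

Lemma integral_gauss_scale (s : R) : (0 < s)%R ->
  \int[mu]_x (expR (- (s * x ^+ 2)))%:E = (Num.sqrt pi / Num.sqrt s)%:E.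
Proof.
move=> s0; have c0 : (0 < Num.sqrt s)%R by rewrite sqrtr_gt0.
have := @integralT_gauss R; rewrite (ge0_integral_scaleT c0); last 2 first.
- apply/measurable_EFinP; exact: measurable_gauss_fun.
- by move=> x; rewrite lee_fin gauss_fun_ge0.
under eq_integral do rewrite /gauss_fun exprMn sqr_sqrtr ?(ltW s0)//.
set I := \int[mu]_x _ => h.
have I0 : 0 <= I by apply: integral_ge0 => x _; rewrite lee_fin expR_ge0.
have If : I \is a fin_num.
  rewrite ge0_fin_numE// ltey; apply/eqP => Iy; move: h.
  by rewrite Iy gt0_muley// lte_fin.
move: h; rewrite -(fineK If) -EFinM => -[<-]; congr EFin.
by rewrite mulrC mulKf// gt_eqF.
Qed.

Definition sqnorm2 (p : R2) : R := (p.1 ^+ 2 + p.2 ^+ 2)%R.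

Lemma sqnorm2_ge0 p : (0 <= sqnorm2 p)%R.
Proof. by rewrite addr_ge0 ?sqr_ge0. Qed.

Lemma measurable_sqnorm2 : measurable_fun [set: R2] sqnorm2.
Proof.
by apply: measurable_funD; apply: measurable_funX; [exact: measurable_fst|exact: measurable_snd].
Qed.

Lemma measurable_expR_sqnorm2 (s : R) D :
  measurable_fun D (fun p : R2 => expR (- (s * sqnorm2 p)))%R.
Proof.
apply: measurable_funTS; apply: (measurableT_comp (@measurable_expR R)).
apply: measurableT_comp => //; apply: measurable_funM; first exact: measurable_cst.
exact: measurable_sqnorm2.
Qed.

Lemma integral_gauss2 (s : R) : (0 < s)%R ->
  \int[lebesgue_R2 R]_p (expR (- (s * sqnorm2 p)))%:E = (pi / s)%:E.
Proof.
move=> s0; have m1 : measurable_fun [set: R] (fun y : R => expR (- (s * y ^+ 2)))%R.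
  apply: (measurableT_comp (@measurable_expR R)); apply: measurableT_comp => //.
  by apply: measurable_funM; [exact: measurable_cst|exact: measurable_funX].
rewrite (fubini_tonelli1 (m1 := mu) (m2 := mu))//; last first.
  by apply/measurable_EFinP; exact: measurable_expR_sqnorm2.
rewrite /fubini_F /=.
rewrite (_ : (fun x => _) = fun x : R =>
    (Num.sqrt pi / Num.sqrt s * expR (- (s * x ^+ 2)))%:E); last first.
  apply/funext => x; under eq_integral do rewrite /sqnorm2/= mulrDr opprD expRD.
  have := @ge0_integral_EFinZl _ _ _ mu setT (fun y : R => expR (- (s * y ^+ 2)))%R
    (expR (- (s * x ^+ 2))) measurableT m1 (fun y _ => expR_ge0 _) (expR_ge0 _).
  by move=> ->; rewrite integral_gauss_scale// -EFinM mulrC.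
rewrite ge0_integral_EFinZl//.
rewrite integral_gauss_scale// -EFinM; congr EFin.
by rewrite mulrACA -invfM -!expr2 !sqr_sqrtr ?pi_ge0 ?(ltW s0).
Qed.

Let origin : set R2 := [set (0%R, 0%R)].

Let measurable_origin : measurable origin.
Proof.
rewrite (_ : origin = [set 0%R] `*` [set 0%R]); first exact: measurableX.
by apply/seteqP; split=> -[x y] /= => [[-> ->]|[-> ->]].
Qed.

Let null_origin : lebesgue_R2 R origin = 0.
Proof.
rewrite (_ : origin = [set 0%R] `*` [set 0%R]); last first.
  by apply/seteqP; split=> -[x y] /= => [[-> ->]|[-> ->]].
transitivity ((mu \x mu) ([set 0%R] `*` [set 0%R])) => //.
rewrite product_measure1E// [X in X * _](_ : _ = 0) ?mul0e//.
exact: lebesgue_measure_set1.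
Qed.

(** [laplace_powR] needs [sqnorm2 p > 0], which fails only at the origin, a null set. *)
Let integral_setD_origin (F : R2 -> R) : measurable_fun setT F -> (forall p, 0 <= F p)%R ->
  \int[lebesgue_R2 R]_p (F p)%:E = \int[lebesgue_R2 R]_(p in setT `\` origin) (F p)%:E.
Proof.
move=> mF F0; apply: (ge0_negligible_integral measurable_origin) => //.
- exact/measurable_EFinP.
- by move=> p _; rewrite lee_fin.
Qed.

Let sqnorm2_gt0 p : ([set: R2] `\` origin) p -> (0 < sqnorm2 p)%R.
Proof.
case: p => x y [_ /= xy]; rewrite /sqnorm2/= lt_def addr_ge0 ?sqr_ge0// andbT.
rewrite paddr_eq0 ?sqr_ge0// !sqrf_eq0; apply/negP => /andP[/eqP x0 /eqP y0].
by apply: xy; rewrite /origin x0 y0.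
Qed.

(* Expand N^(a - 1) = Gamma(1 - a)^-1 * int_0^oo v^(- a) e^(- v N) dv with      *)
(* N = |p|^2, integrate the Gaussian, and undo the expansion with              *)
(* 1 / (v + s) = int_0^oo e^(- (v + s) t) dt.                                  *)
Lemma integral_powR_expR_sqnorm2 (a s : R) : (0 < a < 1)%R -> (0 < s)%R ->
  \int[lebesgue_R2 R]_p ((sqnorm2 p)^-1 * sqnorm2 p `^ a * expR (- (s * sqnorm2 p)))%:E =
  (pi * s `^ (- a) * rgamma a)%:E.
Proof.
move=> /andP[a0 a1] s0; have b0 : (0 < 1 - a)%R by rewrite subr_gt0.
set D := [set: R2] `\` origin.
have mD : measurable D by exact: measurableD.
pose k := rgamma (1 - a); have k0 : (0 < k)%R by exact: rgamma_gt0.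
have mpow (b : R) : measurable_fun [set: R2] (fun p => sqnorm2 p `^ b)%R.
  exact: (measurableT_comp (@measurable_powR R b) measurable_sqnorm2).
have mF : measurable_fun [set: R2]
    (fun p => (sqnorm2 p)^-1 * sqnorm2 p `^ a * expR (- (s * sqnorm2 p)))%R.
  apply: measurable_funM; last exact: measurable_expR_sqnorm2.
  apply: measurable_funM => //.
  rewrite (_ : (fun p => _) = fun p => sqnorm2 p `^ (-1)%R)%R//.
  by apply/funext => p; rewrite powR_inv1 ?sqnorm2_ge0.
have F0 p : (0 <= (sqnorm2 p)^-1 * sqnorm2 p `^ a * expR (- (s * sqnorm2 p)))%R.
  by rewrite !mulr_ge0 ?invr_ge0 ?sqnorm2_ge0 ?powR_ge0 ?expR_ge0.
pose G (q : R2 * R) : R := (q.2 `^ (1 - a - 1) * expR (- (sqnorm2 q.1 * q.2)) *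
  expR (- (s * sqnorm2 q.1)))%R.
have msq : measurable_fun [set: R2 * R] (fun q => sqnorm2 q.1).
  exact: (measurableT_comp measurable_sqnorm2 measurable_fst).
have mG : measurable_fun [set: R2 * R] G.
  apply: measurable_funM; first apply: measurable_funM.
  - exact: (measurableT_comp (@measurable_powR R _) measurable_snd).
  - apply: (measurableT_comp (@measurable_expR R)); apply: measurableT_comp => //.
    by apply: measurable_funM => //; exact: measurable_snd.
  - apply: (measurableT_comp (@measurable_expR R)); apply: measurableT_comp => //.
    by apply: measurable_funM => //; exact: measurable_cst.
have G0 q : (0 <= G q)%R by rewrite !mulr_ge0 ?powR_ge0 ?expR_ge0.
pose H (q : R * R) : R := (q.1 `^ (1 - a - 1) * expR (- (q.1 * q.2)) * expR (- (s * q.2)))%R.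
have mH : measurable_fun [set: R * R] H.
  apply: measurable_funM; first apply: measurable_funM.
  - exact: (measurableT_comp (@measurable_powR R _) measurable_fst).
  - apply: (measurableT_comp (@measurable_expR R)); apply: measurableT_comp => //.
    by apply: measurable_funM; [exact: measurable_fst|exact: measurable_snd].
  - apply: (measurableT_comp (@measurable_expR R)); apply: measurableT_comp => //.
    by apply: measurable_funM; [exact: measurable_cst|exact: measurable_snd].
have H0 q : (0 <= H q)%R by rewrite !mulr_ge0 ?powR_ge0 ?expR_ge0.
(* Expanding and undoing the expansion produce the same factor [k = Gamma(1 - a)], which cancels
   because it is finite and positive; this is where [a < 1] enters. *)
suff key : k%:E * \int[lebesgue_R2 R]_p
    ((sqnorm2 p)^-1 * sqnorm2 p `^ a * expR (- (s * sqnorm2 p)))%:E =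
    (k * (pi * s `^ (- a) * rgamma a))%:E.
  have : k^-1%:E * (k%:E * \int[lebesgue_R2 R]_p
      ((sqnorm2 p)^-1 * sqnorm2 p `^ a * expR (- (s * sqnorm2 p)))%:E) =
      k^-1%:E * (k * (pi * s `^ (- a) * rgamma a))%:E by rewrite key.
  by rewrite muleA -!EFinM mulVf ?gt_eqF// mul1e mulKf// gt_eqF.
transitivity (\int[lebesgue_R2 R]_(p in D) \int[mu]_(v in Rpos) (G (p, v))%:E).
  rewrite (integral_setD_origin mF F0) -/D.
  rewrite -(@ge0_integral_EFinZl _ _ _ (lebesgue_R2 R) D _ k mD (measurable_funTS mF) (fun p _ => F0 p) (ltW k0)).
  apply: eq_integral => p; rewrite inE => Dp.
  have N0 := sqnorm2_gt0 Dp; rewrite /G/=.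
  under eq_integral do rewrite mulrC.
  rewrite ge0_integral_EFinZl ?expR_ge0//; last 2 first.
  - exact: measurable_powR_expR.
  - by move=> v _; rewrite mulr_ge0 ?powR_ge0 ?expR_ge0.
  rewrite laplace_powR// rgammaE// -!EFinM; congr EFin.
  rewrite opprB -/k powRB; last by apply/implyP => _; rewrite gt_eqF.
  by rewrite powRr1 ?(ltW N0)//; ring.
transitivity (\int[mu]_(v in Rpos) \int[lebesgue_R2 R]_(p in D) (G (p, v))%:E).
  exact: ge0_tonelli_set.
transitivity (\int[mu]_(v in Rpos) (pi * (v `^ (1 - a - 1) / (v + s)))%:E).
  apply: eq_integral => v; rewrite inE/= in_itv/= andbT => v0.
  rewrite /G/=; under eq_integral => p _.
    rewrite -mulrA -expRD (mulrC (sqnorm2 p)) -opprD -mulrDl; over.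
  rewrite ge0_integral_EFinZl ?powR_ge0//; last exact: measurable_expR_sqnorm2.
  have := integral_gauss2 (addr_gt0 v0 s0).
  rewrite integral_setD_origin ?expR_ge0//; last exact: measurable_expR_sqnorm2.
  by move=> ->; rewrite -EFinM; congr EFin; ring.
have mp : measurable_fun Rpos (fun v : R => v `^ (1 - a - 1) / (v + s))%R.
  apply: measurable_funM; first by apply: measurable_funTS; exact: measurable_powR.
  apply: (@eq_measurable_fun _ _ _ _ _ (fun v : R => (v + s) `^ (-1)))%R.
    move=> v; rewrite inE/= in_itv/= andbT => v0.
    by rewrite powR_inv1// addr_ge0 ?(ltW v0) ?(ltW s0).
  apply: measurable_funTS; apply: (measurableT_comp (@measurable_powR R (-1))).
  by apply: measurable_funD => //; exact: measurable_cst.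
rewrite ge0_integral_EFinZl ?pi_ge0//; last first.
  move=> v; rewrite /= in_itv/= andbT => v0.
  by rewrite divr_ge0 ?powR_ge0// addr_ge0 ?(ltW v0) ?(ltW s0).
rewrite (_ : (k * _ = pi * (k * (s `^ (- a) * rgamma a)))%R); last by ring.
rewrite [RHS]EFinM; congr (_ * _).
transitivity (\int[mu]_(v in Rpos) \int[mu]_(t in Rpos) (H (v, t))%:E).
  apply: eq_integral => v; rewrite inE/= in_itv/= andbT => v0.
  rewrite /H/=; under eq_integral => t _.
    rewrite -mulrA -expRD -opprD -mulrDl; over.
  rewrite ge0_integral_EFinZl ?powR_ge0//; last exact: measurable_expRN.
  by rewrite integral_expRN0 ?addr_gt0// -EFinM.
transitivity (\int[mu]_(t in Rpos) \int[mu]_(v in Rpos) (H (v, t))%:E).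
  exact: ge0_tonelli_set.
transitivity (\int[mu]_(t in Rpos) (k * (t `^ (a - 1) * expR (- (s * t))))%:E).
  apply: eq_integral => t; rewrite inE/= in_itv/= andbT => t0.
  rewrite /H/=; under eq_integral => v _.
    rewrite mulrC (mulrC v); over.
  rewrite ge0_integral_EFinZl ?expR_ge0//; last 2 first.
  - exact: measurable_powR_expR.
  - by move=> v _; rewrite mulr_ge0 ?powR_ge0 ?expR_ge0.
  rewrite laplace_powR// rgammaE// -!EFinM; congr EFin.
  by rewrite opprB -/k; ring.
rewrite ge0_integral_EFinZl ?(ltW k0)//; last 2 first.
- exact: measurable_powR_expR.
- by move=> v _; rewrite mulr_ge0 ?powR_ge0 ?expR_ge0.
by rewrite laplace_powR// rgammaE// -!EFinM.
Qed.

End Radial.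

(** * Integrals of products over tuples *)

Section TupleIntegral.
Context d (T : measurableType d) (R : realType).
Variable mu : {sigma_finite_measure set T -> \bar R}.
Local Open Scope ereal_scope.

Lemma measurable_prod_tnth n (phi : T -> R) D : measurable_fun setT phi ->
  measurable_fun D (fun x : n.-tuple T => \prod_(j < n) phi (tnth x j))%R.
Proof.
move=> mphi; apply: measurable_prod => j _; apply: measurable_funTS.
exact: (measurableT_comp mphi (measurable_tnth j)).
Qed.

(** Tonelli peels off the first coordinate, [tuple_measure] being the image of a product under
    [cons_pair]; the base case is a Dirac mass at the empty tuple. *)
Lemma integral_tuple_prod n (phi : T -> R) (c : R) : measurable_fun setT phi ->
  (forall x, 0 <= phi x)%R -> \int[mu]_x (phi x)%:E = c%:E ->
  \int[tuple_measure mu n]_x (\prod_(j < n) phi (tnth x j))%:E = (c ^+ n)%:E.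
Proof.
move=> mphi phi0 intphi.
have prod0 m (x : m.-tuple T) : (0 <= \prod_(j < m) phi (tnth x j))%R.
  by apply: prodr_ge0 => j _.
elim: n => [|n IH].
  rewrite integral_dirac//; first by rewrite diracT mul1e big_ord0 expr0.
  by apply/measurable_EFinP; exact: measurable_prod_tnth.
transitivity (\int[pushforward (mu \x tuple_measure mu n) (@cons_pair _ T n)]_x
   (\prod_(j < n.+1) phi (tnth x j))%:E) => //.
rewrite ge0_integral_pushforward//=; last 3 first.
- exact: measurable_cons_pair.
- by apply/measurable_EFinP; exact: measurable_prod_tnth.
- by move=> x _; rewrite lee_fin; exact: prod0.
rewrite preimage_setT (fubini_tonelli1 (m1 := mu) (m2 := tuple_measure mu n))//; last 2 first.
- apply/measurable_EFinP; apply: (measurableT_comp (measurable_prod_tnth mphi)).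
  exact: measurable_cons_pair.
- by move=> x /=; rewrite lee_fin; exact: prod0.
rewrite /fubini_F /=.
rewrite (_ : (fun x => _) = fun x => (c ^+ n * phi x)%:E); last first.
  apply/funext => x.
  rewrite (_ : (fun y => _) = fun y : n.-tuple T => (phi x * \prod_(j < n) phi (tnth y j))%:E).
    rewrite ge0_integral_EFinZl//; last exact: measurable_prod_tnth.
    by rewrite IH -EFinM mulrC.
  apply/funext => y; congr EFin; rewrite big_ord_recl; congr (_ * _)%R.
  by apply: eq_bigr => j _; rewrite /cons_pair/= tnthS; congr phi; rewrite !(tnth_nth x).
have c0 : (0 <= c)%R by rewrite -lee_fin -intphi integral_ge0// => x _; rewrite lee_fin.
by rewrite ge0_integral_EFinZl ?exprn_ge0// intphi -EFinM exprSr.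
Qed.

End TupleIntegral.

(** * Closed form at real exponents *)

Section ZetaReal.
Context {R : realType}.
Variable n : nat.
Local Open Scope ereal_scope.
Local Notation mu := (@lebesgue_measure R).
Local Notation Rpos := (`]0%R, +oo[%classic : set R).
Local Notation R2 := (measurableTypeR R * measurableTypeR R)%type.
Implicit Types x : n.-tuple R2.

Definition zeta_real_fun (a : R) x : R :=
  ((\prod_(j < n) ((sqnorm2 (tnth x j))^-1 * sqnorm2 (tnth x j) `^ a)) *
   (1 + \sum_(j < n) sqnorm2 (tnth x j)) `^ (- (n.+1%:R * a)))%R.

Lemma measurable_sqnorm2V_powR (a : R) D :
  measurable_fun D (fun p : R2 => (sqnorm2 p)^-1 * sqnorm2 p `^ a)%R.
Proof.
apply: measurable_funTS; apply: measurable_funM; last first.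
  exact: (measurableT_comp (@measurable_powR R a) measurable_sqnorm2).
rewrite (_ : (fun p => _) = fun p => sqnorm2 p `^ (-1)%R)%R.
  exact: (measurableT_comp (@measurable_powR R (-1)) measurable_sqnorm2).
by apply/funext => p; rewrite powR_inv1 ?sqnorm2_ge0.
Qed.

Lemma measurable_sum_sqnorm2 D :
  measurable_fun D (fun x => \sum_(j < n) sqnorm2 (tnth x j))%R.
Proof.
apply: measurable_sum => j; apply: measurable_funTS.
exact: (measurableT_comp measurable_sqnorm2 (measurable_tnth j)).
Qed.

Lemma measurable_zeta_real_fun (a : R) D : measurable_fun D (zeta_real_fun a).
Proof.
apply: measurable_funTS; apply: measurable_funM.
  exact: (measurable_prod_tnth (@measurable_sqnorm2V_powR a setT)).
apply: (measurableT_comp (@measurable_powR R _)); apply: measurable_funD => //.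
  exact: measurable_sum_sqnorm2.
Qed.

Lemma zeta_real_fun_ge0 (a : R) x : (0 <= zeta_real_fun a x)%R.
Proof.
rewrite mulr_ge0 ?powR_ge0// prodr_ge0// => j _.
by rewrite mulr_ge0 ?invr_ge0 ?sqnorm2_ge0 ?powR_ge0.
Qed.

(** After multiplication by [Gamma(c)], the factor [(1 + S) ^ (- c)] becomes an integral over [v] of
    functions that are products over the coordinates. The range of [a] is that of
    [integral_powR_expR_sqnorm2]. *)
Lemma integral_zeta_real_fun (a : R) : (0 < a < 1)%R ->
  \int[lebesgue_Cn R n]_x (zeta_real_fun a x)%:E =
  (pi ^+ n * rgamma a ^+ n.+1 / rgamma (n.+1%:R * a))%:E.
Proof.
move=> a01; have /andP[a0 a1] := a01.
pose c := (n.+1%:R * a)%R; have c0 : (0 < c)%R by rewrite mulr_gt0.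
have k0 := rgamma_gt0 c0.
pose phi (v : R) (p : R2) : R :=
  ((sqnorm2 p)^-1 * sqnorm2 p `^ a * expR (- (v * sqnorm2 p)))%R.
pose G (q : n.-tuple R2 * R) : R :=
  ((q.2 `^ (c - 1) * expR (- q.2)) * \prod_(j < n) phi q.2 (tnth q.1 j))%R.
have phi0 v p : (0 <= phi v p)%R.
  by rewrite !mulr_ge0 ?invr_ge0 ?sqnorm2_ge0 ?powR_ge0 ?expR_ge0.
have G0 q : (0 <= G q)%R.
  by rewrite !mulr_ge0 ?powR_ge0 ?expR_ge0// prodr_ge0.
have mG : measurable_fun setT G.
  apply: measurable_funM.
    exact: (measurableT_comp (@measurable_gamma_fun R c setT) measurable_snd).
  apply: measurable_prod => j _.
  have mt : measurable_fun setT (fun q : n.-tuple R2 * R => tnth q.1 j).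
    exact: (measurableT_comp (measurable_tnth j) measurable_fst).
  apply: measurable_funM.
    exact: (measurable_comp measurableT (@subsetT _ _) (@measurable_sqnorm2V_powR a setT) mt).
  apply: (measurableT_comp (@measurable_expR R)); apply: measurableT_comp => //.
  apply: measurable_funM; first exact: measurable_snd.
  exact: (measurableT_comp measurable_sqnorm2 mt).
suff key : (rgamma c)%:E * \int[lebesgue_Cn R n]_x (zeta_real_fun a x)%:E =
    (pi ^+ n * rgamma a ^+ n.+1)%:E.
  have : (rgamma c)^-1%:E * ((rgamma c)%:E * \int[lebesgue_Cn R n]_x (zeta_real_fun a x)%:E) =
      ((rgamma c)^-1 * (pi ^+ n * rgamma a ^+ n.+1))%:E by rewrite key -EFinM.
  by rewrite muleA -!EFinM mulVf ?gt_eqF// mul1e mulrC.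
rewrite -ge0_integral_EFinZl ?(ltW k0)//; last 2 first.
- exact: measurable_zeta_real_fun.
- by move=> x _; exact: zeta_real_fun_ge0.
transitivity (\int[lebesgue_Cn R n]_(x in setT) \int[mu]_(v in Rpos) (G (x, v))%:E).
  apply: eq_integral => x _; rewrite /G/=.
  set S := (\sum_(j < n) sqnorm2 (tnth x j))%R.
  set P := (\prod_(j < n) ((sqnorm2 (tnth x j))^-1 * sqnorm2 (tnth x j) `^ a))%R.
  have S0 : (0 < 1 + S)%R.
    by rewrite ltr_wpDr// sumr_ge0// => j _; exact: sqnorm2_ge0.
  have P0 : (0 <= P)%R.
    by apply: prodr_ge0 => j _; rewrite mulr_ge0 ?invr_ge0 ?sqnorm2_ge0 ?powR_ge0.
  transitivity (\int[mu]_(v in Rpos) (P * (v `^ (c - 1) * expR (- ((1 + S) * v))))%:E).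
    rewrite ge0_integral_EFinZl//; last 2 first.
    - exact: measurable_powR_expR.
    - by move=> v _; rewrite mulr_ge0 ?powR_ge0 ?expR_ge0.
    rewrite laplace_powR// rgammaE// -!EFinM; congr EFin.
    by rewrite /zeta_real_fun -/S -/P -/c; ring.
  apply: eq_integral => v _; congr EFin; rewrite /phi big_split/= -/P.
  have -> : (\prod_(j < n) expR (- (v * sqnorm2 (tnth x j))) = expR (- (v * S)))%R.
    by rewrite -expR_sum sumrN mulr_sumr.
  by rewrite mulrDl mul1r opprD expRD (mulrC S v); ring.
transitivity (\int[mu]_(v in Rpos) \int[lebesgue_Cn R n]_(x in setT) (G (x, v))%:E).
  exact: ge0_tonelli_set.
transitivity (\int[mu]_(v in Rpos)
    ((pi * rgamma a) ^+ n * (v `^ (a - 1) * expR (- v)))%:E).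
  apply: eq_integral => v; rewrite inE/= in_itv/= andbT => v0; rewrite /G/=.
  rewrite ge0_integral_EFinZl ?mulr_ge0 ?powR_ge0 ?expR_ge0//; last 2 first.
  - apply: measurable_prod_tnth; apply: measurable_funM.
      exact: measurable_sqnorm2V_powR.
    exact: measurable_expR_sqnorm2.
  - by move=> x _; exact: prodr_ge0.
  rewrite (integral_tuple_prod n _ (phi0 v) (integral_powR_expR_sqnorm2 a01 v0)); last first.
    apply: measurable_funM; first exact: measurable_sqnorm2V_powR.
    exact: measurable_expR_sqnorm2.
  rewrite -EFinM; congr EFin.
  (* The [n] planes contribute [v ^ (- n a)], which lowers [v ^ (c - 1)] to [v ^ (a - 1)]: the
     remaining integral is the last factor [Gamma(a)]. *)
  have -> : (c - 1 = (a - 1) + n%:R * a)%R by rewrite /c -natr1; ring.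
  rewrite powRD; last by apply/implyP => _; rewrite gt_eqF.
  have -> : (v `^ (n%:R * a) = (v `^ a) ^+ n)%R.
    by rewrite mulrC powRrM powR_mulrn ?powR_ge0.
  rewrite powRN; have va : (v `^ a != 0)%R by rewrite gt_eqF ?powR_gt0.
  have -> : ((pi * (v `^ a)^-1 * rgamma a) ^+ n = (pi * rgamma a) ^+ n / (v `^ a) ^+ n)%R.
    by rewrite -expr_div_n; congr (_ ^+ n)%R; ring.
  by field; rewrite expf_neq0.
rewrite ge0_integral_EFinZl//; last 3 first.
- exact: measurable_gamma_fun.
- by move=> v _; rewrite mulr_ge0 ?powR_ge0 ?expR_ge0.
- by rewrite exprn_ge0// mulr_ge0 ?pi_ge0 ?(ltW (rgamma_gt0 a0)).
rewrite -/(gammaE a) rgammaE// -EFinM; congr EFin.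
by rewrite exprMn exprSr mulrA.
Qed.

End ZetaReal.

(** * The complex Gamma function *)

Section GammaFunction.
Variable R : realType.
Local Notation C := (Cplx R).
Local Notation mu := (@lebesgue_measure R).
Local Notation Rpos := (`]0, +oo[%classic : set R).

Lemma taylor_cvg (f : C -> C) w a : taylor f w a -> f @ w^' --> f w.
Proof.
move=> hf; rewrite (taylor_at hf).
have /taylor_boundP[r r0 /(_ r (lexx _)) h] := hf.
apply/cvg_cnormP => e e0; apply/near_dcnormP.
exists (Num.min (1 / r) (e / r / r)); first by rewrite lt_min !divr_gt0.
move=> z _; rewrite lt_min !ltr_pdivlMr// => /andP[z1 z2].
have := h z 1%N; rewrite big_ord1 expr0 mulr1 expr1 => hz.
have /hz : r * cnorm (z - w) <= 1 by lra.
lra.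
Qed.

Lemma taylor_id w : exists a, taylor (id : C -> C) w a.
Proof.
eexists; apply: taylor_eq (taylorD (taylor_mulX (taylor_cst 1 w)) (taylor_cst w w)) => //= z.
by rewrite mulr1 subrK.
Qed.

(** Real zeros accumulate at [p = 1/2], so the dichotomy makes [f] vanish around [p]; the segment
    from [p] to [w] stays in the half-plane and carries this to [w]. The value at [w] itself is the
    constant Taylor coefficient. *)
Lemma half_plane_identity (f : C -> C) :
  (forall w, 0 < complex.Re w -> exists a, taylor f w a) ->
  (forall a : R, 0 < a < 1 -> f (a%:C)%C = 0) ->
  forall w, 0 < complex.Re w -> f w = 0.
Proof.
move=> tf fR w w0; pose p : C := ((2^-1)%:C)%C.
have mf z : 0 < complex.Re z -> meromorphic_at f z.
  by move=> /tf[a]; exact: taylor_meromorphic.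
have p0 : 0 < complex.Re p by rewrite /= invr_gt0.
have fp : \forall z \near p^', f z = 0.
  have [//|/near_dcnormP[e e0 he]] := meromorphic_at_dichotomy (mf p p0).
  pose d := Num.min (e / 2) (1 / 4); have d0 : 0 < d by rewrite lt_min !divr_gt0.
  have de : d <= e / 2 by rewrite ge_min lexx.
  have d1 : d <= 1 / 4 by rewrite ge_min lexx orbT.
  have E : ((2^-1 + d)%:C)%C - p = (d%:C)%C :> C by rewrite -rmorphB/= addrC addKr.
  have zp : ((2^-1 + d)%:C)%C != p :> C.
    by rewrite -subr_eq0 E -cnorm_eq0 cnorm_real normr_eq0 gt_eqF.
  have ze : cnorm (((2^-1 + d)%:C)%C - p) < e by rewrite E cnorm_real gtr0_norm//; lra.
  by have := he _ zp ze; rewrite fR ?eqxx//; apply/andP; split; lra.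
have : \forall z \near (p + (w - p))^', f z = 0.
  apply: meromorphic_identity fp => t /andP[t0 t1]; apply: mf.
  rewrite cReD cReM cReB/= mul0r subr0.
  have -> : 2^-1 + t * (complex.Re w - 2^-1) = (1 - t) * 2^-1 + t * complex.Re w by ring.
  have [->|tn0] := eqVneq t 0; first by rewrite subr0 mul1r mul0r addr0 invr_gt0.
  by rewrite ltr_wpDl ?mulr_ge0 ?subr_ge0 ?invr_ge0// mulr_gt0// lt_def tn0.
rewrite addrC subrK => fw; have [a ha] := tf w w0.
by rewrite (taylor_at ha) (taylor_near0 ha fw).
Qed.

Let gexp (t : R) : R := expR (- t).

Let mgexp : measurable_fun Rpos gexp.
Proof.
rewrite (_ : gexp = fun t => expR (- (1 * t))); first exact: measurable_expRN.
by apply/funext => t; rewrite mul1r.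
Qed.

Lemma euler_integral_mellin z : euler_integral z = mellin mu Rpos id gexp (z - 1) :> C.
Proof. by apply: eq_cintegral => t _; rewrite /mellin_fun mulrC. Qed.

Lemma integrable_gamma (b : R) : 0 < b ->
  mu.-integrable Rpos (fun t => (gexp t * t `^ (b - 1))%:E).
Proof.
move=> b0; apply/integrableP; split.
  apply/measurable_EFinP; apply: measurable_funM; first exact: mgexp.
  by apply: measurable_funTS; exact: measurable_powR.
rewrite [X in (X < _)%E](_ : _ = gammaE b); first exact: gammaE_lty.
by apply: eq_integral => t _; rewrite /= ger0_norm ?mulr_ge0 ?powR_ge0 ?expR_ge0// mulrC.
Qed.

Lemma taylor_euler_integral w : 0 < complex.Re w -> exists a, taylor (@euler_integral R) w a.
Proof.
move=> w0; pose d := complex.Re w / 2; have d0 : 0 < d by rewrite divr_gt0.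
have pos t : Rpos t -> 0 < t \/ gexp t = 0.
  by rewrite /= in_itv/= andbT => t0; left.
have ge0 t : Rpos t -> 0 <= gexp t by move=> _; exact: expR_ge0.
have h1 : mu.-integrable Rpos (fun t => (gexp t * t `^ (complex.Re (w - 1) - d))%:E).
  have -> : complex.Re (w - 1) - d = complex.Re w / 2 - 1 by rewrite cReB/= /d; field.
  by apply: integrable_gamma; exact: divr_gt0.
have h2 : mu.-integrable Rpos (fun t => (gexp t * t `^ (complex.Re (w - 1) + d))%:E).
  have -> : complex.Re (w - 1) + d = complex.Re w + d - 1 by rewrite cReB/=; ring.
  by apply: integrable_gamma; exact: addr_gt0.
have := @taylor_mellin _ (measurableTypeR R) R mu Rpos (measurable_itv _) id gexp
  (@measurable_id _ _ _) mgexp ge0 pos (w - 1) d d0 h1 h2.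
rewrite (_ : w - 1 = 1 * w + -1); last by ring.
move=> /taylor_affine h; eexists; apply: taylor_eq h => // z.
by rewrite euler_integral_mellin mul1r.
Qed.

Lemma euler_integral_real (a : R) : 0 < a -> euler_integral (a%:C)%C = ((rgamma a)%:C)%C :> C.
Proof.
move=> a0; apply: complex_eq; rewrite /euler_integral /cintegral/=.
  rewrite /rgamma /gammaE /Rintegral; congr fine; apply: eq_integral => t _.
  by rewrite !(subr0, mul0r, mulr0, cos0, mulr1).
rewrite [LHS](_ : _ = \int[mu]_(t in Rpos) (0 : R)); first by rewrite Rintegral_cst// mul0r.
by apply: eq_Rintegral => t _; rewrite !(subr0, mul0r, mulr0, sin0, addr0).
Qed.

Lemma euler_integralS (z : C) : 0 < complex.Re z -> euler_integral (z + 1) = z * euler_integral z.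
Proof.
move=> z0; apply/eqP; rewrite -subr_eq0; apply/eqP.
apply: (@half_plane_identity (fun z => euler_integral (z + 1) - z * euler_integral z)) z0.
  move=> w w0; have [a ha] := taylor_euler_integral w0.
  have [b hb] := taylor_id w.
  have [c hc] : exists c, taylor (@euler_integral R) (1 * w + 1) c.
    by apply: taylor_euler_integral; rewrite mul1r cReD/= addr_gt0.
  eexists; apply: taylor_eq (taylorB (taylor_affine hc) (taylorM hb ha)) => // x.
  by rewrite mul1r.
move=> a /andP[a0 _]; rewrite euler_integral_real// -(rmorph1 (real_complex R)) -rmorphD/=.
by rewrite euler_integral_real ?addr_gt0// rgammaS// rmorphM subrr.
Qed.

Lemma euler_integralDn (z : C) j : 0 < complex.Re z ->
  euler_integral (z + j%:R) = \prod_(k < j) (z + k%:R) * euler_integral z.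
Proof.
move=> z0; elim: j => [|j IH]; first by rewrite big_ord0 addr0 mul1r.
rewrite -natr1 addrA euler_integralS; last first.
  by rewrite -(rmorph_nat (real_complex R)) cReD/= ltr_wpDr.
by rewrite IH big_ord_recr/=; ring.
Qed.

Lemma cRe_addn (z : C) k : complex.Re (z + k%:R) = complex.Re z + k%:R.
Proof. by rewrite -(rmorph_nat (real_complex R)) cReD. Qed.

(** The shift chosen in [Gamma] jumps with [Re z]. Any larger shift gives the same value, as the
    additional factors, of positive real part, cancel; so one shift serves a whole neighbourhood. *)
Lemma GammaE (z : C) M : - complex.Re z < M%:R ->
  Gamma z = euler_integral (z + M%:R) / \prod_(k < M) (z + k%:R).
Proof.
move=> zM; rewrite /Gamma; set m := (if _ then _ else _).
have [mM mz] : (m <= M)%N /\ 0 < complex.Re z + m%:R.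
  rewrite /m; case: ifPn => [z0|]; first by rewrite addr0.
  rewrite -leNgt => z0; have nz0 : 0 <= - complex.Re z by rewrite oppr_ge0.
  have := truncn_itv nz0 => /andP[t1 t2]; split; last lra.
  by rewrite -(ltr_nat R) (le_lt_trans t1).
rewrite -(subnKC mM) natrD addrA (euler_integralDn (M - m)); last by rewrite cRe_addn.
rewrite big_split_ord/=.
have -> : \prod_(i < M - m) (z + (m + i)%N%:R) = \prod_(k < M - m) (z + m%:R + k%:R).
  by apply: eq_bigr => i _; rewrite natrD addrA.
have nz : \prod_(k < M - m) (z + m%:R + k%:R) != 0.
  apply/prodf_neq0 => k _; apply/eqP => /(congr1 (@complex.Re R)).
  by rewrite !cRe_addn/=; have := ler0n R k; lra.
by rewrite [X in _ = X / _]mulrC -mulf_div divff// mulr1.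
Qed.

Lemma Gamma_euler (z : C) : 0 < complex.Re z -> Gamma z = euler_integral z.
Proof.
by move=> z0; rewrite (@GammaE z 0%N) ?oppr_lt0// big_ord0 addr0 divr1.
Qed.

Lemma meromorphic_at_Gamma w : meromorphic_at (@Gamma R) w.
Proof.
(* The margin 1 makes the shift [M] valid on the unit disc around [w]. *)
pose M := (Num.truncn (`|complex.Re w| + 1)).+1.
have wM : `|complex.Re w| + 1 < M%:R.
  by have /andP[] := truncn_itv (addr_ge0 (normr_ge0 (complex.Re w)) ler01).
have wM' : - complex.Re w + 1 < M%:R.
  by apply: le_lt_trans wM; rewrite lerD2r -normrN ler_norm.
have [a ha] : exists a, taylor (@euler_integral R) (1 * w + M%:R) a.
  apply: taylor_euler_integral; rewrite mul1r cRe_addn; lra.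
have mE := taylor_meromorphic (taylor_affine ha).
have mP : meromorphic_at (fun z => (\prod_(k < M) (z + k%:R))^-1) w.
  apply: meromorphic_atV; apply: (@meromorphic_at_prod _ (fun k z => z + k%:R)) => k.
  have [b hb] := taylor_id w; exact: taylor_meromorphic (taylorD hb (taylor_cst k%:R w)).
apply: meromorphic_at_near (meromorphic_atM mE mP).
apply/near_dcnormP; exists 1 => // z _ z1; rewrite mul1r (@GammaE z M)//.
have := ler_Re_cnorm (z - w); rewrite cReB ler_norml => /andP[h _]; lra.
Qed.

Lemma Gamma_real (a : R) : 0 < a -> Gamma (a%:C)%C = ((rgamma a)%:C)%C :> C.
Proof. by move=> a0; rewrite Gamma_euler ?euler_integral_real. Qed.

Lemma meromorphic_identity_all (f : C -> C) w v : (forall z, meromorphic_at f z) ->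
  (\forall z \near w^', f z = 0) -> \forall z \near v^', f z = 0.
Proof.
move=> mf fw; have := @meromorphic_identity R f w (v - w) (fun t _ => mf _) fw.
by rewrite addrC subrK.
Qed.

(** Otherwise [Gamma (c * z)] would vanish near [c^-1] as well, contradicting positivity of Gamma at
    real arguments slightly above 1. It allows division by [Gamma (n.+1%:R * z)] off isolated
    points. *)
Lemma Gamma_near_neq0 (c w : C) : c != 0 -> \forall z \near w^', Gamma (c * z) != 0.
Proof.
move=> c0; pose f z := Gamma (c * z + 0).
have mf z : meromorphic_at f z by apply: meromorphic_at_affine => //; exact: meromorphic_at_Gamma.
have [fw|] := meromorphic_at_dichotomy (mf w); last by apply: filterS => z; rewrite /f addr0.
exfalso; have /near_dcnormP[e e0 he] := meromorphic_identity_all c^-1 mf fw.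
pose d : R := e / cnorm c^-1 / 2.
have nc : 0 < cnorm c^-1 by rewrite cnorm_gt0 invr_eq0.
have d0 : 0 < d by rewrite !divr_gt0.
pose z : C := c^-1 * ((1 + d)%:C)%C.
have E : z - c^-1 = c^-1 * (d%:C)%C by rewrite /z rmorphD/= rmorph1; ring.
have : f z = 0.
  apply: he.
    rewrite -subr_eq0 E; apply: mulf_neq0; first by rewrite invr_eq0.
    by rewrite -cnorm_eq0 cnorm_real normr_eq0 gt_eqF.
  rewrite E cnormM cnorm_real gtr0_norm// /d mulrA mulrCA divff ?gt_eqF// mulr1.
  by rewrite ltr_pdivrMr// ltr_pMr// ltr1n.
rewrite /f /z addr0 mulVKf// Gamma_real ?addr_gt0// => /complexI /eqP.
by rewrite gt_eqF// rgamma_gt0// addr_gt0.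
Qed.

End GammaFunction.

(** * The zeta integral and its finite part *)

Section Zeta.
Variable R : realType.
Variable n : nat.
Local Notation C := (Cplx R).
Local Notation R2 := (measurableTypeR R * measurableTypeR R)%type.
Implicit Types x : n.-tuple R2.

Let s := @coord_section R n.

(* 0 where some coordinate vanishes, as 0^-1 = 0 *)
Definition zeta_weight x : R := (\prod_(j < n) sqnorm2 (tnth x j))^-1.

(** This is [||s||^2] read in the affine chart ([fs_normsq_chart]). *)
Definition zeta_base x : R :=
  (\prod_(j < n) sqnorm2 (tnth x j)) * (1 + \sum_(j < n) sqnorm2 (tnth x j)) `^ (- n.+1%:R).

Let prod_ge0 x : 0 <= \prod_(j < n) sqnorm2 (tnth x j).
Proof. by apply: prodr_ge0 => j _; exact: sqnorm2_ge0. Qed.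

Let sum_ge0 x : 0 <= \sum_(j < n) sqnorm2 (tnth x j).
Proof. by apply: sumr_ge0 => j _; exact: sqnorm2_ge0. Qed.

Lemma powR_prod (F : 'I_n -> R) (a : R) : (forall j, 0 <= F j) ->
  (\prod_(j < n) F j) `^ a = \prod_(j < n) F j `^ a.
Proof.
move=> F0; suff [] : 0 <= \prod_(j < n) F j /\
  (\prod_(j < n) F j) `^ a = \prod_(j < n) F j `^ a by [].
elim/big_rec2: _ => [|j y z _ [z0 IH]]; first by rewrite powR1.
by rewrite powRM// IH mulr_ge0.
Qed.

Lemma zeta_weight_base (a : R) x :
  zeta_weight x * zeta_base x `^ a = zeta_real_fun a x.
Proof.
rewrite /zeta_weight /zeta_base powRM ?powR_ge0// -powRrM mulNr mulrA; congr (_ * _).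
rewrite powR_prod; last by move=> j; exact: sqnorm2_ge0.
by rewrite -prodfV -big_split.
Qed.

Lemma zeta_weight_ge0 x : 0 <= zeta_weight x.
Proof. by rewrite invr_ge0. Qed.

Lemma zeta_base_ge0 x : 0 <= zeta_base x.
Proof. by rewrite mulr_ge0 ?powR_ge0. Qed.

Lemma zeta_base_gt0 x : 0 < zeta_base x \/ zeta_weight x = 0.
Proof.
have [p0|p0] := eqVneq (\prod_(j < n) sqnorm2 (tnth x j)) 0.
  by right; rewrite /zeta_weight p0 invr0.
left; rewrite mulr_gt0 ?powR_gt0 ?ltr_wpDr//.
by rewrite lt_def p0 prod_ge0.
Qed.

(** Each of the [n] factors is at most [1 + S], and the denominator is [(1 + S) ^ (n + 1)]. *)
Lemma zeta_base_le1 x : zeta_base x <= 1.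
Proof.
set S := \sum_(j < n) sqnorm2 (tnth x j).
have S1 : 1 <= 1 + S by rewrite lerDl; exact: sum_ge0.
have S0 : 0 <= 1 + S by rewrite (le_trans _ S1).
rewrite /zeta_base -/S powR_invn// ler_pdivrMr ?exprn_gt0 ?(lt_le_trans _ S1)// mul1r.
apply: (@le_trans _ _ ((1 + S) ^+ n)); last by rewrite exprS ler_peMl ?exprn_ge0.
rewrite -[n in leRHS]card_ord -prodr_const; apply: ler_prod => j _.
rewrite sqnorm2_ge0/= /S (bigD1 j)//= addrCA lerDl addr_ge0//.
by apply: sumr_ge0 => i _; exact: sqnorm2_ge0.
Qed.

Lemma measurable_prod_sqnorm2 D :
  measurable_fun D (fun x => \prod_(j < n) sqnorm2 (tnth x j)).
Proof. by apply: measurable_prod_tnth; exact: measurable_sqnorm2. Qed.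

Lemma measurable_zeta_weight D : measurable_fun D zeta_weight.
Proof.
rewrite (_ : zeta_weight = fun x => (\prod_(j < n) sqnorm2 (tnth x j)) `^ (-1)).
  apply: measurable_funTS.
  exact: (measurableT_comp (@measurable_powR R (-1)) (@measurable_prod_sqnorm2 setT)).
by apply/funext => x; rewrite powR_inv1.
Qed.

Lemma measurable_zeta_base D : measurable_fun D zeta_base.
Proof.
apply: measurable_funTS; apply: measurable_funM; first exact: measurable_prod_sqnorm2.
apply: (measurableT_comp (@measurable_powR R _)); apply: measurable_funD => //.
exact: measurable_sum_sqnorm2.
Qed.

Lemma integrable_zeta (a : R) : 0 < a ->
  (lebesgue_Cn R n).-integrable setT (fun x => (zeta_weight x * zeta_base x `^ a)%:E).
Proof.
have small (b : R) : 0 < b < 1 ->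
    (lebesgue_Cn R n).-integrable setT (fun x => (zeta_weight x * zeta_base x `^ b)%:E).
  move=> b01; under eq_fun do rewrite zeta_weight_base.
  apply/integrableP; split; first by apply/measurable_EFinP; exact: measurable_zeta_real_fun.
  under eq_integral do rewrite abse_EFin ger0_norm ?zeta_real_fun_ge0//.
  by rewrite integral_zeta_real_fun// ltry.
move=> a0; have [a1|a1] := ltP a 1; first by apply: small; rewrite a0.
(* As [zeta_base] is at most 1, larger exponents are dominated by the exponent [1/2]. *)
apply: le_integrable (small 2^-1 _) => //.
- apply/measurable_EFinP; under eq_fun do rewrite zeta_weight_base.
  exact: measurable_zeta_real_fun.
- move=> x _ /=; rewrite lee_fin !ger0_norm ?mulr_ge0 ?zeta_weight_ge0 ?powR_ge0//.
  rewrite ler_wpM2l ?zeta_weight_ge0//.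
  have [f0|f0] := eqVneq (zeta_base x) 0.
    by rewrite f0 !powR0// ?invr_eq0// gt_eqF.
  apply: ger_powR; last by rewrite (le_trans _ a1)// invf_le1// ler1n.
  by rewrite zeta_base_le1 lt_def f0 zeta_base_ge0.
- by rewrite invr_gt0 invf_lt1// ltr1n ltr0n.
Qed.

Lemma normsq_prod (F : 'I_n -> C) : normsq (\prod_(j < n) F j) = \prod_(j < n) normsq (F j).
Proof.
apply: (big_morph _ (@normsqM R)).
by rewrite /normsq/= expr1n expr0n addr0.
Qed.

Lemma row_mx_chart0 (z : 'rV[C]_n) : (row_mx 1 z : 'rV[C]_n.+1) 0 ord0 = 1.
Proof.
have -> : ord0 = lshift n (0 : 'I_1) :> 'I_(1 + n) by apply: val_inj.
by rewrite -[RHS](_ : (1 : 'M[C]_1) 0 0 = 1); [exact: (row_mxEl (1 : 'M[C]_1) z)|rewrite mxE].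
Qed.

Lemma row_mx_chartS (z : 'rV[C]_n) j : (row_mx 1 z : 'rV[C]_n.+1) 0 (lift ord0 j) = z 0 j.
Proof.
have -> : lift ord0 j = rshift 1 j :> 'I_(1 + n) by apply: val_inj.
exact: (row_mxEr (1 : 'M[C]_1) z).
Qed.

Lemma fs_normsq_chart x :
  fs_normsq n.+1 s (affine_chart (point_of_tuple x)) = zeta_base x.
Proof.
rewrite /affine_chart fs_normsqE; last by move=> c Y; exact: coord_section_homog.
rewrite /= /s /coord_section !big_ord_recl row_mx_chart0 mul1r.
under eq_bigr do rewrite row_mx_chartS.
under [X in _ / (_ + X) ^+ _]eq_bigr do rewrite row_mx_chartS.
rewrite normsq_prod /zeta_base powR_invn; last by rewrite addr_ge0.
have -> : normsq (1 : C) = 1 by rewrite /normsq/= expr1n expr0n addr0.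
congr (_ / (_ + _) ^+ _); apply: eq_bigr => j _; by rewrite mxE.
Qed.

Lemma form_density_zeta (z : C) x :
  form_density (norm_power n.+1 s z) (@omega R n) x = mellin_fun zeta_base zeta_weight z x.
Proof.
rewrite /form_density /mellin_fun /norm_power fs_normsq_chart; congr (_ * _).
rewrite /omega normsq_prod.
have -> : \prod_(j < n) normsq (point_of_tuple x 0 j) = \prod_(j < n) sqnorm2 (tnth x j).
  by apply: eq_bigr => j _; rewrite mxE.
rewrite /zeta_weight fmorphV mulrA.
(* The change to real coordinates contributes [(- 2 i) ^ n], which the coefficient [(i / 2) ^ n] of
   [omega] normalises to 1. *)
suff -> : (- 2 * (('i)%C : C)) ^+ n * ((('i)%C : C) ^+ n / 2 ^+ n) = 1 by rewrite mul1r.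
by rewrite mulrA -exprMn -mulrA -expr2 sqr_i mulrNN mulr1 divff// expf_neq0// pnatr_eq0.
Qed.

Let J := zeta_integral n.+1 s (@omega R n).

Lemma zeta_integral_mellin z : J z = mellin (lebesgue_Cn R n) setT zeta_base zeta_weight z.
Proof. by apply: eq_cintegral => x _; exact: form_density_zeta. Qed.

Lemma taylor_zeta_integral w : 0 < complex.Re w ->
  (exists a, taylor J w a) /\ integrable_form (norm_power n.+1 s w) (@omega R n).
Proof.
move=> w0; pose d := complex.Re w / 2; have d0 : 0 < d by rewrite divr_gt0.
have h1 : (lebesgue_Cn R n).-integrable setT
    (fun x => (zeta_weight x * zeta_base x `^ (complex.Re w - d))%:E).
  apply: integrable_zeta; have -> : complex.Re w - d = complex.Re w / 2 by rewrite /d; field.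
  exact: divr_gt0.
have h2 : (lebesgue_Cn R n).-integrable setT
    (fun x => (zeta_weight x * zeta_base x `^ (complex.Re w + d))%:E).
  by apply: integrable_zeta; exact: addr_gt0.
have g0 x : setT x -> 0 <= zeta_weight x by move=> _; exact: zeta_weight_ge0.
have f0 x : setT x -> 0 < zeta_base x \/ zeta_weight x = 0 by move=> _; exact: zeta_base_gt0.
have mf := @measurable_zeta_base setT; have mg := @measurable_zeta_weight setT.
split.
  have h := taylor_mellin measurableT mf mg g0 f0 d0 h1 h2; eexists; apply: taylor_eq h => // z.
  by rewrite zeta_integral_mellin.
have := cintegrable_mellin measurableT mf mg g0 f0 d0 h1 h2.
by apply: eq_cintegrable => // x _; rewrite form_density_zeta.
Qed.

Lemma zeta_integral_real (a : R) : 0 < a < 1 ->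
  J (a%:C)%C = ((pi ^+ n * rgamma a ^+ n.+1 / rgamma (n.+1%:R * a))%:C)%C.
Proof.
move=> a01; rewrite zeta_integral_mellin; apply: complex_eq; rewrite /mellin /cintegral/=.
  rewrite /Rintegral (eq_integral (fun x => (zeta_real_fun a x)%:E)).
    by rewrite integral_zeta_real_fun.
  move=> x _; rewrite -zeta_weight_base /mellin_fun/= mul0r cos0 sin0.
  by rewrite !(mul0r, mulr0, subr0, mulr1, addr0).
rewrite [LHS](_ : _ = \int[lebesgue_Cn R n]_x (0 : R)); first by rewrite Rintegral_cst// mul0r.
apply: eq_Rintegral => x _; rewrite /mellin_fun/= mul0r cos0 sin0.
by rewrite !(mul0r, mulr0, subr0, mulr1, addr0).
Qed.

(** The product form keeps both sides analytic in the half-plane, whatever the zeros of Euler's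
    integral. *)
Lemma zeta_integral_euler w : 0 < complex.Re w ->
  J w * euler_integral (n.+1%:R * w) = ((pi ^+ n)%:C)%C * euler_integral w ^+ n.+1.
Proof.
move=> w0; apply/eqP; rewrite -subr_eq0; apply/eqP.
apply: (@half_plane_identity R (fun w => J w * euler_integral (n.+1%:R * w) -
   ((pi ^+ n)%:C)%C * euler_integral w ^+ n.+1)) w0.
  move=> v v0; have [[a ha] _] := taylor_zeta_integral v0.
  have [b hb] := taylor_euler_integral v0; have [c hc _] := taylorX n.+1 hb.
  have [e he] : exists e, taylor (@euler_integral R) (n.+1%:R * v + 0) e.
    apply: taylor_euler_integral; rewrite addr0 -(rmorph_nat (real_complex R)) cReM/= mul0r subr0.
    by rewrite mulr_gt0.
  have t := taylorB (taylorM ha (taylor_affine he)) (taylorZ ((pi ^+ n)%:C)%C hc).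
  eexists; rewrite (_ : (fun w => _) = fun z => J z * euler_integral (n.+1%:R * z + 0) -
    ((pi ^+ n)%:C)%C * euler_integral z ^+ n.+1); first exact: t.
  by apply/funext => z; rewrite addr0.
move=> a a01; have /andP[a0 _] := a01.
rewrite zeta_integral_real// -(rmorph_nat (real_complex R)) -rmorphM/=.
have na0 : 0 < n.+1%:R * a by rewrite mulr_gt0.
rewrite !euler_integral_real// -rmorphXn -!rmorphM/= -rmorphB/= divfK ?subrr//.
by rewrite gt_eqF// rgamma_gt0.
Qed.

(** * Meromorphic continuation and constant term *)

Definition gamma_quotient (z : C) : C := Gamma z ^+ n.+1 / Gamma (n.+1%:R * z).

Let n1_neq0 : (n.+1%:R : C) != 0. Proof. by rewrite pnatr_eq0. Qed.

Lemma meromorphic_at_gamma_quotient w : meromorphic_at gamma_quotient w.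
Proof.
apply: meromorphic_atM; first by apply: meromorphic_atX; exact: meromorphic_at_Gamma.
apply: meromorphic_atV.
have := @meromorphic_at_affine R (@Gamma R) w n.+1%:R 0 n1_neq0 (@meromorphic_at_Gamma R _).
by apply: meromorphic_at_near; apply: nearW => z; rewrite addr0.
Qed.

(** A continuation must equal [J] at every point of a half-plane, while the quotient takes the
    default value 0 wherever its denominator vanishes; hence the two branches. *)
Definition zeta_continuation (z : C) : C :=
  if 0 < complex.Re z then J z else ((pi ^+ n)%:C)%C * gamma_quotient z.

(** This glues the branches along [Re z = 0]: for [Re z > 0] they agree by [zeta_integral_euler]
    wherever [Gamma (n.+1%:R * z)] is nonzero, hence at all points near [w] except possibly [w]. *)
Lemma zeta_continuation_near (w : C) : complex.Re w <= 0 ->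
  \forall z \near w^', zeta_continuation z = ((pi ^+ n)%:C)%C * gamma_quotient z.
Proof.
move=> w0; have := Gamma_near_neq0 w n1_neq0; apply: filterS => z nz.
rewrite /zeta_continuation; case: ifPn => // z0.
have nz0 : 0 < complex.Re (n.+1%:R * z).
  by rewrite -(rmorph_nat (real_complex R)) cReM/= mul0r subr0 mulr_gt0.
rewrite Gamma_euler// in nz.
by rewrite /gamma_quotient !Gamma_euler// mulrA -zeta_integral_euler// mulfK.
Qed.

Lemma meromorphic_zeta_continuation : meromorphic zeta_continuation.
Proof.
apply/meromorphicP => w; have [w0|w0] := ltP 0 (complex.Re w); last first.
  have mG := meromorphic_atM (meromorphic_at_cst ((pi ^+ n)%:C)%C w) (meromorphic_at_gamma_quotient w).
  apply: meromorphic_at_near mG; have := zeta_continuation_near w0.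
  by apply: filterS => z ->.
have [[a /taylor_meromorphic mJ] _] := taylor_zeta_integral w0.
apply: meromorphic_at_near mJ; apply/near_dcnormP; exists (complex.Re w) => // z _ zw.
rewrite /zeta_continuation; case: ifPn => //; rewrite -leNgt => z0.
suff : 0 < complex.Re z by rewrite ltNge z0.
have := ler_Re_cnorm (z - w); rewrite cReB ler_norml => /andP[h _]; lra.
Qed.

Lemma zeta_meromorphic_continuation : meromorphic_continuation J zeta_continuation.
Proof.
split; first exact: meromorphic_zeta_continuation.
by exists 0 => z z0; rewrite /zeta_continuation z0.
Qed.

(** Both agree with [I] to the right of [max c1 c2]; their difference vanishes around a point there,
    hence everywhere up to isolated points. *)
Lemma meromorphic_continuation_unique (I F1 F2 : C -> C) w :
  meromorphic_continuation I F1 -> meromorphic_continuation I F2 ->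
  \forall z \near w^', F1 z = F2 z.
Proof.
move=> [/meromorphicP m1 [c1 h1]] [/meromorphicP m2 [c2 h2]].
pose c := Num.max c1 c2; pose p : C := ((c + 1)%:C)%C.
have near0 : \forall z \near p^', F1 z - F2 z = 0.
  apply/near_dcnormP; exists 1 => // z _ zp.
  have zc : c < complex.Re z.
    have := ler_Re_cnorm (z - p); rewrite cReB ler_norml => /andP[h _].
    by move: h; rewrite /p/=; lra.
  rewrite h1 ?h2 ?subrr// (le_lt_trans _ zc)// /c le_max lexx ?orbT//.
have := meromorphic_identity_all w (fun z => meromorphic_atB (m1 z) (m2 z)) near0.
by apply: filterS => z /eqP; rewrite subr_eq0 => /eqP.
Qed.

(** [get] returns an unspecified admissible value; uniqueness of the continuation and of Laurent
    coefficients leaves only [a0]. *)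
Lemma finite_partE (I F : C -> C) a0 : meromorphic_continuation I F ->
  constant_term F 0 a0 -> finite_part I = a0.
Proof.
move=> cF tF; rewrite /finite_part.
have /getPex[F' [cF' [m' [a' [l' <-]]]]] :
    [set a0 | exists F, meromorphic_continuation I F /\ constant_term F 0 a0] !=set0.
  by exists a0, F.
have [m [a [l <-]]] := tF.
apply: laurent_coef0_unique l' l _.
exact: meromorphic_continuation_unique cF' cF.
Qed.

Let h (z : C) : C := z ^+ n * Gamma z ^+ n.+1 / Gamma (n.+1%:R * z).
Let H := remove_singularity h 0.

(** What [h] becomes after substituting [Gamma(y) = E(y + 1) / y] for [y = z] and [y = (n + 1) z],
    with [E] Euler's integral: all powers of [z] cancel and a factor [n + 1] remains. *)
Let h1 (z : C) : C :=
  n.+1%:R * (euler_integral (1 * z + 1) ^+ n.+1 * (euler_integral (n.+1%:R * z + 1))^-1).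

Lemma gamma_quotient_near0 : \forall z \near 0^', h z = h1 z.
Proof.
(* On this disc [z] and [(n + 1) z] both have modulus below 1, so a shift by 1 suffices in
   [GammaE]. *)
apply/near_dcnormP; exists (n.+1%:R^-1); first by rewrite invr_gt0.
move=> z z0; rewrite subr0 => zn.
have nz1 : cnorm (n.+1%:R * z) < 1.
  by rewrite cnormM cnorm_nat mulrC -ltr_pdivlMr// div1r.
have z1 : cnorm z < 1 by rewrite (lt_le_trans zn)// invf_le1 ?ler1n.
have G1 (y : C) : cnorm y < 1 -> Gamma y = euler_integral (y + 1) / y.
  move=> y1; rewrite (@GammaE R y 1) ?big_ord1 ?addr0//.
  by apply: le_lt_trans y1; rewrite (le_trans _ (ler_Re_cnorm y))// -normrN ler_norm.
rewrite /h /h1 mul1r !G1// exprMn exprVn invfM invrK.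
move: (euler_integral (n.+1%:R * z + 1))^-1 => B; rewrite (exprS z); field.
by rewrite z0 expf_neq0.
Qed.

(** [h1] is analytic at 0 because the denominator takes there the value [Gamma(1) > 0]. It equals
    [h] off 0, and its continuity identifies the limit used in [remove_singularity] with [h1 0]. *)
Lemma taylor_removed : exists b, taylor H 0 b.
Proof.
have [a ha] : exists a, taylor (@euler_integral R) (1 * 0 + 1) a.
  by apply: taylor_euler_integral; rewrite mulr0 add0r.
have [b hb b0] := taylorX n.+1 (taylor_affine ha).
have [c hc] : exists c, taylor (@euler_integral R) (n.+1%:R * 0 + 1) c.
  by apply: taylor_euler_integral; rewrite mulr0 add0r.
have hc' := taylor_affine hc.
have c0 : c 0%N * n.+1%:R ^+ 0 != 0.
  rewrite expr0 mulr1 -(taylor_at hc) mulr0 add0r -(rmorph1 (real_complex R)).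
  rewrite euler_integral_real// -cnorm_eq0 cnorm_real normr_eq0 gt_eqF// rgamma_gt0//.
have th1 := taylorZ n.+1%:R (taylorM hb (taylorV hc' c0)).
have Hh : \forall z \near 0, h1 z = H z.
  have := gamma_quotient_near0 => /near_dcnormP[e e0 he].
  apply/near_cnormP; exists e => // z ze; rewrite /H /remove_singularity.
  case: eqVneq => [->|z0]; last by rewrite he.
  apply/esym/cvg_lim; first exact: norm_hausdorff.
  have := taylor_cvg th1; apply: cvg_trans; apply: near_eq_cvg.
  by have := gamma_quotient_near0; apply: filterS => y ->.
by eexists; exact: taylor_near Hh th1.
Qed.

(** Near 0 the continuation times [z ^ n] is [pi ^ n * H], so the Laurent coefficient of index 0 is
    the Taylor coefficient of index [n]. *)
Lemma constant_term_zeta b : taylor H 0 b ->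
  constant_term zeta_continuation 0 (((pi ^+ n)%:C)%C * b n).
Proof.
move=> hb; have hpb := taylorZ (((pi ^+ n)%:C)%C : C) hb.
exists n; eexists; split.
  apply: (taylor_laurent hpb); have := @zeta_continuation_near 0 (lexx _).
  move=> /near_dcnormP[e e0 he]; apply/near_dcnormP; exists e => // z z0 ze.
  rewrite he// subr0 /H /remove_singularity (negbTE z0) /h /gamma_quotient.
  by rewrite -!mulrA; congr (_ * _); rewrite !mulrA mulrC !mulrA.
by cbv beta; rewrite add0r.
Qed.

End Zeta.

Theorem mainTheorem12 (R : realType) (n : nat) (hn : (1 <= n)%N) :
  let s := @coord_section R n in
  let H := remove_singularity
    (fun lambda : Cplx R =>
       lambda ^+ n * Gamma lambda ^+ n.+1 / Gamma (n.+1%:R * lambda)) 0 in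
  [/\ converges_holomorphically n.+1 s (@omega R n),
      exists F, meromorphic_continuation (zeta_integral n.+1 s (@omega R n)) F,
      \forall lambda \near (0 : Cplx R), derivable H lambda 1 &
      fp_integral n.+1 s (@omega R n) =
        (((pi ^+ n / n`!%:R : R)%:C)%C : Cplx R) * derive1n n H 0].
Proof.
move=> s H; have [b hb] := taylor_removed R n; split.
- exists 0 => w w0; have [[a ha] iw] := taylor_zeta_integral n w0; split=> //.
  by have [] := taylor_derive ha.
- by exists (zeta_continuation n); exact: zeta_meromorphic_continuation.
- by have [] := taylor_derive1 hb.
rewrite /fp_integral (finite_partE (zeta_meromorphic_continuation R n) (constant_term_zeta hb)).
rewrite (taylor_derive1n n hb) mulrA; congr (_ * _).
rewrite -(rmorph_nat (real_complex R)) -rmorphM/= divfK//.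
Qed.
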